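(* (1) The collection $\mathcal{C}^3_{\rm S}$ of all simplified copulas is nowhere dense in $(\mathcal{C}^3,D_1)$ and in $(\mathcal{C}^3,D_\infty)$. (2) $\mathcal{C}^3_{\rm S}$ is nowhere dense in $\mathcal{C}^3$ with respect to the topology induced by weak conditional convergence. (3) The collection of all simplified copulas with positive density is nowhere dense in $(\mathcal{C}^3_{{\rm ac},>0},D_1)$ and in $(\mathcal{C}^3_{{\rm ac},>0},D_\infty)$.
   Context: $\mathbb{I}=[0,1]$, $\lambda^k$ Lebesgue measure on $\mathbb{I}^k$ ($\lambda=\lambda^1$). $\mathcal{C}^3$ is the set of three-dimensional copulas; points are written $(\mathbf{u},v)$, $\mathbf{u}\in\mathbb{I}^2$. For $C\in\mathcal{C}^3$, $K_C:\mathbb{I}\times\mathcal{B}(\mathbb{I}^2)\to\mathbb{I}$ is (a version of) the regular conditional distribution of $(U_1,U_2)$ given $U_3=v$, $(U_1,U_2,U_3)\sim C$; $F_{1|3}(u_1|t)=K_C(t,[0,u_1]\times\mathbb{I})$, $F_{2|3}(u_2|t)=K_C(t,\mathbb{I}\times[0,u_2])$. $C$ is simplified if there is a bivariate copula $A$ with $C(\mathbf{u},v)=\int_{[0,v]}A(F_{1|3}(u_1|t),F_{2|3}(u_2|t))\,d\lambda(t)$ for all $(\mathbf{u},v)$ and, for $\lambda$-a.e. $t$, $F_{1|3}(\cdot|t)$ and $F_{2|3}(\cdot|t)$ are continuous. $D_1(C_1,C_2)=\int_{\mathbb{I}^2}\int_{\mathbb{I}}|K_{C_1}(v,[\mathbf{0},\mathbf{u}])-K_{C_2}(v,[\mathbf{0},\mathbf{u}])|\,d\lambda(v)\,d\lambda^2(\mathbf{u})$,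 $D_\infty(C_1,C_2)=\sup_{\mathbf{u}\in\mathbb{I}^2}\int_{\mathbb{I}}|K_{C_1}(v,[\mathbf{0},\mathbf{u}])-K_{C_2}(v,[\mathbf{0},\mathbf{u}])|\,d\lambda(v)$. A sequence $(C_n)$ converges weakly conditional to $C$ if for $\lambda$-a.e. $v$ the probability measures $K_{C_n}(v,\cdot)$ converge weakly to $K_C(v,\cdot)$. $\mathcal{C}^3_{{\rm ac},>0}$ denotes the set of absolutely continuous three-dimensional copulas whose density is positive ($\lambda^3$-a.e.). A set is nowhere dense if its closure has empty interior. *)

(* Defs.v *)
From HB Require Import structures.
From mathcomp Require Import all_boot all_order all_algebra.
From mathcomp Require Import all_classical all_reals all_analysis.
Set Implicit Arguments. Unset Strict Implicit. Unset Printing Implicit Defensive.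
Import Order.TTheory GRing.Theory Num.Theory.
Import numFieldNormedType.Exports.
Local Open Scope classical_set_scope.
Local Open Scope ring_scope.

Section Copulas.
Variable R : realType.

Local Notation lam := (@lebesgue_measure R).
Local Notation lam2 := (lam \x lam)%E.
Local Notation lam3 := ((lam \x lam) \x lam)%E.

Definition in01 (x : R) : Prop := 0 <= x <= 1.

Definition Icc (a b : R) : set R := `[a, b].

Definition clamp01 (x : R) : R := Num.max 0 (Num.min x 1).

(* Three-dimensional copulas, points written C u1 u2 v (u = (u1,u2)).
   As usual the copula is a function on I^3; we identify it with its
   canonical extension to R^3 (the distribution function of the
   corresponding law on I^3), C x = C (clamp x). *)
Definition volume3 (C : R -> R -> R -> R) (a1 b1 a2 b2 a3 b3 : R) : R :=
  C b1 b2 b3 - C a1 b2 b3 - C b1 a2 b3 - C b1 b2 a3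
  + C a1 a2 b3 + C a1 b2 a3 + C b1 a2 a3 - C a1 a2 a3.

Definition is_copula3 (C : R -> R -> R -> R) : Prop :=
  [/\ (forall x y z, C x y z = C (clamp01 x) (clamp01 y) (clamp01 z)),
      (forall x y, in01 x -> in01 y ->
         [/\ C 0 x y = 0, C x 0 y = 0 & C x y 0 = 0]),
      (forall x, in01 x -> [/\ C x 1 1 = x, C 1 x 1 = x & C 1 1 x = x]) &
      (forall a1 b1 a2 b2 a3 b3, in01 a1 -> in01 b1 -> in01 a2 -> in01 b2 ->
         in01 a3 -> in01 b3 -> a1 <= b1 -> a2 <= b2 -> a3 <= b3 ->
         0 <= volume3 C a1 b1 a2 b2 a3 b3)].

Definition copula3 : set (R -> R -> R -> R) := [set C | is_copula3 C].

(* Bivariate copulas (only their values on I^2 matter). *)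
Definition is_copula2 (A : R -> R -> R) : Prop :=
  [/\ (forall x, in01 x -> A 0 x = 0 /\ A x 0 = 0),
      (forall x, in01 x -> A x 1 = x /\ A 1 x = x) &
      (forall a1 b1 a2 b2, in01 a1 -> in01 b1 -> in01 a2 -> in01 b2 ->
         a1 <= b1 -> a2 <= b2 ->
         0 <= A b1 b2 - A a1 b2 - A b1 a2 + A a1 a2)].

Definition box (u1 u2 : R) : set (R * R) := Icc 0 u1 `*` Icc 0 u2.

(* K is (a version of) the regular conditional distribution K_C of
   (U1,U2) given U3 = v, (U1,U2,U3) ~ C: a probability (Markov) kernel
   from R to R x R such that P((U1,U2) in [0,u], U3 in [0,v])
   = int_[0,v] K(t,[0,u]) dlambda(t) for all (u,v) in I^3. *)
Definition is_cond_kernel (C : R -> R -> R -> R)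
    (K : R.-pker R ~> (R * R)%type) : Prop :=
  forall u1 u2 v, in01 u1 -> in01 u2 -> in01 v ->
    (C u1 u2 v)%:E = (\int[lam]_(t in Icc 0 v) K t (box u1 u2))%E.

Definition D1_of (K1 K2 : R.-pker R ~> (R * R)%type) : \bar R :=
  (\int[lam2]_(u in Icc 0 1 `*` Icc 0 1)
     \int[lam]_(v in Icc 0 1) `|K1 v (box u.1 u.2) - K2 v (box u.1 u.2)|)%E.

Definition Dinf_of (K1 K2 : R.-pker R ~> (R * R)%type) : \bar R :=
  ereal_sup [set (\int[lam]_(v in Icc 0 1)
       `|K1 v (box u.1 u.2) - K2 v (box u.1 u.2)|)%E
     | u in Icc 0 1 `*` Icc 0 1].

(* D_1 and D_infty: the value of the above for any versions of the kernels
   (it does not depend on the versions chosen). *)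
Definition D1 (C1 C2 : R -> R -> R -> R) : R :=
  xget 0 [set d : R | forall K1 K2, is_cond_kernel C1 K1 -> is_cond_kernel C2 K2 ->
                      d%:E = D1_of K1 K2].

Definition Dinf (C1 C2 : R -> R -> R -> R) : R :=
  xget 0 [set d : R | forall K1 K2, is_cond_kernel C1 K1 -> is_cond_kernel C2 K2 ->
                      d%:E = Dinf_of K1 K2].

Definition F13 (K : R.-pker R ~> (R * R)%type) (t u1 : R) : R :=
  fine (K t (Icc 0 u1 `*` Icc 0 1)).
Definition F23 (K : R.-pker R ~> (R * R)%type) (t u2 : R) : R :=
  fine (K t (Icc 0 1 `*` Icc 0 u2)).

Definition simplified (C : R -> R -> R -> R) : Prop :=
  is_copula3 C /\
  exists K : R.-pker R ~> (R * R)%type, is_cond_kernel C K /\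
  exists A : R -> R -> R, is_copula2 A /\
    (forall u1 u2 v, in01 u1 -> in01 u2 -> in01 v ->
      (C u1 u2 v)%:E =
        (\int[lam]_(t in Icc 0 v) (A (F13 K t u1) (F23 K t u2))%:E)%E) /\
    {ae lam, forall t, in01 t ->
       {within Icc 0 1, continuous (F13 K t)} /\
       {within Icc 0 1, continuous (F23 K t)}}.

Definition weak_cvg (mu_ : nat -> {measure set (R * R) -> \bar R})
    (mu : {measure set (R * R) -> \bar R}) : Prop :=
  forall f : R * R -> R, continuous f -> (exists M, forall x, `|f x| <= M) ->
    (fun n => (\int[mu_ n]_x (f x)%:E)%E) @ \oo --> (\int[mu]_x (f x)%:E)%E.

Definition wcc (Cn : nat -> R -> R -> R -> R) (C : R -> R -> R -> R) : Prop :=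
  forall (Kn : nat -> R.-pker R ~> (R * R)%type) (K : R.-pker R ~> (R * R)%type),
    (forall n, is_cond_kernel (Cn n) (Kn n)) -> is_cond_kernel C K ->
    {ae lam, forall v, in01 v ->
       weak_cvg (fun n => Kn n v) (K v)}.

Definition ac_pos (C : R -> R -> R -> R) : Prop :=
  is_copula3 C /\
  exists c : (R * R) * R -> R,
    [/\ measurable_fun setT c, (forall x, 0 <= c x),
        (forall u1 u2 v, in01 u1 -> in01 u2 -> in01 v ->
           (C u1 u2 v)%:E =
             (\int[lam3]_(x in (Icc 0 u1 `*` Icc 0 u2) `*` Icc 0 v) (c x)%:E)%E) &
        {ae lam3, forall x, ((Icc 0 1 `*` Icc 0 1) `*` Icc 0 1) x -> 0 < c x}].

End Copulas.

Section Top.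
Variables (R : realType) (T : Type).

Definition metric_open (X : set T) (d : T -> T -> R) (U : set T) : Prop :=
  U `<=` X /\ forall x, U x -> exists2 r : R, 0 < r & forall y, X y -> d x y < r -> U y.

(* open sets of the topology on X induced by a sequential convergence
   notion conv: complements (in X) of sets closed under conv-limits *)
Definition seq_open (X : set T) (conv : (nat -> T) -> T -> Prop) (U : set T) : Prop :=
  U `<=` X /\ forall (xn : nat -> T) x, (forall n, X (xn n) /\ ~ U (xn n)) ->
     X x -> conv xn x -> ~ U x.

Definition closed_in (X : set T) (op : set T -> Prop) (F : set T) : Prop :=
  F `<=` X /\ op (X `\` F).

Definition closure_in (X : set T) (op : set T -> Prop) (S : set T) : set T :=
  [set x | X x /\ forall F, closed_in X op F -> S `<=` F -> F x].

Definition nowhere_dense_in (X : set T) (op : set T -> Prop) (S : set T) : Prop :=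
  forall U, op U -> U `<=` closure_in X op S -> U = set0.
End Top.

(* Main.v *)
(* Fix a copula C. By a pigeonhole argument, the values of its conditional kernel
   on [0,(1/2,1/2)], [0,(1/2,1)] and [0,(1,1/2)] are almost constant in the
   conditioning variable on some set of positive measure, which we split into two
   pieces T and T'. Mix into C a small multiple e of a copula that is conditionally
   independent off T and, given the third coordinate in T, puts its mass on two
   diagonal squares of side 1/2. This moves C by at most e in D_1 and D_infty. The
   conditional margins at 1/2 stay almost equal on T and T', while the conditional
   values at (1/2,1/2) now differ by about e/4. As a bivariate copula is
   1-Lipschitz, this is incompatible with being (close to) a simplified copula,
   where closeness is measured by the integrals in D_infty at the three points
   only. Neighbourhoods for these three integrals are open in all the topologies
   considered: for D_1 because the integrals are Lipschitz in the point, for weak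
   conditional convergence because the margins of a copula are uniform.
   Every copula has a conditional kernel, obtained by iterating a quantile
   transform built from Radon-Nikodym derivatives. *)
Require Import Defs.
From HB Require Import structures.
From mathcomp Require Import all_boot all_order all_algebra.
From mathcomp Require Import all_classical all_reals all_analysis measurable_realfun.
From mathcomp Require Import ring lra.
Set Implicit Arguments. Unset Strict Implicit. Unset Printing Implicit Defensive.
Import Order.TTheory GRing.Theory Num.Theory.
Import numFieldNormedType.Exports.
Local Open Scope classical_set_scope.
Local Open Scope ring_scope.

(** [D1], [Dinf] and [wcc] quantify over all versions of the kernels, so they carry information only
    once kernels exist and are almost surely unique at each point. The points (1/2,1) and (1,1/2)
    are those where a kernel returns the conditional margins that enter the bivariate copula [A] of
    a simplified copula, and at (1/2,1/2) it returns the value of [A]; three numbers per time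
    therefore refute simplification, whatever [A] is. A kernel need not be continuous in the point,
    and this shapes the topological half: only averages over time are Lipschitz, because averaging
    gives back a copula with uniform margins. Under weak conditional convergence there are no balls,
    so a mixture is brought into an open set by letting e tend to 0 along a sequence. The set T may
    change with each term, since almost surely the mixture moves the kernel by at most e on every
    event. *)

Definition pushm d d' (T1 : measurableType d) (T2 : measurableType d') (R : realType)
    (m : {measure set T1 -> \bar R}) (f : T1 -> T2) (mf : measurable_fun setT f) :
    {measure set T2 -> \bar R} :=
  measure_function_pushforward__canonical__measure_function_Measure m mf.

Definition restrm d (T : measurableType d) (R : realType)
    (m : {measure set T -> \bar R}) (D : set T) (mD : measurable D) :
    {measure set T -> \bar R} := mrestr m mD.

(** * Measures determined by rational rays and quadrants *)

Section MeasureUniqueness.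
Variable R : realType.
Local Open Scope ereal_scope.

Definition rat_rays : set (set R) := [set `]-oo, ratr q]%classic | q in [set: rat]].

Lemma measurable_rat_rays : @measurable _ R = <<s rat_rays >>.
Proof.
rewrite [LHS](RGenInftyO.measurableE R).
apply/seteqP; split.
- apply: smallest_sub; first exact: smallest_sigma_algebra.
  move=> _ [r ->].
  have -> : `]-oo, r[%classic =
      \bigcup_(q in [set q : rat | (ratr q < r)%R]) `]-oo, (ratr q : R)]%classic.
    apply/seteqP; split => [y /=|y [q /= qr]]; rewrite /= !in_itv/=.
      by move=> /rat_in_itvoo[q]; rewrite in_itv/= => /andP[yq qr]; exists q => //=;
        rewrite in_itv/= ltW.
    by move/le_lt_trans; apply.
  rewrite bigcup_mkcond.
  apply: (@bigcupT_measurable_rat _ (g_sigma_algebraType rat_rays)) => q.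
  case: ifP => _; last exact: measurable0.
  by apply: sub_sigma_algebra; exists q.
- apply: smallest_sub; first exact: smallest_sigma_algebra.
  move=> _ [q _ <-]; rewrite -(RGenInftyO.measurableE R).
  exact: measurable_itv.
Qed.

Lemma measure_eq_rat_rays (m1 m2 : {measure set R -> \bar R}) :
  (forall q : rat, m1 `]-oo, ratr q]%classic < +oo) ->
  (forall q : rat, m1 `]-oo, ratr q]%classic = m2 `]-oo, ratr q]%classic) ->
  forall A, measurable A -> m1 A = m2 A.
Proof.
move=> fin m12; apply: (measure_unique rat_rays (fun n : nat => `]-oo, ratr n%:R]%classic)).
- exact: measurable_rat_rays.
- move=> _ _ [p _ <-] [q _ <-]; exists (Order.min p q) => //.
  apply/seteqP; split => x /=; rewrite !in_itv/= ?le_min.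
    by case: (leP p q) => pq xp; split => //; apply: (le_trans xp); rewrite ler_rat// ltW.
  by case: (leP p q) => pq [].
- by move=> n; exists n%:R.
- apply/seteqP; split => // x _; exists (Num.bound `|x|%R) => //=.
  by rewrite in_itv/= ratr_nat (le_trans (ler_norm _))// ltW// archi_boundP.
- by move=> _ [q _ <-].
- by move=> n; exact: fin.
Qed.

Definition rat_quad (p q : rat) : set (R * R) :=
  `]-oo, ratr p]%classic `*` `]-oo, ratr q]%classic.

(** Rational corners keep the generating family countable, so that almost sure identities on single
    quadrants can be merged into one null set. The plane is reduced to the line twice: with one
    factor fixed, the mass of a rectangle is, as a function of the other factor, a projection of a
    restricted measure. *)
Lemma measure_eq_rat_quad (m1 m2 : {measure set (R * R) -> \bar R}) :
  m1 setT < +oo ->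
  (forall p q : rat, m1 (rat_quad p q) = m2 (rat_quad p q)) ->
  forall A, measurable A -> m1 A = m2 A.
Proof.
move=> fin m12.
have finS A : measurable A -> m1 A < +oo.
  by move=> mA; apply: le_lt_trans fin; apply: le_measure => //; rewrite inE.
have mfst B : measurable B -> measurable (@setT R `*` B :> set (R * R)).
  by move=> mB; exact: measurableX.
have st1 (B : set R) (mB : measurable B) :
    (forall p : rat, m1 (`]-oo, ratr p]%classic `*` B) = m2 (`]-oo, ratr p]%classic `*` B)) ->
    forall A, measurable A -> m1 (A `*` B) = m2 (A `*` B).
  move=> h A mA.
  have E (m : {measure set (R * R) -> \bar R}) D : measurable D ->
      pushm (restrm m (mfst _ mB)) (@measurable_fst _ _ R R) D = m (D `*` B).
    move=> mD; rewrite /= /pushforward /= /mrestr; congr (m _).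
    by apply/seteqP; split => -[x y] /=; tauto.
  rewrite -!E//; apply: measure_eq_rat_rays => // q; rewrite ?E//.
    by apply: finS; exact: measurableX.
have st2 (B : set R) (mB : measurable B) :
    (forall p : rat, m1 (B `*` `]-oo, ratr p]%classic) = m2 (B `*` `]-oo, ratr p]%classic)) ->
    forall A, measurable A -> m1 (B `*` A) = m2 (B `*` A).
  move=> h A mA.
  have mB' : measurable (B `*` @setT R) by exact: measurableX.
  have E (m : {measure set (R * R) -> \bar R}) D : measurable D ->
      pushm (restrm m mB') (@measurable_snd _ _ R R) D = m (B `*` D).
    move=> mD; rewrite /= /pushforward /= /mrestr; congr (m _).
    by apply/seteqP; split => -[x y] /=; tauto.
  rewrite -!E//; apply: measure_eq_rat_rays => // q; rewrite ?E//.
    by apply: finS; exact: measurableX.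
have rect A B : measurable A -> measurable B -> m1 (A `*` B) = m2 (A `*` B).
  move=> mA mB; apply: st2 => // q; apply: st1 => // p; exact: m12.
apply: (measure_unique [set A `*` B | A in measurable & B in measurable] (fun=> setT)) => //.
- exact: measurable_prod_measurableType.
- move=> _ _ [A mA [B mB <-]] [C mC [D mD <-]].
  by rewrite -setXI; exists (A `&` C); [exact: measurableI|exists (B `&` D) => //; exact: measurableI].
- by move=> _; exists setT => //; exists setT => //; rewrite setXTT.
- by apply: bigcup_const; exists 0%N.
- by move=> _ [A mA [B mB <-]]; exact: rect.
Qed.

End MeasureUniqueness.

(** * Densities of dominated measures *)

Section Densities.
Context d (X : measurableType d) (R : realType).
Variable mu : {finite_measure set X -> \bar R}.
Local Open Scope ereal_scope.

(** On the set where [g < f] the difference [f - g] is nonnegative with nonpositive integral, so it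
    vanishes almost everywhere there, which strictness forbids. *)
Lemma ae_le_of_integral_le (f g : X -> \bar R) :
  mu.-integrable setT f -> mu.-integrable setT g ->
  (forall A, measurable A -> \int[mu]_(x in A) f x <= \int[mu]_(x in A) g x) ->
  {ae mu, forall x, f x <= g x}.
Proof.
move=> fi gi fg.
have mf := measurable_int _ fi; have mg := measurable_int _ gi.
have sub0 (a b : \bar R) : a < b -> 0 <= b - a.
  case: a b => [r||] [s||] //; rewrite ?le0y //.
  by rewrite lte_fin -EFinB lee_fin subr_ge0 => /ltW.
pose E := [set x | g x < f x].
have mE : measurable E by rewrite -[E]setTI; exact: measurable_lte.
have fiE := integrableS measurableT mE (@subsetT _ E) fi.
have giE := integrableS measurableT mE (@subsetT _ E) gi.
have mfg : measurable_fun E (f \- g) by exact/measurable_int/(integrableB mE fiE giE).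
have : \int[mu]_(x in E) `|(f \- g) x| = 0.
  apply/eqP; rewrite eq_le integral_ge0 ?andbT//.
  rewrite (eq_integral (f \- g)); last first.
    by move=> x; rewrite inE => /= xE; rewrite gee0_abs//; exact: sub0.
  rewrite integralB// leeBlDr ?add0e; first exact: fg.
  exact: integrable_fin_num.
move/(ae_eq_integral_abs _ mE mfg) => [N [mN N0 EN]].
exists N; split => // x /= fgx; apply: EN => /= h.
have Ex : E x by rewrite /E/= ltNge; exact/negP.
move: Ex (h Ex); rewrite /E/=; case: (g x) (f x) => [r||] [s||] //.
by move=> + /eqP; rewrite -EFinB eqe subr_eq0 lte_fin => rs /eqP sr; rewrite sr ltxx in rs.
Qed.

(** Domination puts the Radon-Nikodym derivative in [0,1] only almost everywhere; clamping yields a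
    real version with these bounds everywhere, as the quantile construction requires. *)
Lemma density_exists (nu : {measure set X -> \bar R}) :
  (forall A, measurable A -> nu A <= mu A) ->
  exists f : X -> R, [/\ measurable_fun setT f, (forall x, (0 <= f x <= 1)%R) &
    forall A, measurable A -> nu A = \int[mu]_(x in A) (f x)%:E].
Proof.
move=> numu.
have nufin : nu setT < +oo.
  by apply: (le_lt_trans (numu _ measurableT)); rewrite ltey_eq fin_num_measure.
pose nu' := [the {finite_measure set X -> \bar R} of mfrestr measurableT nufin].
have nu'E A : nu' A = nu A by rewrite /nu'/= /mfrestr /mrestr setIT.
pose c := [the {charge set X -> \bar R} of charge_of_finite_measure nu'].
have cE A : c A = nu A by rewrite -nu'E.
have cmu : c `<< mu.
  apply/null_content_dominatesP => A mA A0; rewrite cE.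
  by apply/eqP; rewrite -measure_le0 -A0; exact: numu.
pose g := Radon_Nikodym c mu.
have gi : mu.-integrable setT g by exact: Radon_Nikodym_integrable.
have gE A : measurable A -> nu A = \int[mu]_(x in A) g x.
  by move=> mA; rewrite -cE; exact: Radon_Nikodym_integral.
have gfin x : g x \is a fin_num by exact: Radon_Nikodym_fin_num.
have g0 : {ae mu, forall x, 0 <= g x}.
  apply: ae_le_of_integral_le => //.
    exact: (finite_measure_integrable_cst mu 0%R).
  by move=> A mA; rewrite integral0 -gE.
have g1 : {ae mu, forall x, g x <= 1}.
  apply: (ae_le_of_integral_le gi (finite_measure_integrable_cst mu 1%R measurableT)).
  by move=> A mA; rewrite -gE// (le_trans (numu _ mA))// -[leLHS]mul1e -(integral_cst mu mA).
have mg := measurable_int _ gi.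
have mf : measurable_fun setT (fun x => clamp01 (fine (g x))).
  by apply: measurable_maxr => //; apply: measurable_minr => //; exact: measurableT_comp.
exists (fun x => clamp01 (fine (g x))); split => //.
  by move=> x; rewrite /clamp01 le_max lexx/= ge_max ler01 ge_min lexx orbT.
move=> A mA; rewrite gE//; apply: ae_eq_integral => //.
- exact: measurable_funTS.
- by apply: measurable_funTS; exact/measurable_EFinP.
- apply: filterS2 g0 g1 => x h0 h1 _; rewrite -[in LHS](fineK (gfin x)); congr EFin.
  rewrite /clamp01.
  have h0' : (0 <= fine (g x))%R by exact: fine_ge0.
  have h1' : (fine (g x) <= 1)%R by rewrite -lee_fin fineK.
  by rewrite (min_idPl h1') (max_idPr h0').
Qed.

End Densities.

(** * The uniform law on the unit interval and quantile disintegration *)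

Section UniformMeasure.
Variable R : realType.
Let mI01 : measurable (`[(0:R), 1]%classic : set (measurableTypeR R)).
Proof. exact: measurable_itv. Qed.

Definition lam01 : set (measurableTypeR R) -> \bar R := mrestr (@lebesgue_measure R) mI01.

HB.instance Definition _ := Measure.on lam01.

Let lam01T : lam01 setT = 1%E.
Proof. by rewrite /lam01 /mrestr setTI lebesgue_measure_itv/= lte_fin ltr01 sube0. Qed.

HB.instance Definition _ := Measure_isProbability.Build _ _ _ lam01 lam01T.

Lemma lam01_le (a : R) : 0 <= a <= 1 -> lam01 [set w | w <= a] = a%:E.
Proof.
move=> /andP[a0 a1]; rewrite /lam01 /mrestr.
have -> : [set w | w <= a] `&` `[0, 1]%classic = `[0, a]%classic.
  apply/seteqP; split => x /=; rewrite !in_itv/=; first by move=> [xa /andP[-> _]].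
  by move=> /andP[x0 xa]; rewrite x0 xa (le_trans xa a1).
rewrite lebesgue_measure_itv/= lte_fin sube0; case: ltP => // a0'.
by congr EFin; apply/le_anti; rewrite a0 a0'.
Qed.

End UniformMeasure.

Lemma ae_forall_countable d (T : measurableType d) (R : realType)
    (mu : {measure set T -> \bar R}) (I : countType) (P : I -> T -> Prop) :
  (forall i, {ae mu, forall x, P i x}) -> {ae mu, forall x, forall i, P i x}.
Proof.
move=> aeP; pose F n := if unpickle n is Some i then ~` [set x | P i x] else set0.
have nF : mu.-negligible (\bigcup_n F n).
  apply: negligible_bigcup => n; rewrite /F; case: unpickle => [i|]; first exact: aeP.
  exact: negligible_set0.
apply: negligibleS nF => x /= /existsNP[i Pi]; exists (pickle i) => //.
by rewrite /F pickleK.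
Qed.

(* The law of [w |-> Q (x, w)] under uniform [w] has distribution function
   [q |-> d(nu q)/d(mu)] at [x]; [Q] is the corresponding quantile transform,
   with the junk value 2 where the total mass of the fibre is exhausted. *)
Section QuantileDisintegration.
Context d (X : measurableType d) (R : realType).
Variables (mu : {finite_measure set X -> \bar R})
          (nu : R -> {measure set X -> \bar R}) (L : R).
Hypothesis nu_mu : forall A, measurable A -> (nu 1 A <= mu A)%E.
Hypothesis nu_nd : forall p q A, 0 <= p -> p <= q -> q <= 1 -> measurable A ->
  (nu p A <= nu q A)%E.
Hypothesis nu_lip : forall p q A, 0 <= p -> p <= q -> q <= 1 -> measurable A ->
  (nu q A <= nu p A + (L * (q - p))%:E)%E.

Let I01 (p : rat) := (0 <= (ratr p : R)) && ((ratr p : R) <= 1).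

Let nule p A : 0 <= p <= 1 -> measurable A -> (nu p A <= mu A)%E.
Proof.
by move=> /andP[p0 p1] mA; apply: le_trans (nu_mu mA); exact: nu_nd.
Qed.

Lemma quantile_disintegration : exists Q : X * measurableTypeR R -> R,
  [/\ measurable_fun setT Q, (forall z, 0 <= Q z) &
   forall q B, 0 <= q <= 1 -> measurable B ->
     (mu \x @lam01 R)%E ((B `*` setT) `&` [set z | Q z <= q]) = nu q B].
Proof.
have /choice[f fP] : forall p : rat, exists f : X -> R,
    [/\ measurable_fun setT f, (forall x, 0 <= f x <= 1) &
     I01 p -> forall A, measurable A -> nu (ratr p) A = (\int[mu]_(x in A) (f x)%:E)%E].
  move=> p; have [p01|np] := boolP (I01 p).
    have [f [mf f01 fE]] := density_exists (fun A mA => nule p01 mA).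
    by exists f; split.
  by exists (fun=> 0); split => // x; rewrite lexx ler01.
have mf p : measurable_fun setT (f p) by case: (fP p).
have f01 p x : 0 <= f p x <= 1 by case: (fP p).
have fE p : I01 p -> forall A, measurable A ->
   nu (ratr p) A = (\int[mu]_(x in A) (f p x)%:E)%E by case: (fP p).
have fi p : (mu.-integrable setT (EFin \o f p))%E.
  apply: (@le_integrable _ _ _ mu _ measurableT _ (EFin \o cst 1)) => //.
  - exact/measurable_EFinP.
  - by move=> x _ /=; case/andP: (f01 p x) => f0 f1; rewrite lee_fin normr1 ger0_norm.
  - exact: finite_measure_integrable_cst.
(* The densities are chosen separately for each level, so monotonicity in the level holds only off a
   null set; countability gives one [N] for all pairs of rational levels. *)
have [N [mN N0 HN]] : {ae mu, forall x, forall pq : rat * rat,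
    I01 pq.1 -> I01 pq.2 -> pq.1 <= pq.2 -> f pq.1 x <= f pq.2 x}.
  apply: ae_forall_countable => -[p q] /=.
  have [p01|np] := boolP (I01 p); last by apply: aeW.
  have [q01|nq] := boolP (I01 q); last by apply: aeW.
  have [pq|npq] := boolP (p <= q); last by apply: aeW.
  have : {ae mu, forall x, ((EFin \o f p) x <= (EFin \o f q) x)%E}.
    apply: ae_le_of_integral_le => // A mA; rewrite -fE// -fE//.
    by case/andP: p01 => p0 _; case/andP: q01 => _ q1; apply: nu_nd => //; rewrite ler_rat.
  by apply: filterS => x; rewrite lee_fin.
have mono p q x : ~ N x -> I01 p -> I01 q -> p <= q -> f p x <= f q x.
  move=> Nx p01 q01 pq; apply: contrapT => h; apply: Nx; apply: HN => /= /(_ (p, q)).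
  by move=> /(_ p01 q01 pq).
pose S p := [set z : X * measurableTypeR R | z.2 <= f p z.1].
have mS p : measurable (S p).
  have -> : S p = [set: X * measurableTypeR R] `&` [set z | (z.2%:E <= (f p z.1)%:E)%E].
    by apply/seteqP; split => z; rewrite /S /= lee_fin; tauto.
  apply: measurable_lee => //; apply/measurable_EFinP.
    exact: measurable_snd.
  exact: measurableT_comp.
have muS p B : I01 p -> measurable B ->
    (mu \x @lam01 R)%E ((B `*` setT) `&` S p) = nu (ratr p) B.
  move=> p01 mB; rewrite fE// [RHS]integral_mkcond.
  apply: eq_integral => x _; rewrite /patch.
  have [xB|xB] := boolP (x \in B).
    rewrite /= -(lam01_le (f01 p x)); congr (lam01 _).
    by apply/seteqP; split => w; rewrite /xsection/= !inE /S/=; [case|split => //; split => //; exact: set_mem].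
  rewrite /= (_ : xsection _ _ = set0) ?measure0//.
  by apply/seteqP; split => w //; rewrite /xsection/= !inE => -[[/= /mem_set Bx _] _]; rewrite Bx in xB.
have r0 : (ratr 0 : R) = 0 by rewrite (ratr_nat R 0).
have r1 : (ratr 1 : R) = 1 by rewrite (ratr_nat R 1).
have I0 : I01 0 by rewrite /I01 r0 lexx ler01.
have I1 : I01 1 by rewrite /I01 r1 lexx ler01.
pose val p (z : X * measurableTypeR R) : R := if z.2 <= f p z.1 then ratr p else 2.
pose V z := [set val p z | p in [set p | I01 p]].
have V0 z : lbound (V z) 0.
  move=> _ [p /andP[p0 _] <-]; rewrite /val; case: ifP => // _.
have V1 z : V z !=set0 by exists (val 0 z); exists 0.
pose Q z := inf (V z).
(* The bound [c <= 2] hides the junk value: a value below [c] must come from a rational level [p]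
   with the point in [S p]. *)
have QltP z c : c <= 2 -> Q z < c <-> exists p, [/\ I01 p, ratr p < c & S p z].
  move=> c2; split.
    move=> /inf_lt - /(_ (V1 z)) [_ [p p01 <-]]; rewrite /val; case: ifP => [zp pc|_].
      by exists p.
    by move=> /lt_le_trans /(_ c2); rewrite ltxx.
  move=> [p [p01 pc zp]]; apply: le_lt_trans pc; rewrite /Q.
  have -> : ratr p = val p z by rewrite /val ifT.
  by apply: ge_inf; [exists 0; exact: V0|exists p].
have Q0 z : 0 <= Q z by apply: lb_le_inf => //; exact: V0.
have Q2 z : Q z <= 2.
  apply: (@le_trans _ _ (val 0 z)).
    by apply: ge_inf; [exists 0; exact: V0|exists 0].
  by rewrite /val; case: ifP => // _; rewrite r0.
have mQlt c : measurable [set z | Q z < c].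
  have [c2|c2] := leP c 2; last first.
    rewrite (_ : [set z | _] = setT)//; apply/seteqP; split => z //= _.
    exact: le_lt_trans c2.
  have -> : [set z | Q z < c] = \bigcup_(p in [set p : rat | I01 p /\ ratr p < c]) S p.
    apply/seteqP; split => z /=.
      by move=> /(QltP _ _ c2)[p [p01 pc zp]]; exists p.
    by move=> [p [p01 pc] zp]; apply/(QltP _ _ c2); exists p.
  rewrite bigcup_mkcond; apply: bigcupT_measurable_rat => p.
  by case: ifP => // _; exact: mS.
have mQ : measurable_fun setT Q.
  apply: (measurability _ (RGenInftyO.measurableE R)) => _ [_ [c ->] <-].
  rewrite setTI (_ : _ @^-1` _ = [set z | Q z < c]); first exact: mQlt.
  by apply/seteqP; split => z /=; rewrite in_itv.
have mQle c : measurable [set z | Q z <= c].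
  rewrite (_ : [set z | _] = Q @^-1` `]-oo, c]%classic); last first.
    by apply/seteqP; split => z /=; rewrite in_itv.
  by rewrite -[X in measurable X]setTI; exact: mQ.
exists Q; split => // q B /andP[q0 q1] mB.
(* [m] is squeezed between the values of [nu] at rational levels just below and just above [q]; the
   Lipschitz hypothesis closes the gap. *)
set m := (X in X = _).
have lower p : I01 p -> ratr p <= q -> (nu (ratr p) B <= m)%E.
  move=> p01 pq; rewrite -muS//; apply: le_measure; rewrite ?inE//.
  - by apply: measurableI => //; exact: measurableX.
  - by apply: measurableI => //; exact: measurableX.
  - apply: setIS => z /= zp; apply: le_trans pq.
    by apply: ge_inf; [exists 0; exact: V0|exists p => //; rewrite /val ifT].
have upper p c : I01 p -> c <= 2 -> q < c ->
    (forall p', I01 p' -> ratr p' < c -> p' <= p) -> (m <= nu (ratr p) B)%E.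
  move=> p01 c2 qc cp; rewrite -muS//.
  have NT0 : (mu \x @lam01 R)%E (N `*` setT) = 0%E 
    by rewrite product_measure1E//= [X in (X * _)%E](N0 : mu N = 0%E) mul0e.
  have mNT : measurable (N `*` [set: measurableTypeR R]) by exact: measurableX.
  have mBS : measurable ((B `*` [set: measurableTypeR R]) `&` S p).
    by apply: measurableI => //; exact: measurableX.
  rewrite -[leRHS]adde0 -NT0; apply: le_trans (measureU2 _ mBS mNT).
  apply: le_measure; rewrite ?inE.
  - by apply: measurableI => //; exact: measurableX.
  - exact: measurableU.
  move=> z [Bz /= Qz]; have [Nz|Nz] := pselect (N z.1); first by right.
  left; split => //; have /(QltP _ _ c2)[p' [p'01 p'c zp']] := le_lt_trans Qz qc.
  by rewrite /S/=; apply: le_trans zp' _; apply: mono => //; exact: cp.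
(* [L] may be zero or negative, so [|L| + 1] serves as the positive divisor. *)
have L1 : 0 < `|L| + 1 by rewrite ltr_wpDl.
have step e r s : 0 < e -> r <= s -> s <= r + e / (`|L| + 1) -> L * (s - r) <= e.
  move=> e0 rs sr; apply: (@le_trans _ _ ((`|L| + 1) * (s - r))).
    apply: ler_wpM2r; first by rewrite subr_ge0.
    by rewrite (le_trans (ler_norm _))// lerDl.
  by rewrite mulrC -ler_pdivlMr// lerBlDl.
apply/eqP; rewrite eq_le; apply/andP; split.
(* At [q = 1] no admissible rational lies above. The cut 2 is used instead, below which every
   admissible level is at most 1. *)
- have [q1'|q1'] := eqVneq q 1.
    have -> : nu q B = nu (ratr 1) B by rewrite r1 q1'.
    apply: (upper _ 2) => //; first by rewrite q1' ltr1n.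
    by move=> p' /andP[_ p'1] _; rewrite -(ler_rat R) r1.
  apply/lee_addgt0Pr => e e0.
  have : q < Num.min 1 (q + e / (`|L| + 1)).
    by rewrite lt_min lt_neqAle q1' q1 ltrDl divr_gt0.
  move=> /rat_in_itvoo[p]; rewrite in_itv/= lt_min => /andP[qp /andP[p1 pe]].
  have p01 : I01 p by rewrite /I01 (le_trans q0 (ltW qp)) ltW.
  have h : (m <= nu (ratr p) B)%E.
    apply: (upper p (ratr p)) => //; first by rewrite (le_trans (ltW p1)) ?ler1n.
    by move=> p' _; rewrite ltr_rat => /ltW.
  apply: le_trans h _; apply: le_trans (nu_lip q0 (ltW qp) (ltW p1) mB) _.
  by rewrite leeD2l// lee_fin step// ltW.
- have [q0'|q0'] := eqVneq q 0.
    by have := lower 0 I0; rewrite r0 q0'; apply.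
  apply/lee_addgt0Pr => e e0.
  have : Num.max 0 (q - e / (`|L| + 1)) < q.
    by rewrite gt_max lt_neqAle eq_sym q0' q0 ltrBlDr ltrDl divr_gt0.
  move=> /rat_in_itvoo[p]; rewrite in_itv/= gt_max => /andP[/andP[p0 pe] pq].
  have p01 : I01 p by rewrite /I01 (ltW p0) (le_trans (ltW pq)).
  apply: le_trans (nu_lip (ltW p0) (ltW pq) q1 mB) _.
  apply: leeD; first exact: (lower _ p01 (ltW pq)).
  by rewrite lee_fin step// ?ltW// -ltrBlDr.
Qed.

End QuantileDisintegration.

(** Splits only on comparisons whose operands contain no conditional, so nested minima and maxima
    are resolved from the inside out. *)
Ltac minmax_cases :=
  repeat match goal with
  | |- context [if (?a < ?b)%O then _ else _] =>
      lazymatch constr:((a, b)) with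
      | context [if _ then _ else _] => fail
      | _ => case: (ltP a b) => ?
      end
  end.

(** * Stieltjes measures on the line and quantile transforms of strips *)

Section LineMeasures.
Variable R : realType.
Local Notation lineT := (measurableTypeR R).

Lemma clamp01_ge0 (x : R) : 0 <= clamp01 x.
Proof. by rewrite /clamp01 le_max lexx. Qed.

Lemma clamp01_le1 (x : R) : clamp01 x <= 1.
Proof. by rewrite /clamp01 ge_max ler01 ge_min lexx orbT. Qed.

Lemma clamp01_id (x : R) : 0 <= x <= 1 -> clamp01 x = x.
Proof. by move=> /andP[x0 x1]; rewrite /clamp01 (min_idPl x1) (max_idPr x0). Qed.

Lemma clamp01_ge1 (x : R) : 1 <= x -> clamp01 x = 1.
Proof. by move=> x1; rewrite /clamp01 (min_idPr x1) (max_idPr ler01). Qed.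

Lemma clamp01_le0 (x : R) : x <= 0 -> clamp01 x = 0.
Proof. by move=> x0; rewrite /clamp01 (max_idPl _)// ge_min x0. Qed.

Lemma clamp01_in01 (x : R) : in01 (clamp01 x).
Proof. by rewrite /in01 clamp01_ge0 clamp01_le1. Qed.

Lemma clamp01K (x : R) : clamp01 (clamp01 x) = clamp01 x.
Proof. by rewrite clamp01_id// clamp01_in01. Qed.

Lemma clamp01_nd (x y : R) : x <= y -> clamp01 x <= clamp01 y.
Proof.
by rewrite /clamp01 /Num.max /Num.min => xy; minmax_cases; lra.
Qed.

Lemma clamp01_lip (x y : R) : x <= y -> clamp01 y - clamp01 x <= y - x.
Proof.
by rewrite /clamp01 /Num.max /Num.min => xy; minmax_cases; lra.
Qed.

Lemma ocitv_measure_eq (m1 m2 : {measure set lineT -> \bar R}) :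
  (forall a b : R, a <= b -> (m1 `]a, b]%classic < +oo)%E) ->
  (forall a b : R, a <= b -> m1 `]a, b]%classic = m2 `]a, b]%classic) ->
  forall A, measurable A -> m1 A = m2 A.
Proof.
move=> fin m12.
apply: (@measure_unique _ R lineT (@ocitv R) (fun n : nat => `]- n%:R, n%:R]%classic)).
- by [].
- exact: ocitvI.
- by move=> n; exact: is_ocitv.
- exact: bigcup_itvT.
- move=> A /ocitvP[->|[x /ltW x12 ->]]; last exact: m12.
  by rewrite !measure0.
- by move=> n; apply: fin; rewrite lerNl (le_trans _ (ler0n _ n))// oppr_le0.
Qed.

Lemma lebesgue_stieltjes_ocitv (f : cumulative R R) (a b : R) : a <= b ->
  lebesgue_stieltjes_measure f `]a, b]%classic = (f b - f a)%:E.
Proof.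
move=> ab; rewrite /lebesgue_stieltjes_measure /measure_extension.
by rewrite measurable_mu_extE/=; [rewrite wlength_itv_bnd|exact: is_ocitv].
Qed.

(** The two-sided bound says that [g] is nondecreasing and 1-Lipschitz, hence continuous, hence the
    distribution function of a Stieltjes measure. *)
Lemma line_measure_exists (g : R -> R) :
  (forall x y, x <= y -> 0 <= g y - g x <= y - x) ->
  exists m : {measure set lineT -> \bar R},
    forall a b, a <= b -> m `]a, b]%classic = (g b - g a)%:E.
Proof.
move=> gP.
have nd : {homo g : x y / x <= y}.
  by move=> x y /gP/andP[]; rewrite subr_ge0.
have cg : continuous g.
  move=> x; apply/cvgrPdist_le => e e0; near=> y.
  have xye : `|x - y| <= e by near: y; apply: cvgr_dist_le.
  case: (leP x y) => xy.
    move: (gP _ _ xy) => /andP[h1 h2]; rewrite distrC ger0_norm// (le_trans h2)//.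
    by move: xye; rewrite distrC ger0_norm// subr_ge0.
  move: (gP _ _ (ltW xy)) => /andP[h1 h2]; rewrite ger0_norm// (le_trans h2)//.
  by move: xye; rewrite ger0_norm// subr_ge0 ltW.
have rc : right_continuous g by apply: right_continuousW.
pose G := isCumulative.Build R _ R g nd rc.
pose f : cumulative R R := HB.pack g G.
by exists (lebesgue_stieltjes_measure f) => a b ab; exact: lebesgue_stieltjes_ocitv.
Unshelve. all: by end_near. Qed.

(* [q] is the level of a spatial coordinate, [v] the level of the conditioning
   variable; in both variables the margin is dominated by Lebesgue measure. *)
Definition strip_cdf (H : R -> R -> R) : Prop :=
  [/\ (forall q v, H q v = H q (clamp01 v)),
      (forall x, in01 x -> H x 0 = 0 /\ H 0 x = 0),
      (forall q q' v v', 0 <= q -> q <= q' -> q' <= 1 -> 0 <= v -> v <= v' -> v' <= 1 ->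
        0 <= H q' v' - H q' v - (H q v' - H q v)),
      (forall q q', 0 <= q -> q <= q' -> q' <= 1 -> H q' 1 - H q 1 <= q' - q) &
      (forall v v', 0 <= v -> v <= v' -> v' <= 1 -> H 1 v' - H 1 v <= v' - v)].

Lemma strip_cdf_incr (H : R -> R -> R) q q' v v' : strip_cdf H ->
  0 <= q -> q <= q' -> q' <= 1 -> v <= v' -> 0 <= H q' v' - H q' v - (H q v' - H q v).
Proof.
move=> [Hc _ H2 _ _] q0 qq q1 vv.
rewrite (Hc q') (Hc q' v) (Hc q v') (Hc q v).
by apply: H2 => //; rewrite ?clamp01_ge0 ?clamp01_le1 ?clamp01_nd.
Qed.

Lemma strip_cdf_le (H : R -> R -> R) q v v' : strip_cdf H -> 0 <= q <= 1 ->
  v <= v' -> 0 <= H q v' - H q v <= clamp01 v' - clamp01 v.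
Proof.
move=> HH /andP[q0 q1] vv.
have := strip_cdf_incr HH q0 q1 (lexx _) vv.
have := strip_cdf_incr HH (lexx _) q0 q1 vv.
case: HH => [Hc H0 _ _ HL].
rewrite (Hc 0 v') (Hc 0 v) !(H0 _ (clamp01_in01 _)).2.
have := HL _ _ (clamp01_ge0 v) (clamp01_nd vv) (clamp01_le1 v').
rewrite -!Hc; lra.
Qed.

Lemma lam01_ray (a : R) : lam01 (`]-oo, a]%classic : set lineT) = (clamp01 a)%:E.
Proof.
have [a0|a0] := ltP a 0.
  rewrite clamp01_le0 ?ltW// /lam01 /mrestr.
  transitivity (@lebesgue_measure R set0); last by rewrite measure0.
  congr lebesgue_measure; apply/seteqP; split => x //=; rewrite !in_itv/= => -[xa /andP[x0 _]].
  by move: (lt_le_trans a0 x0); rewrite ltNge xa.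
rewrite -(lam01_le (clamp01_in01 a)) /lam01 /mrestr; congr lebesgue_measure.
apply/seteqP; split => x /=; rewrite !in_itv/= => -[xa /andP[x0 x1]]; split; rewrite ?x0//.
  by rewrite -(@clamp01_id x) ?clamp01_nd ?x0.
have [a1|a1] := leP 1 a; first exact: le_trans a1.
by move: xa; rewrite clamp01_id// a0 ltW.
Qed.

Lemma lam01_ocitv (a b : R) : a <= b ->
  lam01 (`]a, b]%classic : set lineT) = (clamp01 b - clamp01 a)%:E.
Proof.
move=> ab; have -> : `]a, b]%classic = `]-oo, b]%classic `\` `]-oo, a]%classic.
  apply/seteqP; split => x /=; rewrite !in_itv/=; first by move=> /andP[]; rewrite ltNge => /negP.
  by move=> [-> /negP]; rewrite -ltNge => ->.
have mray c : measurable (`]-oo, c]%classic : set lineT) by exact: measurable_itv.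
have fin : (lam01 (`]-oo, b]%classic : set lineT) < +oo)%E by rewrite lam01_ray ltry.
rewrite (measureD (mray b) (mray a) fin).
rewrite setIidr; first by rewrite EFinB -!lam01_ray.
by move=> x /=; rewrite !in_itv/= => xa; exact: le_trans ab.
Qed.

(** For each level [q] the function [H q] defines a measure [nu q]. Rectangle monotonicity makes the
    increments in [q] measures too, which turns inequalities between distribution functions into the
    setwise bounds that the disintegration asks for. *)
Lemma strip_quantile (H : R -> R -> R) : strip_cdf H ->
  exists Q : lineT * lineT -> R,
  [/\ measurable_fun setT Q, (forall z, 0 <= Q z),
    (forall q, 0 <= q <= 1 ->
      (@lam01 R \x @lam01 R)%E [set z | Q z <= q] = (H q 1)%:E) &
    forall q v, 0 <= q <= 1 ->
      (@lam01 R \x @lam01 R)%E ((`]-oo, v]%classic `*` setT) `&` [set z | Q z <= q])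
      = (H q v)%:E].
Proof.
move=> HH.
have /choice[nu nuE] : forall q : R, exists m : {measure set lineT -> \bar R},
    0 <= q <= 1 -> forall a b, a <= b -> m `]a, b]%classic = (H q b - H q a)%:E.
  move=> q; have [q01|] := boolP (0 <= q <= 1); last by exists mzero.
  have [|m mE] := @line_measure_exists (H q); last by exists m.
  move=> x y xy; have /andP[-> h]/= := strip_cdf_le HH q01 xy.
  by apply: le_trans h _; exact: clamp01_lip.
(* [H q] is constant outside [0,1], so no mass is lost on []-1, 1]], and total masses can be read
   off the formula for half-open intervals. *)
have m11 : measurable (`]-1, 1]%classic : set lineT) by exact: measurable_itv.
have q01 (q q' : R) : 0 <= q -> q <= q' -> q' <= 1 -> 0 <= q <= 1 /\ 0 <= q' <= 1.
  by move=> a b c; split; apply/andP; split=> //; lra.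
have inc q q' : 0 <= q -> q <= q' -> q' <= 1 -> exists m : {measure set lineT -> \bar R},
    (forall A, measurable A -> nu q' A = nu q A + m A)%E /\
    (m `](-1)%R, 1%R]%classic <= (1 * (q' - q))%:E)%E.
  move=> q0 qq q1; have [q01' q01''] := q01 _ _ q0 qq q1.
  have [|m mE] := @line_measure_exists (fun v => H q' v - H q v).
    move=> x y xy; have h := strip_cdf_incr HH q0 qq q1 xy.
    have /andP[h1 _] := strip_cdf_le HH q01' xy.
    have /andP[_ h2] := strip_cdf_le HH q01'' xy.
    have h3 := clamp01_lip xy; apply/andP; split; lra.
  exists m; split.
    move=> A mA; rewrite -[RHS]measure_addE.
    apply: (ocitv_measure_eq (m1 := nu q') (m2 := measure_add (nu q) m)) => //.
      by move=> a b ab; rewrite nuE// ltry.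
    move=> a b ab; rewrite [RHS]measure_addE nuE// nuE// mE// -EFinD; congr EFin; lra.
  rewrite mE ?lee_fin; last by lra.
  case: HH => [Hc H0 _ HL _].
  have := HL _ _ q0 qq q1.
  rewrite (Hc q' (-1)) (Hc q (-1)) clamp01_le0 ?(H0 _ q01').1 ?(H0 _ q01'').1//; lra.
have [| | |] := quantile_disintegration (mu := @lam01 R) (nu := fun q => restrm (nu q) m11) (L := 1).
- move=> A mA.
  have i01 : 0 <= (1:R) <= 1 by rewrite lexx ler01.
  (* The defect of [nu 1] from the uniform law is again a Stieltjes measure, whence domination on
     every set. *)
  have [|m mE] := @line_measure_exists (fun v => clamp01 v - H 1 v).
    move=> x y xy; have /andP[h1 h2] := strip_cdf_le HH i01 xy.
    have h3 := clamp01_lip xy; apply/andP; split; lra.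
  rewrite /restrm/= /mrestr (_ : lam01 A = nu 1%R A + m A)%E.
    apply: (@le_trans _ _ (nu 1 A)); last by rewrite leeDl.
    by apply: le_measure; rewrite ?inE//; exact: measurableI.
  rewrite -[RHS]measure_addE.
  apply: (ocitv_measure_eq (m1 := @lam01 R) (m2 := measure_add (nu 1) m)) => //.
    by move=> a b ab; apply: le_lt_trans (ltry (clamp01 b - clamp01 a)); rewrite -lam01_ocitv.
  move=> a b ab; transitivity (clamp01 b - clamp01 a)%:E; first exact: lam01_ocitv.
  rewrite [RHS]measure_addE nuE// mE// -EFinD; congr EFin; lra.
- move=> p q A p0 pq q1 mA; have [m [mE _]] := inc _ _ p0 pq q1.
  by rewrite /restrm/= /mrestr mE ?leeDl//; exact: measurableI.
- move=> p q A p0 pq q1 mA; have [m [mE mle]] := inc _ _ p0 pq q1.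
  rewrite /restrm/= /mrestr mE ?leeD2l//; last exact: measurableI.
  apply: le_trans mle; apply: le_measure; rewrite ?inE//; exact: measurableI.
move=> Q [mQ Q0 QE]; exists Q; split => // [q q01'|q v q01'].
  have := QE _ _ q01' measurableT; rewrite setXTT setTI => ->.
  have h11 : (-1 : R) <= 1 by lra.
  rewrite /restrm/= /mrestr setTI (nuE _ q01' _ _ h11).
  by have [Hc H0 _ _ _] := HH; rewrite (Hc q (-1)) clamp01_le0 ?(H0 _ q01').1 ?subr0// lerN10.
have mr : measurable (`]-oo, v]%classic : set lineT) by exact: measurable_itv.
rewrite (QE _ _ q01' mr).
rewrite /restrm/= /mrestr.
have [Hc H0 _ _ _] := HH.
rewrite (Hc q v); have [v0|v0] := ltP v (-1).
  rewrite (_ : _ `&` _ = set0); last first.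
    apply/seteqP; split => x //=; rewrite !in_itv/= => -[xv /andP[x1 _]].
    by move: (lt_trans v0 x1); rewrite ltNge xv.
  by rewrite measure0 clamp01_le0 ?(H0 _ _).1// (le_trans (ltW v0))// lerN10.
have h11 : (-1 : R) <= 1 by lra.
rewrite (_ : _ `&` _ = `]-1, Num.min v 1]%classic); last first.
  apply/seteqP; split => x /=; rewrite !in_itv/= le_min.
    by move=> [-> /andP[-> ->]].
  by move=> /and3P[-> -> ->].
rewrite nuE//; last by rewrite le_min v0.
rewrite (Hc q (-1)) (clamp01_le0 (lerN10 R)) (H0 _ q01').1 subr0 (Hc q (Num.min v 1)); congr (H q _)%:E.
have [v1|v1] := leP v 1; first by [].
by rewrite (clamp01_ge1 (ltW v1)) clamp01_ge1.
Qed.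

End LineMeasures.

(** * Planar measures obtained from slabs of a copula *)

Section PlaneMeasures.
Variable R : realType.
Local Notation lineT := (measurableTypeR R).
Local Notation lam01sq := (@lam01 R \x @lam01 R)%E.

Definition quadrant (v b : R) : set (R * R) := `]-oo, v]%classic `*` `]-oo, b]%classic.

Lemma measurable_quadrant v b : measurable (quadrant v b).
Proof. by apply: measurableX. Qed.

Definition strip_graph (Q : lineT * lineT -> R) (z : lineT * lineT) : R * R := (z.1, Q z).

Lemma measurable_strip_graph Q : measurable_fun setT Q -> measurable_fun setT (strip_graph Q).
Proof. by move=> mQ; apply: measurable_fun_pair => //; exact: measurable_fst. Qed.

(** The restriction to [Q z <= 1] removes the points at which a quantile transform takes its junk
    value. *)
Lemma strip_pushforward (H : R -> R -> R) (Q : lineT * lineT -> R)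
    (mQ : measurable_fun setT Q) (mD : measurable [set z | Q z <= 1]) :
  (forall z, 0 <= Q z) ->
  (forall q v, 0 <= q <= 1 ->
    lam01sq ((`]-oo, v]%classic `*` setT) `&` [set z | Q z <= q]) = (H q v)%:E) ->
  forall v b, pushm (restrm lam01sq mD) (measurable_strip_graph mQ) (quadrant v b) =
    (if 0 <= b then H (Num.min b 1) v else 0)%:E.
Proof.
move=> Q0 QE v b; rewrite /pushm/= /pushforward/= /mrestr.
rewrite /quadrant /strip_graph; case: ifPn => [b0|b0].
  rewrite -QE; last by rewrite le_min b0 ler01 ge_min lexx orbT.
  congr (product_measure1 _ _ _); apply/seteqP; split => -[t w] /=; rewrite !in_itv/= le_min.
    by move=> [[tv Qb] Q1]; rewrite Qb Q1.
  by move=> [[tv _] /andP[Qb Q1]].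
rewrite (_ : _ `&` _ = set0) ?measure0//; apply/seteqP; split => -[t w] //=.
by rewrite !in_itv/= => -[[_ Qb] _]; rewrite (le_trans (Q0 _) Qb) in b0.
Qed.

Lemma measurable_sublevel d (T : measurableType d) (Q : T -> R) (c : R) :
  measurable_fun setT Q -> measurable [set z | Q z <= c].
Proof.
move=> mQ; rewrite (_ : [set z | _] = Q @^-1` `]-oo, c]%classic); last first.
  by apply/seteqP; split => z /=; rewrite in_itv.
by rewrite -[X in measurable X]setTI; exact: mQ.
Qed.

(** The measure is the image of the uniform square, cut to [Q z <= 1], under the graph of the
    quantile transform; this replaces an extension argument in the plane. *)
Lemma plane_measure_exists (H : R -> R -> R) : strip_cdf H ->
  exists m : {measure set (R * R) -> \bar R}, m setT = (H 1 1)%:E /\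
    forall v b, m (quadrant v b) = (if 0 <= b then H (Num.min b 1) v else 0)%:E.
Proof.
move=> /strip_quantile[Q [mQ Q0 QT QE]].
have mD := measurable_sublevel 1 mQ.
exists (pushm (restrm lam01sq mD) (measurable_strip_graph mQ)); split.
  rewrite /pushm/= /pushforward/= /mrestr preimage_setT setTI.
  by apply: QT; rewrite ler01 lexx.
exact: strip_pushforward.
Qed.

Lemma plane_measure_eq (m1 m2 : {measure set (R * R) -> \bar R}) :
  (m1 setT < +oo)%E -> (forall v b, m1 (quadrant v b) = m2 (quadrant v b)) ->
  forall A, measurable A -> m1 A = m2 A.
Proof. by move=> fin m12; apply: measure_eq_rat_quad => // p q; exact: m12. Qed.

Section CopulaStrips.
Variable C : R -> R -> R -> R.
Hypothesis hC : is_copula3 C.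

(** The monotonicity condition is the volume of a box over the slab from [y] to [y']. The two
    Lipschitz bounds express that the complementary slabs, below [y] and above [y'], have
    nonnegative volume. *)
Lemma copula3_strip_cdf y y' : 0 <= y -> y <= y' -> y' <= 1 ->
  strip_cdf (fun q v => C q y' v - C q y v).
Proof.
case: hC => Cc C0 C1 CV y0 yy y1.
have i0 : in01 (0:R) by rewrite /in01; lra.
have i1 : in01 (1:R) by rewrite /in01; lra.
have iy : in01 y by rewrite /in01; lra.
have iy' : in01 y' by rewrite /in01; lra.
have z1 a b : in01 a -> in01 b -> C 0 a b = 0 by move=> ia ib; case: (C0 a b ia ib).
have z2 a b : in01 a -> in01 b -> C a 0 b = 0 by move=> ia ib; case: (C0 a b ia ib).
have z3 a b : in01 a -> in01 b -> C a b 0 = 0 by move=> ia ib; case: (C0 a b ia ib).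
have o1 a : in01 a -> C a 1 1 = a by move=> /C1[].
have o2 a : in01 a -> C 1 a 1 = a by move=> /C1[].
have o3 a : in01 a -> C 1 1 a = a by move=> /C1[].
have I01 (a b : R) : 0 <= a -> a <= b -> b <= 1 -> in01 a /\ in01 b by move=> *; rewrite /in01; split; lra.
split.
- move=> q v; rewrite (Cc q y') (Cc q y) (Cc q y' (clamp01 v)) (Cc q y (clamp01 v)).
  by rewrite clamp01K.
- by move=> x ix; rewrite !z1 ?z3// subrr.
- move=> q q' v v' q0 qq q1 v0 vv v1.
  have [iq iq'] := I01 _ _ q0 qq q1; have [iv iv'] := I01 _ _ v0 vv v1.
  have := CV q q' y y' v v' iq iq' iy iy' iv iv' qq yy vv; rewrite /volume3; lra.
- move=> q q' q0 qq q1; have [iq iq'] := I01 _ _ q0 qq q1.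
  have := CV q q' 0 y 0 1 iq iq' i0 iy i0 i1 qq y0 ler01.
  have := CV q q' y' 1 0 1 iq iq' iy' i1 i0 i1 qq y1 ler01.
  by rewrite /volume3 !o1// !z2 ?z3//; lra.
- move=> v v' v0 vv v1; have [iv iv'] := I01 _ _ v0 vv v1.
  have := CV 0 1 0 y v v' i0 i1 i0 iy iv iv' ler01 y0 vv.
  have := CV 0 1 y' 1 v v' i0 i1 iy' i1 iv iv' ler01 y1 vv.
  by rewrite /volume3 !o3// !z1// !z2//; lra.
Qed.

Lemma copula3_grounded2 a b : in01 a -> C a 0 b = 0.
Proof.
case: hC => Cc C0 _ _ ia; rewrite Cc (clamp01_le0 (lexx _)).
by have [] := C0 (clamp01 a) (clamp01 b) (clamp01_in01 _) (clamp01_in01 _).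
Qed.

Lemma copula3_strip_cdf0 y : in01 y -> exists2 H, strip_cdf H &
  forall q v, in01 q -> H q v = C q y v.
Proof.
move=> /andP[y0 y1]; exists (fun q v => C q y v - C q 0 v).
  exact: copula3_strip_cdf.
by move=> q v iq; rewrite copula3_grounded2// subr0.
Qed.

End CopulaStrips.
End PlaneMeasures.

(** * Existence of conditional kernels *)

Section KernelExistence.
Variable R : realType.
Local Notation lineT := (measurableTypeR R).

Definition lam01sq : set (lineT * lineT) -> \bar R := (@lam01 R \x @lam01 R)%E.
HB.instance Definition _ := Measure.on lam01sq.

Lemma lam01sqT : lam01sq setT = 1%E.
Proof.
rewrite /lam01sq -setXTT product_measure1E//.
by rewrite -[RHS]mule1; congr (_ * _)%E; exact: probability_setT.
Qed.

HB.instance Definition _ := Measure_isProbability.Build _ _ _ lam01sq lam01sqT.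

Lemma integral_lam01 (v : R) (f : R -> \bar R) : v <= 1 ->
  (\int[@lebesgue_measure R]_(t in Icc 0%R v) f t = \int[@lam01 R]_(t in Icc 0%R v) f t)%E.
Proof.
move=> v1; apply: eq_measure_integral => A mA Av; rewrite /= /lam01 /mrestr setIidl//.
apply: subset_trans Av _ => t; rewrite /Icc /= !in_itv/= => /andP[-> tv].
exact: le_trans v1.
Qed.

Lemma measurable_Icc (a b : R) : measurable (Icc a b : set lineT).
Proof. exact: measurable_itv. Qed.

Section KernelOfMap.
Variable Psi : lineT * (lineT * lineT) -> R * R.
Hypothesis mPsi : measurable_fun setT Psi.

Lemma measurable_Psi_section (t : lineT) : measurable_fun setT (fun w => Psi (t, w)).
Proof. by apply: measurableT_comp => //; exact: measurable_pair1. Qed.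

(** Taking the law of [Psi (t, .)] under independent uniform variables gives a probability for every
    [t], and measurability in [t] is that of the sections of a measurable set. *)
Definition map_law (t : R) : {measure set (R * R) -> \bar R} :=
  pushm lam01sq (measurable_Psi_section t).

Lemma measurable_map_law U : measurable U -> measurable_fun [set: R] (map_law ^~ U).
Proof.
move=> mU; have := @measurable_fun_xsection _ _ lineT (lineT * lineT)%type R lam01sq (Psi @^-1` U).
have mPU : measurable (Psi @^-1` U) by rewrite -[X in measurable X]setTI; exact: mPsi.
move=> /(_ mPU); apply: eq_measurable_fun => t _.
rewrite /map_law/= /pushforward/=; congr (lam01sq _).
by apply/seteqP; split => w; rewrite /xsection/= inE.
Qed.

HB.instance Definition _ := isKernel.Build _ _ R (R * R)%type R map_law measurable_map_law.

Lemma map_lawT t : map_law t setT = 1%E.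
Proof.
by rewrite /map_law/= /pushforward/= preimage_setT lam01sqT.
Qed.

HB.instance Definition _ := Kernel_isProbability.Build _ _ R (R * R)%type R map_law map_lawT.

Definition map_kernel : R.-pker R ~> (R * R)%type := map_law.

End KernelOfMap.

(* Given [t], sample [U1] as [Q1 (t, w1)] and then [U2] as [Q2 ((t, U1), w2)],
   for independent uniform [w1], [w2]. *)
Lemma cond_kernel_exists (C : R -> R -> R -> R) : is_copula3 C ->
  exists K : R.-pker R ~> (R * R)%type, is_cond_kernel C K.
Proof.
move=> hC; have [Cc C0 C1 _] := hC.
have min01 (b : R) : 0 <= b -> in01 (Num.min b 1) by move=> b0; rewrite /in01 le_min b0 ler01 ge_min lexx orbT.
have i1 : in01 (1:R) by rewrite /in01; lra.
(* [nu y] is the law of [(U3, U1)] on the event [U2 <= y]; the conditioning variable is the first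
   coordinate. *)
have /choice[nu nuE] : forall y : R, exists m : {measure set (R * R) -> \bar R},
    in01 y -> m setT = y%:E /\
    forall v b, m (quadrant v b) = (if 0 <= b then C (Num.min b 1) y v else 0)%:E.
  move=> y; have [iy|] := pselect (in01 y); last by exists mzero.
  have [H HH HC] := copula3_strip_cdf0 hC iy.
  have [m [mT mE]] := plane_measure_exists HH; exists m => _; split.
    by rewrite mT HC//; case: (C1 _ iy) => _ ->.
  by move=> v b; rewrite mE; case: ifP => // b0; rewrite HC//; exact: min01.
have inc y y' : 0 <= y -> y <= y' -> y' <= 1 -> exists D : {measure set (R * R) -> \bar R},
    (forall A, measurable A -> nu y' A = nu y A + D A)%E /\ D setT = (1 * (y' - y))%:E.
  move=> y0 yy y1.
  have iy : in01 y by rewrite /in01 y0 (le_trans yy).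
  have iy' : in01 y' by rewrite /in01 y1 (le_trans y0).
  have [D [DT DE]] := plane_measure_exists (copula3_strip_cdf hC y0 yy y1).
  exists D; split; last first.
    by rewrite DT mul1r; case: (C1 _ iy) => _ -> _; case: (C1 _ iy') => _ ->.
  move=> A mA; rewrite -[RHS]measure_addE.
  apply: (plane_measure_eq (m1 := nu y') (m2 := measure_add (nu y) D)) => //.
    by rewrite (nuE _ iy').1 ltry.
  move=> v b; rewrite [RHS]measure_addE DE (nuE _ iy).2 (nuE _ iy').2 -EFinD.
  by congr EFin; case: ifP => _; rewrite ?addr0// addrC subrK.
have [H HH HC] := copula3_strip_cdf0 hC i1.
have [Q1 [mQ1 Q10 QT1 QE1]] := strip_quantile HH.
(* [mu0] is the law of [t] together with the first draw. It dominates [nu 1], which counts only the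
   draws with [Q1 <= 1]. *)
pose mu0 := pushm lam01sq (measurable_strip_graph mQ1).
have mu0T : (mu0 setT < +oo)%E.
  by rewrite /mu0/= /pushforward/= preimage_setT lam01sqT ltry.
pose mu := [the {finite_measure set (R * R)%type -> \bar R} of mfrestr measurableT mu0T].
have muE A : mu A = lam01sq (strip_graph Q1 @^-1` A).
  by rewrite /mu/= /mfrestr /mrestr setIT.
have mD := measurable_sublevel 1 mQ1.
have nu_mu A : measurable A -> (nu 1%R A <= mu A)%E.
  move=> mA; rewrite (plane_measure_eq (m1 := nu 1)
    (m2 := pushm (restrm (@lam01 R \x @lam01 R)%E mD) (measurable_strip_graph mQ1))) //.
  - have mgA : measurable (strip_graph Q1 @^-1` A).
      by rewrite -[X in measurable X]setTI; apply: measurable_strip_graph.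
    rewrite muE /pushm/= /pushforward/= /mrestr; apply: le_measure; rewrite ?inE//.
    exact: measurableI.
  - by rewrite (nuE _ i1).1 ltry.
  move=> v b; rewrite (nuE _ i1).2 (strip_pushforward mQ1 mD Q10 QE1).
  by congr EFin; case: ifP => // b0; rewrite HC//; exact: min01.
have [| |Q2 [mQ2 Q20 QE2]] := quantile_disintegration (L := 1) nu_mu.
- move=> p q A p0 pq q1 mA; have [D [-> // _]] := inc _ _ p0 pq q1.
  by rewrite leeDl.
- move=> p q A p0 pq q1 mA; have [D [-> // <-]] := inc _ _ p0 pq q1.
  by rewrite leeD2l//; apply: le_measure; rewrite ?inE.
pose Psi (z : lineT * (lineT * lineT)) : R * R :=
  (Q1 (z.1, z.2.1), Q2 ((strip_graph Q1 (z.1, z.2.1)), z.2.2)).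
have m121 : measurable_fun setT (fun z : lineT * (lineT * lineT) => (z.1, z.2.1)).
  apply: measurable_fun_pair; first exact: measurable_fst.
  by apply: measurableT_comp; [exact: measurable_fst|exact: measurable_snd].
have mPsi : measurable_fun setT Psi.
  apply: measurable_fun_pair; first exact: measurableT_comp m121.
  apply: measurableT_comp => //; apply: measurable_fun_pair.
    by apply: measurableT_comp m121; exact: measurable_strip_graph.
  by apply: measurableT_comp; [exact: measurable_snd|exact: measurable_snd].
exists (map_kernel mPsi) => u1 u2 v iu1 iu2 iv.
have [u10 u11] := andP iu1; have [v0 v1] := andP iv.
pose B := `[0, v]%classic `*` `]-oo, u1]%classic : set (R * R).
have mB : measurable B by apply: measurableX.
have -> : (C u1 u2 v)%:E = nu u2 B.
  have qE w : nu u2 (quadrant w u1) = (C u1 u2 w)%:E.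
    by rewrite (nuE _ iu2).2 u10 (min_idPl u11).
  have q0 : nu u2 (quadrant 0 u1) = 0%E.
    by rewrite qE; case: (C0 _ _ iu1 iu2) => _ _ ->.
  (* The quadrant exceeds [B] only at times [t < 0], and groundedness at [v = 0] leaves no mass
     there. *)
  rewrite -qE; apply/eqP; rewrite eq_le; apply/andP; split; last first.
    apply: le_measure; rewrite ?inE//; first exact: measurable_quadrant.
    by move=> [t x]; rewrite /quadrant /B /= !in_itv/= => -[/andP[_ tv] xu].
  rewrite -[leRHS]adde0 -q0; apply: le_trans (measureU2 _ mB (measurable_quadrant 0 u1)).
  apply: le_measure; rewrite ?inE//; first exact: measurable_quadrant.
    by apply: measurableU => //; exact: measurable_quadrant.
  move=> [t x]; rewrite /quadrant /B /= !in_itv/= => -[tv xu].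
  by case: (leP t 0) => [t0|/ltW t0]; [right|left]; split; rewrite /= ?in_itv/= ?t0 ?tv ?xu.
rewrite integral_lam01// -(QE2 _ _ iu2 mB).
set S := (_ `*` _) `&` _.
have mS : measurable S.
  by apply: measurableI; [exact: measurableX|exact: measurable_sublevel].
pose g (x : R * R) : \bar R := lam01 (xsection S x).
have mg : measurable_fun setT g by exact: measurable_fun_xsection.
rewrite [LHS](_ : _ = \int[mu0]_x g x)%E; last first.
  by apply: eq_measure_integral => A mA _; rewrite /= /mfrestr /mrestr setIT.
rewrite ge0_integral_pushforward//; last exact: measurable_strip_graph.
rewrite preimage_setT fubini_tonelli1; last 2 first.
- by apply: measurableT_comp => //; exact: measurable_strip_graph.
- by move=> z; exact: measure_ge0.
rewrite [RHS]integral_mkcond; apply: eq_integral => t _; rewrite /patch /fubini_F.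
have [tv|tv] := boolP (t \in Icc 0 v).
  apply: eq_integral => w1 _; rewrite /g /=; congr (lam01 _).
  apply/seteqP; split => w2; rewrite /xsection /S /B /= !inE /strip_graph /box /Icc /= !in_itv/=.
    by move=> [[[_ ->] _] ->]; rewrite Q10 Q20.
  move=> [/andP[_ ->] /andP[_ ->]].
  by split => //; split => //; split => //; move: tv; rewrite inE /Icc /= in_itv.
rewrite integral0_eq// => w1 _; rewrite /g /= (_ : xsection _ _ = set0) ?measure0//.
apply/seteqP; split => w2 //; rewrite /xsection /S /B /= inE /strip_graph /=.
by move=> [[[tv' _] _] _]; move: tv; rewrite notin_setE => /(_ tv').
Qed.

End KernelExistence.

(** * Almost sure uniqueness from equal primitives *)

Section InducedMeasure.
Context d (T : measurableType d) (R : realType) (mu : {measure set T -> \bar R}).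
Variable f : T -> \bar R.
Hypotheses (mf : measurable_fun setT f) (f0 : forall x, (0 <= f x)%E).

(** The two proofs are arguments so that the measure structure, which depends on them, can be
    attached to this name. *)
Definition induced_measure (_ : measurable_fun setT f) (_ : forall x, (0 <= f x)%E)
  (A : set T) : \bar R := (\int[mu]_(t in A) f t)%E.

Let im0 : induced_measure mf f0 set0 = 0%E.
Proof. exact: integral_set0. Qed.

Let im_ge0 A : (0 <= induced_measure mf f0 A)%E.
Proof. exact: integral_ge0. Qed.

Let im_additive : semi_sigma_additive (induced_measure mf f0).
Proof. exact: semi_sigma_additive_nng_induced. Qed.

HB.instance Definition _ :=
  isMeasure.Build _ _ _ (induced_measure mf f0) im0 im_ge0 im_additive.

Definition inducedm : {measure set T -> \bar R} := induced_measure mf f0.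

End InducedMeasure.

Section Versions.
Variable R : realType.
Local Notation lineT := (measurableTypeR R).
Local Notation lam := (@lebesgue_measure R).

Lemma in01_0 : in01 (0 : R).
Proof. by rewrite /in01 lexx ler01. Qed.

Lemma in01_1 : in01 (1 : R).
Proof. by rewrite /in01 lexx ler01. Qed.

(** The integral of a nonnegative function is a supremum over the simple functions below it, hence
    monotone for arbitrary functions. This serves the outer integral of [D1_of], whose integrand is
    never shown to be measurable in the point. *)
Lemma ge0_le_integralW d (T : measurableType d) (mu : {measure set T -> \bar R})
    (D : set T) (f g : T -> \bar R) :
  (forall x, D x -> 0 <= f x)%E -> (forall x, D x -> f x <= g x)%E ->
  (\int[mu]_(x in D) f x <= \int[mu]_(x in D) g x)%E.
Proof.
move=> f0 fg; have g0 x : D x -> (0 <= g x)%E.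
  by move=> Dx; apply: le_trans (f0 _ Dx) (fg _ Dx).
rewrite !ge0_integralE//; apply: le_ereal_sup => _ [h hf <-]; exists h => // x.
apply: le_trans (hf x) _; rewrite /patch; case: ifPn => //.
by rewrite inE => /fg.
Qed.

Lemma lam_Icc01 : lam (Icc 0 1) = 1%E.
Proof. by rewrite /Icc lebesgue_measure_itv/= lte_fin ltr01 sube0. Qed.

Lemma integral_lam01_setI (D : set lineT) (f : lineT -> \bar R) : measurable D ->
  measurable_fun setT f -> (forall x, 0 <= f x)%E ->
  (\int[@lam01 R]_(x in D) f x = \int[lam]_(x in D `&` Icc 0%R 1%R) f x)%E.
Proof.
move=> mD mf f0; have mI := measurable_Icc (0 : R) 1.
have mDI : measurable (D `&` Icc 0 1) by exact: measurableI.
have mDJ : measurable (D `\` Icc 0 1) by exact: measurableD.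
rewrite -{1}(setUIDK D (Icc 0 1)) ge0_integral_setU//; last 2 first.
- exact: measurable_funTS.
- by apply/disj_set2P; rewrite setDE setIACA setICr setI0.
rewrite (@null_set_integral _ _ _ _ (D `\` Icc 0 1))//; last 2 first.
- exact: measurable_funTS.
- transitivity (lam set0); last by rewrite measure0.
  rewrite /lam01 /mrestr; congr (lam _); rewrite setDE -setIA [X in _ `&` X]setIC.
  by rewrite [X in _ `&` X]setICr setI0.
rewrite adde0; apply: eq_measure_integral => A mA AD.
rewrite /= /lam01 /mrestr setIidl//; apply: subset_trans AD _; exact: subIsetr.
Qed.

Lemma ae_lam01 (P : R -> Prop) : {ae @lam01 R, forall t, P t} ->
  {ae lam, forall t, in01 t -> P t}.
Proof.
move=> [N [mN N0 NP]]; exists (N `&` Icc 0 1); split.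
- by apply: measurableI => //; exact: measurable_Icc.
- exact: N0.
- move=> t /= nP; split.
    by apply: NP => /= Pt; apply: nP.
  by rewrite /Icc /= in_itv/=; apply: contrapT => nt; apply: nP => /nt.
Qed.

(** Equal primitives mean equal induced measures on rays, hence on all measurable sets; comparison
    of integrals in both directions gives almost sure equality. *)
Lemma ae_eq_of_primitive (f g : lineT -> \bar R) :
  measurable_fun setT f -> measurable_fun setT g ->
  (forall t, 0 <= f t <= 1)%E -> (forall t, 0 <= g t <= 1)%E ->
  (forall v, in01 v -> \int[lam]_(t in Icc 0%R v) f t = \int[lam]_(t in Icc 0%R v) g t)%E ->
  {ae lam, forall t, in01 t -> f t = g t}.
Proof.
move=> mf mg f01 g01 fg.
have f0 t : (0 <= f t)%E by case/andP: (f01 t).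
have g0 t : (0 <= g t)%E by case/andP: (g01 t).
have fgA A : measurable A -> (\int[@lam01 R]_(t in A) f t = \int[@lam01 R]_(t in A) g t)%E.
  have mid : measurable_fun [set: lineT] (fun t : lineT => (t : R)) by exact: measurable_id.
  have ray h (mh : measurable_fun setT h) (h0 : forall t, (0 <= h t)%E) (q : rat) :
      pushm (inducedm (@lam01 R) mh h0) mid `]-oo, ratr q]%classic =
      if (0 <= ratr q :> R) then (\int[lam]_(t in Icc 0%R (Num.min (ratr q) 1%R)) h t)%E else 0%E.
    rewrite /= /pushforward /= /induced_measure integral_lam01_setI//; last exact: measurable_itv.
    case: ifPn => q0.
      congr (integral _ _ _); apply/seteqP; split => t; rewrite /Icc /= !in_itv/= le_min.
        by move=> [-> /andP[-> ->]].
      by move=> /and3P[-> -> ->].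
    rewrite (_ : _ `&` _ = set0) ?integral_set0//.
    apply/seteqP; split => t //; rewrite /Icc /= !in_itv/= => -[tq /andP[t0 _]].
    by rewrite (le_trans t0 tq) in q0.
  move=> mA; have fin (q : rat) : (pushm (inducedm (@lam01 R) mf f0) mid `]-oo, ratr q]%classic < +oo)%E.
    rewrite /= /pushforward /= /induced_measure.
    apply: (@le_lt_trans _ _ (\int[@lam01 R]_(t in `]-oo, ratr q]%classic) cst 1 t)%E).
      by apply: ge0_le_integralW => // t _; case/andP: (f01 t).
    rewrite integral_cst; last exact: measurable_itv.
    by rewrite mul1e (le_lt_trans (probability_le1 _ _))// ?ltry//; exact: measurable_itv.
  apply: (measure_eq_rat_rays fin _ mA (m2 := pushm (inducedm (@lam01 R) mg g0) mid)) => q.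
  rewrite !ray; case: ifP => // q0; apply: fg.
  by rewrite /in01 le_min q0 ler01 ge_min lexx orbT.
have bi h : measurable_fun setT h -> (forall t, 0 <= h t <= 1)%E -> (@lam01 R).-integrable setT h.
  move=> mh h01; apply: (@le_integrable _ _ _ (@lam01 R) _ measurableT _ (EFin \o cst 1)) => //.
  - by move=> x _ /=; case/andP: (h01 x) => a b; rewrite gee0_abs// normr1.
  - exact: finite_measure_integrable_cst.
have fi := bi _ mf f01; have gi := bi _ mg g01.
apply: ae_lam01.
have h1 : {ae @lam01 R, forall t, (f t <= g t)%E}.
  by apply: ae_le_of_integral_le => // A mA; rewrite fgA.
have h2 : {ae @lam01 R, forall t, (g t <= f t)%E}.
  by apply: ae_le_of_integral_le => // A mA; rewrite fgA.
by apply: filterS2 h1 h2 => t a b; apply/le_anti; rewrite a b.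
Qed.

End Versions.

#[global] Instance ae_lebesgue_filter (R : realType) :
  Filter (nbhs (almost_everywhere (@lebesgue_measure R))).
Proof. by apply: ae_filter_ringOfSetsType. Qed.

(** * Kernels at a fixed point and their distance in the mean over time *)

Section KernelDistance.
Variable R : realType.
Local Notation lineT := (measurableTypeR R).
Local Notation lam := (@lebesgue_measure R).
Local Notation pkernel := (R.-pker R ~> (R * R)%type).
Implicit Types (K : pkernel) (C : R -> R -> R -> R).

Lemma measurable_box (u1 u2 : R) : measurable (box u1 u2).
Proof. by apply: measurableX; exact: measurable_itv. Qed.

Lemma measurable_kernel_line K B : measurable B -> measurable_fun [set: lineT] (fun t => K t B).
Proof. by move=> mB; exact (measurable_kernel K B mB). Qed.

Lemma pkernel_ge0_le1 K t B : measurable B -> (0 <= K t B <= 1)%E.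
Proof.
move=> mB; rewrite measure_ge0/= -(@prob_kernel _ _ _ _ _ K t).
by apply: le_measure; rewrite ?inE.
Qed.

Lemma pkernel_fin K t B : measurable B -> K t B \is a fin_num.
Proof.
move=> mB; have /andP[h0 h1] := pkernel_ge0_le1 K t mB.
by rewrite ge0_fin_numE// (le_lt_trans h1)// ltry.
Qed.

Definition kbox K (u1 u2 t : R) : R := fine (K t (box u1 u2)).

Lemma kboxE K u1 u2 t : (kbox K u1 u2 t)%:E = K t (box u1 u2).
Proof. by rewrite /kbox fineK// pkernel_fin//; exact: measurable_box. Qed.

Lemma kbox01 K u1 u2 t : 0 <= kbox K u1 u2 t <= 1.
Proof.
by have := pkernel_ge0_le1 K t (measurable_box u1 u2); rewrite -kboxE !lee_fin.
Qed.

Lemma kbox_le K u1 u2 v1 v2 t : u1 <= v1 -> u2 <= v2 -> kbox K u1 u2 t <= kbox K v1 v2 t.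
Proof.
move=> h1 h2; rewrite -lee_fin !kboxE; apply: le_measure; rewrite ?inE; try exact: measurable_box.
move=> -[x y]; rewrite /box /Icc /= !in_itv/= => -[/andP[-> xu] /andP[-> yu]].
by split; [exact: le_trans xu h1|exact: le_trans yu h2].
Qed.

Lemma measurable_kbox K u1 u2 : measurable_fun [set: lineT] (kbox K u1 u2).
Proof.
apply/measurable_EFinP; rewrite (_ : _ \o _ = fun t => K t (box u1 u2)).
  exact (measurable_kernel_line K (measurable_box u1 u2)).
by apply/funext => t /=; rewrite kboxE.
Qed.

Lemma cond_kernelE C K u1 u2 v : is_cond_kernel C K -> in01 u1 -> in01 u2 -> in01 v ->
  (\int[lam]_(t in Icc 0%R v) (kbox K u1 u2 t)%:E)%E = (C u1 u2 v)%:E.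
Proof.
move=> hK i1 i2 iv; rewrite (hK _ _ _ i1 i2 iv).
by apply: eq_integral => t _; rewrite kboxE.
Qed.

(** The tool for computing kernels: a candidate with values in [0,1] and the right primitive is the
    kernel at that point, up to a null set depending on the point. Versions, mixtures, split copulas
    and the simplifying identity are all handled this way. *)
Lemma cond_kernel_ae C K (g : R -> R) u1 u2 : is_cond_kernel C K -> in01 u1 -> in01 u2 ->
  measurable_fun [set: lineT] g -> (forall t, 0 <= g t <= 1) ->
  (forall v, in01 v -> (\int[lam]_(t in Icc 0%R v) (g t)%:E)%E = (C u1 u2 v)%:E) ->
  {ae lam, forall t, in01 t -> kbox K u1 u2 t = g t}.
Proof.
move=> hK i1 i2 mg g01 gE.
have : {ae lam, forall t, in01 t -> (kbox K u1 u2 t)%:E = (g t)%:E}.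
  apply: ae_eq_of_primitive.
  - by apply/measurable_EFinP; exact: measurable_kbox.
  - exact/measurable_EFinP.
  - by move=> t; have := kbox01 K u1 u2 t; rewrite -!lee_fin.
  - by move=> t; have := g01 t; rewrite -!lee_fin.
  - by move=> v iv; rewrite gE//; exact: cond_kernelE.
by apply: filterS => t h /h [].
Qed.

Lemma cond_kernel_version C K K' u1 u2 : is_cond_kernel C K -> is_cond_kernel C K' ->
  in01 u1 -> in01 u2 -> {ae lam, forall t, in01 t -> kbox K u1 u2 t = kbox K' u1 u2 t}.
Proof.
move=> hK hK' i1 i2; apply: (cond_kernel_ae hK) => //; first exact: measurable_kbox.
  exact: kbox01.
by move=> v iv; exact: cond_kernelE.
Qed.

(** The inner integral shared by [D1_of] and [Dinf_of]; it lies in [0,1], so [fine] loses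
    nothing. *)
Definition gdist K K' (u1 u2 : R) : R :=
  fine (\int[lam]_(t in Icc 0%R 1%R) `|kbox K u1 u2 t - kbox K' u1 u2 t|%:E)%E.

Lemma measurable_kdiff K K' u1 u2 :
  measurable_fun [set: lineT] (fun t => `|kbox K u1 u2 t - kbox K' u1 u2 t|).
Proof.
apply: measurableT_comp => //; apply: measurable_funB; exact: measurable_kbox.
Qed.

Lemma measurable_kdiffE K K' u1 u2 (D : set lineT) :
  measurable_fun D (fun t => `|kbox K u1 u2 t - kbox K' u1 u2 t|%:E).
Proof. by apply: measurable_funTS; apply/measurable_EFinP; exact: measurable_kdiff. Qed.

Lemma kdiff_le1 K K' u1 u2 t : `|kbox K u1 u2 t - kbox K' u1 u2 t| <= 1.
Proof.
have /andP[a0 a1] := kbox01 K u1 u2 t; have /andP[b0 b1] := kbox01 K' u1 u2 t.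
by rewrite ler_norml; apply/andP; split; lra.
Qed.

Lemma gdist_int_le1 K K' u1 u2 :
  (\int[lam]_(t in Icc 0%R 1%R) `|kbox K u1 u2 t - kbox K' u1 u2 t|%:E <= 1)%E.
Proof.
apply: (@le_trans _ _ (\int[lam]_(t in Icc 0%R 1%R) cst 1 t)%E).
  apply: ge0_le_integralW => t _ /=; first by rewrite lee_fin.
  by rewrite lee_fin kdiff_le1.
have le1 : (lam (Icc 0%R 1%R) <= 1)%E by rewrite lam_Icc01.
by rewrite (integral_cst _ (measurable_Icc 0 1)) mul1e; exact: le1.
Qed.

Lemma gdistE K K' u1 u2 : (gdist K K' u1 u2)%:E =
  (\int[lam]_(t in Icc 0%R 1%R) `|kbox K u1 u2 t - kbox K' u1 u2 t|%:E)%E.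
Proof.
rewrite /gdist fineK// ge0_fin_numE; last by apply: integral_ge0 => t _; rewrite lee_fin.
by rewrite (le_lt_trans (gdist_int_le1 _ _ _ _))// ltry.
Qed.

Lemma gdistEE K K' u1 u2 : (gdist K K' u1 u2)%:E =
  (\int[lam]_(v in Icc 0%R 1%R) `|K v (box u1 u2) - K' v (box u1 u2)|)%E.
Proof. by rewrite gdistE; apply: eq_integral => t _; rewrite -!kboxE. Qed.

Lemma gdist_ge0 K K' u1 u2 : 0 <= gdist K K' u1 u2.
Proof. by rewrite -lee_fin gdistE; apply: integral_ge0 => t _; rewrite lee_fin. Qed.

Lemma gdist_le1 K K' u1 u2 : gdist K K' u1 u2 <= 1.
Proof. by rewrite -lee_fin gdistE; exact: gdist_int_le1. Qed.

Lemma gdist_version C1 C2 K1 K1' K2 K2' u1 u2 :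
  is_cond_kernel C1 K1 -> is_cond_kernel C1 K1' ->
  is_cond_kernel C2 K2 -> is_cond_kernel C2 K2' -> in01 u1 -> in01 u2 ->
  gdist K1 K2 u1 u2 = gdist K1' K2' u1 u2.
Proof.
move=> h1 h1' h2 h2' i1 i2; rewrite /gdist; congr fine.
apply: ae_eq_integral; first exact: measurable_Icc.
- exact: measurable_kdiffE.
- exact: measurable_kdiffE.
have a1 := cond_kernel_version h1 h1' i1 i2.
have a2 := cond_kernel_version h2 h2' i1 i2.
apply: filterS2 a1 a2 => t e1 e2; rewrite /Icc /= in_itv/= => it.
by rewrite e1// e2.
Qed.

Lemma gdist_triangle K1 K2 K3 u1 u2 :
  gdist K1 K3 u1 u2 <= gdist K1 K2 u1 u2 + gdist K2 K3 u1 u2.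
Proof.
rewrite -lee_fin EFinD !gdistE -ge0_integralD//; first last.
- exact: measurable_kdiffE.
- exact: measurable_kdiffE.
- exact: measurable_Icc.
apply: ge0_le_integralW => t _ /=; first by rewrite lee_fin.
by rewrite -EFinD lee_fin ler_distD.
Qed.

(** At [v = 1] the first two coordinates have a bivariate copula as joint law; four rectangles
    reaching to edges of the square, extended over all of the third coordinate, give the bound. *)
Lemma copula3_lip C u1 u2 v1 v2 : is_copula3 C -> in01 u1 -> in01 u2 -> in01 v1 -> in01 v2 ->
  v1 <= u1 -> v2 <= u2 -> C u1 u2 1 - C v1 v2 1 <= (u1 - v1) + (u2 - v2).
Proof.
move=> [Cc C0 C1 CV] /andP[? ?] /andP[? ?] /andP[? ?] /andP[? ?] h1 h2.
have i0 := in01_0 R; have i1 := in01_1 R.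
have I x : 0 <= x -> x <= 1 -> in01 x by move=> a b; rewrite /in01 a b.
have [? ?] : in01 u1 /\ in01 u2 by split; apply: I.
have [? ?] : in01 v1 /\ in01 v2 by split; apply: I.
have z1 x : in01 x -> C 0 x 1 = 0 by move=> ix; case: (C0 x 1 ix i1).
have z2 x : in01 x -> C x 0 1 = 0 by move=> ix; case: (C0 x 1 ix i1).
have z3 x y : in01 x -> in01 y -> C x y 0 = 0 by move=> ix iy; case: (C0 x y ix iy).
have o1 x : in01 x -> C x 1 1 = x by move=> /C1[].
have o2 x : in01 x -> C 1 x 1 = x by move=> /C1[].
have := CV v1 u1 u2 1 0 1; have := CV 0 1 v2 u2 0 1; have := CV v1 1 v2 u2 0 1.
have := CV 0 v1 v2 u2 0 1.
rewrite /volume3 !(z3 _ _) ?o1 ?o2 ?z1 ?z2//.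
move=> /(_ i0 ltac:(done) ltac:(done) ltac:(done) i0 i1 ltac:(done) ltac:(done) ler01).
move=> e1 /(_ ltac:(done) i1 ltac:(done) ltac:(done) i0 i1 ltac:(done) ltac:(done) ler01).
move=> e2 /(_ i0 i1 ltac:(done) ltac:(done) i0 i1 ler01 ltac:(done) ler01).
move=> e3 /(_ ltac:(done) ltac:(done) ltac:(done) i1 i0 i1 ltac:(done) ltac:(done) ler01).
lra.
Qed.


End KernelDistance.

(** * The distances [D1] and [Dinf] in terms of pointwise distances *)

Section CopulaDistances.
Variable R : realType.
Local Notation lineT := (measurableTypeR R).
Local Notation lam := (@lebesgue_measure R).
Local Notation lam2 := (lam \x lam)%E.
Local Notation pkernel := (R.-pker R ~> (R * R)%type).
Implicit Types (K : pkernel) (C : R -> R -> R -> R).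

(** At a single time a kernel may jump when the box grows. Averaged over all times the growth is
    that of [C] at [v = 1], which uniform margins control. *)
Lemma integral_kdiff_box C K u1 u2 v1 v2 : is_copula3 C -> is_cond_kernel C K ->
  in01 u1 -> in01 u2 -> in01 v1 -> in01 v2 -> v1 <= u1 -> v2 <= u2 ->
  (\int[lam]_(t in Icc 0%R 1%R) (kbox K u1 u2 t - kbox K v1 v2 t)%:E <=
   ((u1 - v1) + (u2 - v2))%:E)%E.
Proof.
move=> hC hK i1 i2 j1 j2 h1 h2.
have mI := measurable_Icc (0:R) 1.
have mk w1 w2 : measurable_fun (Icc 0 1 : set lineT) (fun t => (kbox K w1 w2 t)%:E).
  by apply: measurable_funTS; apply/measurable_EFinP; exact: measurable_kbox.
have h : (\int[lam]_(t in Icc 0%R 1%R) (kbox K u1 u2 t)%:E =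
   \int[lam]_(t in Icc 0%R 1%R) (kbox K v1 v2 t)%:E +
   \int[lam]_(t in Icc 0%R 1%R) (kbox K u1 u2 t - kbox K v1 v2 t)%:E)%E.
  rewrite -ge0_integralD//.
  - by apply: eq_integral => t _; rewrite -EFinD addrC subrK.
  - by move=> t _; case/andP: (kbox01 K v1 v2 t).
  - by move=> t _; rewrite lee_fin subr_ge0 kbox_le.
  - apply: measurable_funTS; apply/measurable_EFinP.
    by apply: measurable_funB; exact: measurable_kbox.
move: h; rewrite !(cond_kernelE hK _ _ (in01_1 R))//.
move=> h; rewrite -(@leeD2lE _ (C v1 v2 1)%:E)//.
apply: (@le_trans _ _ (C u1 u2 1)%:E); first by rewrite h.
have := copula3_lip hC i1 i2 j1 j2 h1 h2; rewrite -EFinD lee_fin; lra.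
Qed.

Lemma gdist_shift C1 C2 K1 K2 u1 u2 v1 v2 : is_copula3 C1 -> is_copula3 C2 ->
  is_cond_kernel C1 K1 -> is_cond_kernel C2 K2 ->
  in01 u1 -> in01 u2 -> in01 v1 -> in01 v2 -> v1 <= u1 -> v2 <= u2 ->
  gdist K1 K2 u1 u2 <= gdist K1 K2 v1 v2 + 2 * ((u1 - v1) + (u2 - v2)).
Proof.
move=> hC1 hC2 hK1 hK2 i1 i2 j1 j2 h1 h2.
have mI := measurable_Icc (0:R) 1.
have mk K : measurable_fun (Icc 0 1 : set lineT) (fun t => (kbox K u1 u2 t - kbox K v1 v2 t)%:E).
  by apply: measurable_funTS; apply/measurable_EFinP; apply: measurable_funB; exact: measurable_kbox.
have k0 K t : (0 <= (kbox K u1 u2 t - kbox K v1 v2 t)%:E)%E by rewrite lee_fin subr_ge0 kbox_le.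
rewrite -lee_fin EFinD mulrDl mul1r EFinD !gdistE.
apply: le_trans; last first.
  apply: leeD2l; apply: leeD.
    exact: (integral_kdiff_box hC1 hK1 i1 i2 j1 j2 h1 h2).
  exact: (integral_kdiff_box hC2 hK2 i1 i2 j1 j2 h1 h2).
rewrite -ge0_integralD// -ge0_integralD//; first last.
- by apply: emeasurable_funD.
- by move=> t _; rewrite adde_ge0.
- exact: measurable_kdiffE.
apply: ge0_le_integralW => t _ /=; first by rewrite lee_fin.
rewrite -!EFinD lee_fin.
move: (k0 K1 t) (k0 K2 t); rewrite !lee_fin => a1 a2.
set x := kbox K1 u1 u2 t in a1 *; set y := kbox K2 u1 u2 t in a2 *.
set z := kbox K1 v1 v2 t in a1 *; set w := kbox K2 v1 v2 t in a2 *.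
have e : x - y = (z - w) + ((x - z) - (y - w)) by lra.
rewrite e (le_trans (ler_normD _ _))// lerD2l (le_trans (ler_normB _ _))//.
by rewrite !ger0_norm.
Qed.

Lemma lam2_rect (a1 b1 a2 b2 : R) : a1 <= b1 -> a2 <= b2 ->
  lam2 (Icc a1 b1 `*` Icc a2 b2) = ((b1 - a1) * (b2 - a2))%:E.
Proof.
move=> h1 h2; transitivity (lam (Icc a1 b1) * lam (Icc a2 b2))%E.
  by apply: product_measure1E; exact: measurable_Icc.
have li (a b : R) : a <= b -> lam (Icc a b) = (b - a)%:E.
  move=> ab; rewrite /Icc lebesgue_measure_itv/= lte_fin; case: ltP => // ba.
  by rewrite (_ : b = a) ?subrr//; apply/le_anti; rewrite ab ba.
by rewrite !li// EFinM.
Qed.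

Lemma D1_ofE K K' : D1_of K K' =
  (\int[lam2]_(u in Icc 0%R 1%R `*` Icc 0%R 1%R) (gdist K K' u.1 u.2)%:E)%E.
Proof. by apply: eq_integral => u _; rewrite gdistEE. Qed.

Lemma D1_of_le K K' (c : R) : 0 <= c ->
  (forall u1 u2, in01 u1 -> in01 u2 -> gdist K K' u1 u2 <= c) -> (D1_of K K' <= c%:E)%E.
Proof.
move=> c0 hc; rewrite D1_ofE.
apply: (@le_trans _ _ (\int[lam2]_(u in Icc 0%R 1%R `*` Icc 0%R 1%R) cst c%:E u)%E).
  apply: ge0_le_integralW => -[u1 u2]; rewrite /Icc /= !in_itv/= => -[i1 i2].
    by rewrite lee_fin gdist_ge0.
  by rewrite lee_fin hc.
rewrite integral_cst; last by apply: measurableX; exact: measurable_Icc.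
have e : lam2 (Icc 0%R 1%R `*` Icc 0%R 1%R) = 1%E by rewrite lam2_rect// !subr0 mulr1.
rewrite [X in (_ * X)%E](e : _ = _) mule1.
by [].
Qed.

Lemma Dinf_of_le K K' (c : R) :
  (forall u1 u2, in01 u1 -> in01 u2 -> gdist K K' u1 u2 <= c) -> (Dinf_of K K' <= c%:E)%E.
Proof.
move=> hc; apply: ge_ereal_sup => _ [[u1 u2] + <-].
rewrite /Icc /= !in_itv/= => -[i1 i2]; rewrite -gdistEE lee_fin; exact: hc.
Qed.

Lemma gdist_le_Dinf_of K K' u1 u2 : in01 u1 -> in01 u2 ->
  ((gdist K K' u1 u2)%:E <= Dinf_of K K')%E.
Proof.
move=> i1 i2; apply: ereal_sup_ubound; exists (u1, u2); last by rewrite gdistEE.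
by rewrite /Icc /= !in_itv/=; split.
Qed.

Lemma D1_of_ge0 K K' : (0 <= D1_of K K')%E.
Proof. by rewrite D1_ofE; apply: integral_ge0 => u _; rewrite lee_fin gdist_ge0. Qed.

Lemma D1_of_fin K K' : D1_of K K' \is a fin_num.
Proof.
rewrite ge0_fin_numE ?D1_of_ge0//; apply: (le_lt_trans (D1_of_le ler01 _)); last exact: ltry.
by move=> *; exact: gdist_le1.
Qed.

Lemma Dinf_of_fin K K' : Dinf_of K K' \is a fin_num.
Proof.
rewrite ge0_fin_numE; last first.
  by apply: le_trans (gdist_le_Dinf_of K K' (in01_0 R) (in01_0 R)); rewrite lee_fin gdist_ge0.
apply: (@le_lt_trans _ _ 1%:E); last exact: ltry.
by apply: Dinf_of_le => *; exact: gdist_le1.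
Qed.

Lemma D1_of_version C1 C2 K1 K1' K2 K2' :
  is_cond_kernel C1 K1 -> is_cond_kernel C1 K1' ->
  is_cond_kernel C2 K2 -> is_cond_kernel C2 K2' -> D1_of K1 K2 = D1_of K1' K2'.
Proof.
move=> h1 h1' h2 h2'; rewrite !D1_ofE; apply: eq_integral => -[u1 u2].
rewrite inE /Icc /= !in_itv/= => -[i1 i2]; congr EFin.
exact: gdist_version h1 h1' h2 h2' i1 i2.
Qed.

Lemma Dinf_of_version C1 C2 K1 K1' K2 K2' :
  is_cond_kernel C1 K1 -> is_cond_kernel C1 K1' ->
  is_cond_kernel C2 K2 -> is_cond_kernel C2 K2' -> Dinf_of K1 K2 = Dinf_of K1' K2'.
Proof.
move=> h1 h1' h2 h2'; congr ereal_sup; apply: eq_imagel => -[u1 u2].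
rewrite /Icc /= !in_itv/= => -[i1 i2]; rewrite -!gdistEE; congr EFin.
exact: gdist_version h1 h1' h2 h2' i1 i2.
Qed.

(** [xget] is meaningful here because its set is inhabited: the value for one pair of versions is
    the value for all. *)
Lemma D1E C1 C2 K1 K2 : is_cond_kernel C1 K1 -> is_cond_kernel C2 K2 ->
  (D1 C1 C2)%:E = D1_of K1 K2.
Proof.
move=> h1 h2; rewrite /D1.
apply: (@xgetPex _ _ [set d : R | forall K1 K2, is_cond_kernel C1 K1 ->
  is_cond_kernel C2 K2 -> d%:E = D1_of K1 K2]) => //.
exists (fine (D1_of K1 K2)) => K1' K2' h1' h2'.
rewrite (fineK (D1_of_fin K1 K2)); exact: D1_of_version h1 h1' h2 h2'.
Qed.

Lemma DinfE C1 C2 K1 K2 : is_cond_kernel C1 K1 -> is_cond_kernel C2 K2 ->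
  (Dinf C1 C2)%:E = Dinf_of K1 K2.
Proof.
move=> h1 h2; rewrite /Dinf.
apply: (@xgetPex _ _ [set d : R | forall K1 K2, is_cond_kernel C1 K1 ->
  is_cond_kernel C2 K2 -> d%:E = Dinf_of K1 K2]) => //.
exists (fine (Dinf_of K1 K2)) => K1' K2' h1' h2'.
rewrite (fineK (Dinf_of_fin K1 K2)); exact: Dinf_of_version h1 h1' h2 h2'.
Qed.

(* Integrate [gdist_shift] over the square of side [h] below [(u1, u2)]. *)
Lemma gdist_le_D1 C1 C2 K1 K2 u1 u2 h : is_copula3 C1 -> is_copula3 C2 ->
  is_cond_kernel C1 K1 -> is_cond_kernel C2 K2 -> in01 u1 -> in01 u2 ->
  0 < h -> h <= u1 -> h <= u2 ->
  (gdist K1 K2 u1 u2 - 4 * h) * (h * h) <= D1 C1 C2.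
Proof.
move=> hC1 hC2 hK1 hK2 i1 i2 h0 hu1 hu2.
have D0 : 0 <= D1 C1 C2 by rewrite -lee_fin (D1E hK1 hK2) D1_of_ge0.
have [c0|c0] := ltP (gdist K1 K2 u1 u2 - 4 * h) 0.
  by apply: le_trans D0; rewrite nmulr_rle0// mulr_ge0// ltW.
rewrite -lee_fin (D1E hK1 hK2) D1_ofE.
set c := (X in (X * _)%:E).
pose S := Icc (u1 - h) u1 `*` Icc (u2 - h) u2.
have [a1 b1] := andP i1; have [a2 b2] := andP i2.
have SI : S `<=` Icc 0 1 `*` Icc 0 1.
  move=> -[x y]; rewrite /S /Icc /= !in_itv/= => -[/andP[? ?] /andP[? ?]].
  by split; apply/andP; split; lra.
have mS : measurable (S : set (lineT * lineT)) by apply: measurableX; exact: measurable_Icc.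
have e : lam2 S = (h * h)%:E.
  by rewrite lam2_rect ?lerBlDr ?lerDl ?(ltW h0)//; congr ((_ * _)%:E); lra.
apply: (@le_trans _ _ (\int[lam2]_(u in Icc 0%R 1%R `*` Icc 0%R 1%R) ((cst c%:E) \_ S) u)%E).
  rewrite -integral_mkcondr setIidr// integral_cst// EFinM.
  by rewrite -e; exact: lexx.
apply: ge0_le_integralW => -[x y].
  by move=> _; rewrite /patch; case: ifP => // _; rewrite lee_fin.
rewrite /Icc /= !in_itv/= => -[ix iy]; rewrite /patch; case: ifPn => [|_]; last first.
  by rewrite lee_fin gdist_ge0.
rewrite inE /S /Icc /= !in_itv/= => -[/andP[x1 x2] /andP[y1 y2]].
rewrite lee_fin /c.
have := gdist_shift hC1 hC2 hK1 hK2 i1 i2 ix iy x2 y2; lra.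
Qed.

End CopulaDistances.

(** * Mixtures of copulas and of their kernels *)

Section Mixtures.
Variable R : realType.
Local Notation lineT := (measurableTypeR R).
Local Notation lam := (@lebesgue_measure R).
Local Notation pkernel := (R.-pker R ~> (R * R)%type).
Implicit Types (K : pkernel) (C : R -> R -> R -> R).

Definition mix (e : R) C C' : R -> R -> R -> R :=
  fun x y z => (1 - e) * C x y z + e * C' x y z.

Lemma mix_copula3 e C C' : in01 e -> is_copula3 C -> is_copula3 C' -> is_copula3 (mix e C C').
Proof.
move=> /andP[e0 e1] [Cc C0 C1 CV] [Dc D0 D1 DV]; rewrite /mix; split.
- by move=> x y z; rewrite Cc Dc.
- move=> x y ix iy; have [-> -> ->] := C0 _ _ ix iy; have [-> -> ->] := D0 _ _ ix iy.
  by rewrite !mulr0 addr0.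
- move=> x ix; have [-> -> ->] := C1 _ ix; have [-> -> ->] := D1 _ ix.
  by rewrite -mulrDl subrK mul1r.
- move=> a1 b1 a2 b2 a3 b3 i1 j1 i2 j2 i3 j3 h1 h2 h3.
  have := CV _ _ _ _ _ _ i1 j1 i2 j2 i3 j3 h1 h2 h3.
  have := DV _ _ _ _ _ _ i1 j1 i2 j2 i3 j3 h1 h2 h3.
  set c := volume3 C _ _ _ _ _ _; set c' := volume3 C' _ _ _ _ _ _ => c'0 c0.
  rewrite (_ : volume3 _ _ _ _ _ _ _ = (1 - e) * c + e * c').
    by rewrite addr_ge0// mulr_ge0// subr_ge0.
  by rewrite /c /c' /volume3; ring.
Qed.

Lemma mix_kernel_ae e C C' K K' K'' u1 u2 : in01 e ->
  is_cond_kernel C K -> is_cond_kernel C' K' -> is_cond_kernel (mix e C C') K'' ->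
  in01 u1 -> in01 u2 ->
  {ae lam, forall t, in01 t ->
    kbox K'' u1 u2 t = (1 - e) * kbox K u1 u2 t + e * kbox K' u1 u2 t}.
Proof.
move=> /andP[e0 e1] hK hK' hK'' i1 i2.
have e1' : 0 <= 1 - e by rewrite subr_ge0.
have mk k c : measurable_fun [set: lineT] (fun t => c * kbox k u1 u2 t).
  by apply: measurable_funM => //; exact: measurable_kbox.
apply: (cond_kernel_ae hK'') => //.
- exact: measurable_funD.
- move=> t; have /andP[a0 a1] := kbox01 K u1 u2 t; have /andP[b0 b1] := kbox01 K' u1 u2 t.
  apply/andP; split; first by rewrite addr_ge0// mulr_ge0.
  have h1 := ler_wpM2l e1' a1; have h2 := ler_wpM2l e0 b1; lra.
- move=> v iv; under eq_integral do rewrite EFinD.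
  have mI := measurable_Icc (0:R) v.
  have mkE k c : measurable_fun (Icc 0 v : set lineT) (fun t => (c * kbox k u1 u2 t)%:E).
    by apply: measurable_funTS; apply/measurable_EFinP.
  have mkE1 k : measurable_fun (Icc 0 v : set lineT) (fun t => (kbox k u1 u2 t)%:E).
    by apply: measurable_funTS; apply/measurable_EFinP; exact: measurable_kbox.
  have k0 k t : 0 <= kbox k u1 u2 t by case/andP: (kbox01 k u1 u2 t).
  rewrite ge0_integralD//; first last.
  + by move=> t _; rewrite lee_fin mulr_ge0.
  + by move=> t _; rewrite lee_fin mulr_ge0.
  under eq_integral do rewrite EFinM.
  under [X in (_ + X)%E]eq_integral do rewrite EFinM.
  rewrite !ge0_integralZl//; try (by move=> t _; rewrite lee_fin).
  by rewrite (cond_kernelE hK)// (cond_kernelE hK').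
Qed.

Lemma gdist_le_ae K K' u1 u2 (c : R) : 
  {ae lam, forall t, in01 t -> `|kbox K u1 u2 t - kbox K' u1 u2 t| <= c} ->
  0 <= c -> gdist K K' u1 u2 <= c.
Proof.
move=> h c0; rewrite -lee_fin gdistE.
apply: (@le_trans _ _ (\int[lam]_(t in Icc 0%R 1%R) cst c%:E t)%E).
  apply: ae_ge0_le_integral; [exact: measurable_Icc|by move=> t _; rewrite lee_fin| | | | ].
  - exact: measurable_kdiffE.
  - by move=> t _; rewrite lee_fin.
  - exact: measurable_cst.
  by apply: filterS h => t ht; rewrite /Icc /= in_itv/= => it; rewrite lee_fin ht.
have le1 : (lam (Icc 0%R 1%R) <= 1)%E by rewrite lam_Icc01.
rewrite (integral_cst _ (measurable_Icc 0 1)); apply: (@le_trans _ _ (c%:E * 1)%E).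
  by rewrite lee_wpmul2l// lee_fin.
by rewrite mule1.
Qed.

(** Almost surely the two kernels differ by [e] times a difference of two probabilities. The bound
    is uniform in the point, so it serves [D1] and [Dinf] alike. *)
Lemma gdist_mix_le e C C' K K'' u1 u2 : in01 e -> is_copula3 C' ->
  is_cond_kernel C K -> is_cond_kernel (mix e C C') K'' ->
  in01 u1 -> in01 u2 -> gdist K K'' u1 u2 <= e.
Proof.
move=> ie /cond_kernel_exists[K' hK'] hK hK'' i1 i2; have [e0 e1] := andP ie.
apply: gdist_le_ae => //.
apply: filterS (mix_kernel_ae ie hK hK' hK'' i1 i2) => t h it; rewrite h//.
rewrite (_ : _ - _ = e * (kbox K u1 u2 t - kbox K' u1 u2 t)); last by ring.
by rewrite normrM ger0_norm// ler_piMr// kdiff_le1.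
Qed.

End Mixtures.

(* [split_copula T]: given the third coordinate in [T] the other two are
   uniform on the two diagonal cells of side 1/2, and off [T] they are
   independent. The two regimes have the same margins at [1/2]. *)
Section SplitCopula.
Variable R : realType.
Local Notation lineT := (measurableTypeR R).
Local Notation lam := (@lebesgue_measure R).
Variable T : set lineT.
Hypothesis mT : measurable T.

Definition lowpart (u : R) : R := Num.min (clamp01 u) (1 / 2).
Definition highpart (u : R) : R := clamp01 u - lowpart u.
Definition timeon (v : R) : R := fine (lam (Icc 0 (clamp01 v) `&` T)).
Definition timeoff (v : R) : R := fine (lam (Icc 0 (clamp01 v) `\` T)).

Definition split_copula (u1 u2 v : R) : R :=
  clamp01 u1 * clamp01 u2 * timeoff v
  + 2 * (lowpart u1 * lowpart u2) * timeon v + 2 * (highpart u1 * highpart u2) * timeon v.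

Lemma lam_Icc (a : R) : 0 <= a -> lam (Icc 0 a) = a%:E.
Proof.
move=> a0; rewrite /Icc lebesgue_measure_itv/= lte_fin sube0; case: ltP => // a0'.
by congr EFin; apply/le_anti; rewrite a0 a0'.
Qed.

Lemma lam_Icc_sub_fin (A : set lineT) (v : R) : measurable A -> A `<=` Icc 0 (clamp01 v) ->
  lam A \is a fin_num.
Proof.
move=> mA AI; rewrite ge0_fin_numE//; apply: (@le_lt_trans _ _ (lam (Icc 0 (clamp01 v)))).
  by apply: le_measure; rewrite ?inE//; exact: measurable_Icc.
by rewrite lam_Icc ?clamp01_ge0// ltry.
Qed.

Lemma timeonE v : (timeon v)%:E = lam (Icc 0 (clamp01 v) `&` T).
Proof.
have mI : measurable (Icc 0 (clamp01 v) `&` T : set lineT).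
  by apply: measurableI => //; exact: measurable_Icc.
by apply: fineK; apply: (lam_Icc_sub_fin (v := v)) => // t [].
Qed.

Lemma timeoffE v : (timeoff v)%:E = lam (Icc 0 (clamp01 v) `\` T).
Proof.
have mD : measurable (Icc 0 (clamp01 v) `\` T : set lineT).
  by apply: measurableD => //; exact: measurable_Icc.
by apply: fineK; apply: (lam_Icc_sub_fin (v := v)) => // t [].
Qed.

Lemma timeonDoff v : timeon v + timeoff v = clamp01 v.
Proof.
have mI := measurable_Icc 0 (clamp01 v).
apply: EFin_inj; rewrite EFinD timeonE timeoffE -(lam_Icc (clamp01_ge0 v)).
rewrite -measureU//; first by rewrite setUIDK.
- exact: measurableI.
- exact: measurableD.
- by rewrite setDE setIACA setICr setI0.
Qed.

Lemma timeon_nd v v' : v <= v' -> timeon v <= timeon v'.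
Proof.
move=> vv; rewrite -lee_fin !timeonE; apply: le_measure; rewrite ?inE.
- by apply: measurableI => //; exact: measurable_Icc.
- by apply: measurableI => //; exact: measurable_Icc.
apply: setSI => t; rewrite /Icc /= !in_itv/= => /andP[-> tv].
exact: le_trans tv (clamp01_nd vv).
Qed.

Lemma timeoff_nd v v' : v <= v' -> timeoff v <= timeoff v'.
Proof.
move=> vv; rewrite -lee_fin !timeoffE; apply: le_measure; rewrite ?inE.
- by apply: measurableD => //; exact: measurable_Icc.
- by apply: measurableD => //; exact: measurable_Icc.
apply: setSD => t; rewrite /Icc /= !in_itv/= => /andP[-> tv].
exact: le_trans tv (clamp01_nd vv).
Qed.

Lemma timeon_ge0 v : 0 <= timeon v.
Proof. by rewrite -lee_fin timeonE. Qed.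

Lemma timeoff_ge0 v : 0 <= timeoff v.
Proof. by rewrite -lee_fin timeoffE. Qed.

Lemma lowpart_nd u u' : u <= u' -> lowpart u <= lowpart u'.
Proof.
move=> uu; have := clamp01_nd uu; rewrite /lowpart /Num.min; minmax_cases; lra.
Qed.

Lemma highpart_nd u u' : u <= u' -> highpart u <= highpart u'.
Proof.
move=> uu; have := clamp01_nd uu; rewrite /highpart /lowpart /Num.min; minmax_cases; lra.
Qed.

Lemma split_copula3 : is_copula3 split_copula.
Proof.
have c0 : clamp01 (0:R) = 0 by rewrite clamp01_le0.
have c1 : clamp01 (1:R) = 1 by rewrite clamp01_ge1.
have l0 : lowpart 0 = 0 by rewrite /lowpart c0 /Num.min; minmax_cases; lra.
have h0 : highpart 0 = 0 by rewrite /highpart l0 c0 subrr.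
have l1 : lowpart 1 = 1 / 2 by rewrite /lowpart c1 /Num.min; minmax_cases; lra.
have h1 : highpart 1 = 1 / 2 by rewrite /highpart l1 c1; lra.
have lh u : clamp01 u = lowpart u + highpart u by rewrite /highpart addrC subrK.
have t0 : timeon 0 = 0.
  have := timeonDoff 0; have := timeon_ge0 0; have := timeoff_ge0 0; rewrite c0; lra.
have s0 : timeoff 0 = 0.
  have := timeonDoff 0; have := timeon_ge0 0; have := timeoff_ge0 0; rewrite c0; lra.
split.
- by move=> x y z; rewrite /split_copula /highpart /lowpart /timeon /timeoff !clamp01K.
- move=> x y _ _; rewrite /split_copula c0 l0 h0 t0 s0.
  by rewrite !(mul0r, mulr0, addr0).
- move=> x ix; rewrite /split_copula.
  have e1 := timeonDoff 1; have ex := timeonDoff x; have hx := lh x.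
  rewrite c1 l1 h1 in e1 *; rewrite clamp01_id// in ex hx *.
  have -> : timeoff 1 = 1 - timeon 1 by lra.
  have -> : timeoff x = x - timeon x by lra.
  have -> : highpart x = x - lowpart x by lra.
  by split; field.
- move=> a1 b1 a2 b2 a3 b3 _ _ _ _ _ _ h12 h22 h32.
  (* Each of the three summands is a product of one-variable functions, so its volume is the product
     of their increments, all nonnegative. *)
  have -> : volume3 split_copula a1 b1 a2 b2 a3 b3 =
      (clamp01 b1 - clamp01 a1) * (clamp01 b2 - clamp01 a2) * (timeoff b3 - timeoff a3)
      + 2 * ((lowpart b1 - lowpart a1) * (lowpart b2 - lowpart a2)) * (timeon b3 - timeon a3)
      + 2 * ((highpart b1 - highpart a1) * (highpart b2 - highpart a2)) * (timeon b3 - timeon a3).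
    rewrite /volume3 /split_copula.
    move: (lowpart _) (lowpart _) (lowpart _) (lowpart _) (highpart _) (highpart _) (highpart _) (highpart _).
    by move: (clamp01 _) (clamp01 _) (clamp01 _) (clamp01 _) (timeon _) (timeon _) (timeoff _) (timeoff _) => *; ring.
  by rewrite !addr_ge0// !mulr_ge0// ?subr_ge0 ?clamp01_nd ?lowpart_nd ?highpart_nd ?timeon_nd ?timeoff_nd.
Qed.

Lemma split_copula_kernel (K : R.-pker R ~> (R * R)%type) u1 u2 :
  is_cond_kernel split_copula K -> in01 u1 -> in01 u2 ->
  {ae lam, forall t, in01 t -> kbox K u1 u2 t =
    if t \in T then 2 * (lowpart u1 * lowpart u2) + 2 * (highpart u1 * highpart u2)
    else u1 * u2}.
Proof.
move=> hK i1 i2.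
set c := 2 * _ + _; set d := u1 * u2.
have [p1 q1] := andP i1; have [p2 q2] := andP i2.
have d01 : 0 <= d <= 1 by rewrite /d mulr_ge0//= mulr_ile1.
have c01 : 0 <= c <= 1.
  rewrite /c /highpart /lowpart !clamp01_id// /Num.min.
  by minmax_cases; apply/andP; split; nra.
have gE (t : lineT) : (if t \in T then c else d) = c * \1_T t + d * \1_(~` T) t.
  rewrite !indicE in_setC; case: ifP => _ /=; lra.
apply: (cond_kernel_ae hK) => //.
- rewrite (_ : (fun t => _) = fun t => c * \1_T t + d * \1_(~` T) t); last by apply/funext.
  apply: measurable_funD; apply: measurable_funM => //.
  by apply: measurable_indic; exact: measurableC.
- by move=> t; case: ifP.
- move=> v iv; have mI := measurable_Icc (0 : R) v.
  under eq_integral do rewrite gE EFinD.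
  have mi A : measurable A -> measurable_fun (Icc 0 v : set lineT) (fun t => (\1_A t)%:E : \bar R).
    by move=> mA; apply: measurable_funTS; apply/measurable_EFinP.
  have mTC : measurable (~` T) by exact: measurableC.
  have i0 (A : set lineT) t : 0 <= \1_A t :> R by rewrite indicE.
  have [c0 _] := andP c01; have [d0 _] := andP d01.
  rewrite ge0_integralD//; first last.
  + by apply/measurable_EFinP; apply: measurable_funM => //; apply: measurable_funTS.
  + by move=> t _; rewrite lee_fin mulr_ge0.
  + by apply/measurable_EFinP; apply: measurable_funM => //; apply: measurable_funTS.
  + by move=> t _; rewrite lee_fin mulr_ge0.
  under eq_integral do rewrite EFinM.
  under [X in (_ + X)%E]eq_integral do rewrite EFinM.
  rewrite !ge0_integralZl//; try (by move=> t _; rewrite lee_fin); try exact: mi.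
  rewrite !integral_indic// setIC [X in (_ + _ * lam X)%E]setIC.
  transitivity (c%:E * lam (Icc 0%R v `&` T) + d%:E * lam (Icc 0%R v `\` T))%E.
    by rewrite setDE.
  have := timeonE v; have := timeoffE v; rewrite clamp01_id// => <- <-.
  rewrite -!EFinM -EFinD /split_copula !clamp01_id// /c /d; congr EFin; ring.
Qed.

End SplitCopula.

(** * Bivariate copulas, the simplifying identity and selection of times *)

Section SimplifiedSeparation.
Variable R : realType.
Local Notation lineT := (measurableTypeR R).
Local Notation lam := (@lebesgue_measure R).
Local Notation pkernel := (R.-pker R ~> (R * R)%type).
Implicit Types (K : pkernel) (C : R -> R -> R -> R) (A : R -> R -> R).

(** All four rectangles reach an edge of the square, where the copula is zero or a uniform
    margin. *)
Lemma copula2_incr A x x' y y' : is_copula2 A -> in01 x -> in01 x' -> in01 y -> in01 y' ->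
  x <= x' -> y <= y' -> 0 <= A x' y' - A x y <= (x' - x) + (y' - y).
Proof.
move=> [A0 A1 AV] ix ix' iy iy' xx yy.
have i0 := in01_0 R; have i1 := in01_1 R.
have [p0 p1] := andP ix; have [p0' p1'] := andP ix'.
have [q0 q1] := andP iy; have [q0' q1'] := andP iy'.
have := AV _ _ _ _ ix ix' i0 iy' xx q0'.
have := AV _ _ _ _ ix ix' iy' i1 xx q1'.
have := AV _ _ _ _ i0 ix iy iy' p0 yy.
have := AV _ _ _ _ ix i1 iy iy' p1 yy.
rewrite (A0 _ ix).2 (A0 _ ix').2 (A1 _ ix).1 (A1 _ ix').1.
rewrite (A0 _ iy).1 (A0 _ iy').1 (A1 _ iy).2 (A1 _ iy').2 => *.
by apply/andP; split; lra.
Qed.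

Lemma copula2_lip A x x' y y' : is_copula2 A -> in01 x -> in01 x' -> in01 y -> in01 y' ->
  `|A x y - A x' y'| <= `|x - x'| + `|y - y'|.
Proof.
move=> hA ix ix' iy iy'.
have s1 : `|A x y - A x' y| <= `|x - x'|.
  wlog xx : x x' ix ix' / x <= x' => [hw|].
    by case: (leP x x') => [|/ltW] h; [exact: hw|rewrite distrC [leRHS]distrC; exact: hw].
  have /andP[a b] := copula2_incr hA ix ix' iy iy xx (lexx _).
  by rewrite distrC [leRHS]distrC !ger0_norm ?subr_ge0//; lra.
have s2 : `|A x' y - A x' y'| <= `|y - y'|.
  wlog yy : y y' iy iy' {s1} / y <= y' => [hw|].
    by case: (leP y y') => [|/ltW] h; [exact: hw|rewrite distrC [leRHS]distrC; exact: hw].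
  have /andP[a b] := copula2_incr hA ix' ix' iy iy' (lexx _) yy.
  by rewrite distrC [leRHS]distrC !ger0_norm ?subr_ge0//; lra.
by apply: le_trans (ler_distD (A x' y) _ _) _; exact: lerD.
Qed.

Lemma copula2_01 A x y : is_copula2 A -> in01 x -> in01 y -> 0 <= A x y <= 1.
Proof.
move=> hA ix iy; have [A0 A1 _] := hA.
have i0 := in01_0 R; have i1 := in01_1 R.
have /andP[p0 p1] := ix; have /andP[q0 q1] := iy.
have := copula2_incr hA i0 ix i0 iy p0 q0; have := copula2_incr hA ix i1 iy i1 p1 q1.
by rewrite (A0 _ i0).1 (A1 _ i1).1 => /andP[a _] /andP[b _]; apply/andP; split; lra.
Qed.

(** Monotonicity and continuity of [A] present a strict sublevel set as a countable union of sets
    [f < p], [g < q] with rational [p], [q]. These are clamped because [A] is constrained on the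
    unit square only. *)
Lemma measurable_copula2 A (f g : lineT -> R) : is_copula2 A ->
  measurable_fun setT f -> measurable_fun setT g ->
  (forall t, in01 (f t)) -> (forall t, in01 (g t)) ->
  measurable_fun setT (fun t => A (f t) (g t)).
Proof.
move=> hA mf mg f01 g01.
have mlt (h : lineT -> R) (c : R) : measurable_fun [set: lineT] h -> measurable [set t : lineT | h t < c].
  move=> mh; rewrite (_ : [set t | _] = h @^-1` `]-oo, c[%classic); last first.
    by apply/seteqP; split => z /=; rewrite in_itv.
  by rewrite -[X in measurable X]setTI; exact: mh.
apply: (measurability _ (RGenInftyO.measurableE R)) => _ [_ [c ->] <-].
rewrite setTI.
have -> : (fun t => A (f t) (g t)) @^-1` `]-oo, c[%classic =
   \bigcup_(p : rat) \bigcup_(q : rat)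
     (if A (clamp01 (ratr p)) (clamp01 (ratr q)) < c
      then [set t | f t < ratr p] `&` [set t | g t < ratr q] else set0).
  apply/seteqP; split => t /=; rewrite in_itv/=; last first.
    move=> [p _ [q _]]; case: ifP => // h [/= fp gq]; apply: le_lt_trans h.
    have e1 : f t = clamp01 (f t) by rewrite clamp01_id//; exact: f01.
    have e2 : g t = clamp01 (g t) by rewrite clamp01_id//; exact: g01.
    have := copula2_incr hA (clamp01_in01 (f t)) (clamp01_in01 (ratr p))
      (clamp01_in01 (g t)) (clamp01_in01 (ratr q)) (clamp01_nd (ltW fp)) (clamp01_nd (ltW gq)).
    by rewrite -e1 -e2 => /andP[]; rewrite subr_ge0.
  (* Each coordinate rises by less than a quarter of the gap, so [A] rises by less than half of
     it. *)
  move=> Ac; pose e := (c - A (f t) (g t)) / 4.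
  have e0 : 0 < e by rewrite divr_gt0// subr_gt0.
  have [p] : exists p : rat, ratr p \in `](f t), (f t + e)[ by apply: rat_in_itvoo; rewrite ltrDl.
  rewrite in_itv/= => /andP[fp pe].
  have [q] : exists q : rat, ratr q \in `](g t), (g t + e)[ by apply: rat_in_itvoo; rewrite ltrDl.
  rewrite in_itv/= => /andP[gq qe].
  exists p => //; exists q => //; rewrite ifT//.
  have e1 : f t = clamp01 (f t) by rewrite clamp01_id//; exact: f01.
  have e2 : g t = clamp01 (g t) by rewrite clamp01_id//; exact: g01.
  have := copula2_incr hA (clamp01_in01 (f t)) (clamp01_in01 (ratr p))
    (clamp01_in01 (g t)) (clamp01_in01 (ratr q)) (clamp01_nd (ltW fp)) (clamp01_nd (ltW gq)).
  have := clamp01_lip (ltW fp); have := clamp01_lip (ltW gq).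
  rewrite -e1 -e2 => h1 h2 /andP[_ h3].
  have e4 : 4 * e = c - A (f t) (g t) by rewrite /e; field.
  lra.
apply: bigcupT_measurable_rat => p; apply: bigcupT_measurable_rat => q.
by case: ifP => // _; apply: measurableI; exact: mlt.
Qed.

(** [F13] and [F23] unfold to the box values at [(u1, 1)] and [(1, u2)], so the integral formula,
    compared with that of the kernel, becomes an identity between three box values at almost every
    time. *)
Lemma simplified_kernel_ae C : simplified C -> exists K A,
  [/\ is_copula3 C, is_cond_kernel C K, is_copula2 A &
   forall u1 u2, in01 u1 -> in01 u2 ->
    {ae lam, forall t, in01 t -> kbox K u1 u2 t = A (kbox K u1 1 t) (kbox K 1 u2 t)}].
Proof.
move=> [hC [K [hK [A [hA [CA _]]]]]]; exists K, A; split => // u1 u2 i1 i2.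
apply: (cond_kernel_ae hK) => //.
- apply: measurable_copula2 => //; try exact: measurable_kbox.
  + by move=> t; exact: kbox01.
  + by move=> t; exact: kbox01.
- by move=> t; apply: copula2_01 => //; exact: kbox01.
- by move=> v iv; rewrite CA.
Qed.

Lemma measure_pigeonhole (T : set lineT) (f : R -> R) (d : R) : measurable T -> (0 < lam T)%E ->
  measurable_fun [set: lineT] f -> (forall t, 0 <= f t) -> 0 < d ->
  exists c : R, (0 < lam (T `&` [set t | (c <= f t < c + d)%R]))%E.
Proof.
move=> mT T0 mf f0 d0; apply: contrapT => /forallNP h.
have mS c : measurable (T `&` [set t : lineT | c <= f t < c + d]).
  apply: measurableI => //; rewrite (_ : [set t | _] = f @^-1` `[c, c + d[%classic); last first.
    by apply/seteqP; split => z /=; rewrite in_itv.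
  by rewrite -[X in measurable X]setTI; exact: mf.
have n0 (k : nat) : lam.-negligible (T `&` [set t : lineT | k%:R * d <= f t < k%:R * d + d]).
  apply/negligibleP => //; apply/eqP; rewrite eq_le measure_ge0 andbT leNgt.
  by apply/negP; exact: h.
have := negligible_bigcup n0; rewrite -setI_bigcupr setIidl.
  by move/(negligibleP _ mT) => T00; move: T0; rewrite [X in (_ < X)%E](T00 : _ = _) ltxx.
move=> t _; exists (Num.truncn (f t / d)) => //=.
have := @truncn_itv R (f t / d) (divr_ge0 (f0 t) (ltW d0)).
rewrite ler_pdivlMr// ltr_pdivrMr// => /andP[-> /=].
by rewrite -addn1 natrD mulrDl mul1r.
Qed.

(** Markov's inequality for the sum of the three deviations: if at almost every time in [T] one of
    them were at least [d], their integrals would add up to at least [d] times the measure of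
    [T]. *)
Lemma pick_point K K' (T : set lineT) (P : R -> Prop) (d : R) (x1 y1 x2 y2 x3 y3 : R) :
  measurable T -> T `<=` Icc 0 1 -> 0 < d -> {ae lam, forall t, in01 t -> P t} ->
  ((gdist K K' x1 y1 + gdist K K' x2 y2 + gdist K K' x3 y3)%:E < d%:E * lam T)%E ->
  exists t, [/\ T t, P t, `|kbox K x1 y1 t - kbox K' x1 y1 t| < d,
    `|kbox K x2 y2 t - kbox K' x2 y2 t| < d & `|kbox K x3 y3 t - kbox K' x3 y3 t| < d].
Proof.
move=> mT TI d0 aeP; rewrite ltNge => /negP h; apply: contrapT => /forallNP hn; apply: h.
rewrite !EFinD !gdistE.
have mI := measurable_Icc (0:R) 1.
have mk x y := @measurable_kdiffE R K K' x y (Icc 0 1).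
rewrite -ge0_integralD// -ge0_integralD//; first last.
- exact: emeasurable_funD.
- by move=> t _; rewrite adde_ge0.
have -> : (d%:E * lam T = \int[lam]_(t in Icc 0%R 1%R) (d%:E * (\1_T t)%:E))%E.
  have m1 : measurable_fun (Icc 0 1 : set lineT) (fun t => (\1_T t)%:E : \bar R).
    by apply: measurable_funTS; apply/measurable_EFinP.
  have i0 (t : lineT) : Icc 0 1 t -> (0 <= (\1_T t)%:E :> \bar R)%E by move=> _; rewrite lee_fin indicE.
  rewrite (ge0_integralZl lam mI m1 i0) ?lee_fin ?(ltW d0)//.
  by rewrite integral_indic// setIidl.
apply: ae_ge0_le_integral; [exact: mI| | | | |].
- by move=> t _; rewrite -EFinM lee_fin mulr_ge0// ?(ltW d0)// indicE.
- by apply: measurable_funTS; apply/measurable_EFinP; apply: measurable_funM.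
- by move=> t _; rewrite !adde_ge0.
- by apply: emeasurable_funD => //; exact: emeasurable_funD.
apply: filterS aeP => t Pt; rewrite /Icc /= in_itv/= => it.
rewrite -EFinM -!EFinD lee_fin indicE; case: (boolP (t \in T)) => [|_]; last first.
  by rewrite mulr0 !addr_ge0.
rewrite inE mulr1 => tT.
move: (hn t) => /= hnt; rewrite leNgt; apply/negP => hlt; apply: hnt; split => //; first exact: Pt.
- apply: le_lt_trans hlt; rewrite -addrA lerDl addr_ge0//.
- by apply: le_lt_trans hlt; rewrite addrAC lerDr addr_ge0.
- by apply: le_lt_trans hlt; rewrite lerDr addr_ge0.
Qed.

End SimplifiedSeparation.

(** * Separating a mixture from all simplified copulas *)

Section Separation.
Variable R : realType.
Local Notation lineT := (measurableTypeR R).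
Local Notation lam := (@lebesgue_measure R).
Local Notation pkernel := (R.-pker R ~> (R * R)%type).
Implicit Types (K : pkernel) (C : R -> R -> R -> R).

Lemma ae_and (P Q : R -> Prop) : {ae lam, forall t, P t} -> {ae lam, forall t, Q t} ->
  {ae lam, forall t, P t /\ Q t}.
Proof. by move=> aP aQ; apply: filterS2 aP aQ. Qed.

Lemma ae_imp (P Q : R -> Prop) : (forall t, P t -> Q t) -> {ae lam, forall t, P t} ->
  {ae lam, forall t, Q t}.
Proof. by move=> PQ aP; apply: filterS aP. Qed.

Lemma measurable_clamp01 : measurable_fun [set: lineT] (@clamp01 R).
Proof. by apply: measurable_maxr => //; apply: measurable_minr. Qed.

Lemma flat_set (f : R -> R) (T : set lineT) (d : R) : measurable T -> T `<=` Icc 0 1 -> (0 < lam T)%E ->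
  measurable_fun [set: lineT] f -> (forall t, 0 <= f t) -> 0 < d ->
  exists T' : set lineT, [/\ measurable T', T' `<=` T, (0 < lam T')%E &
    forall s t, T' s -> T' t -> `|f s - f t| <= d].
Proof.
move=> mT TI T0 mf f0 d0; have [c c0] := measure_pigeonhole mT T0 mf f0 d0.
exists (T `&` [set t : lineT | c <= f t < c + d]); split => //.
- apply: measurableI => //; rewrite (_ : [set t | _] = f @^-1` `[c, c + d[%classic); last first.
    by apply/seteqP; split => z /=; rewrite in_itv.
  by rewrite -[X in measurable X]setTI; exact: mf.
- move=> s t [_ /= /andP[s1 s2]] [_ /= /andP[t1 t2]].
  by rewrite ler_norml; apply/andP; split; lra.
Qed.

(** The pigeonhole is applied to time itself, clamped to be nonnegative. A band whose width is half
    the measure of [T] meets [T] in positive measure but at most half of it, so the rest is not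
    null. *)
Lemma split_set (T : set lineT) : measurable T -> T `<=` Icc 0 1 -> (0 < lam T)%E ->
  exists T1 T2 : set lineT, [/\ measurable T1 /\ measurable T2, T1 `<=` T /\ T2 `<=` T,
    (0 < lam T1)%E /\ (0 < lam T2)%E & T1 `&` T2 = set0].
Proof.
move=> mT TI T0.
have Tfin : lam T \is a fin_num.
  rewrite ge0_fin_numE//; apply: (@le_lt_trans _ _ (lam (Icc 0%R 1%R))).
    by apply: le_measure; rewrite ?inE//; exact: measurable_Icc.
  by rewrite lam_Icc01 ltry.
pose m := fine (lam T); have mE : m%:E = lam T by rewrite fineK.
have m0 : 0 < m by rewrite -lte_fin mE.
have [c c0] := measure_pigeonhole mT T0 measurable_clamp01 (@clamp01_ge0 R) (divr_gt0 m0 (ltr0n R 2)).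
set T1 := T `&` _ in c0.
have mT1 : measurable T1.
  apply: measurableI => //; rewrite (_ : [set t | _] = @clamp01 R @^-1` `[c, c + m / 2[%classic); last first.
    by apply/seteqP; split => z /=; rewrite in_itv.
  by rewrite -[X in measurable X]setTI; exact: measurable_clamp01.
have T1le : (lam T1 <= (m / 2)%:E)%E.
  apply: (@le_trans _ _ (lam (Icc c (c + m / 2)))).
    apply: le_measure; rewrite ?inE//; first exact: measurable_Icc.
    move=> t [/TI]; rewrite /Icc /= !in_itv/= => it; rewrite clamp01_id//.
    by move=> /andP[-> /ltW].
  rewrite /Icc lebesgue_measure_itv/= lte_fin ltrDl divr_gt0//= -EFinB lee_fin; lra.
exists T1, (T `\` T1); split.
- by split => //; exact: measurableD.
- by split; [exact: subIsetl|exact: subDsetl].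
- split => //; rewrite lt_neqAle measure_ge0 andbT; apply/eqP => h0.
  have : (lam T <= lam T1 + lam (T `\` T1))%E.
    apply: le_trans (measureU2 _ mT1 (measurableD mT mT1)).
    by apply: le_measure; rewrite ?inE//; [apply: measurableU => //; exact: measurableD|
      move=> t Tt; have [?|?] := pselect (T1 t); [left|right]].
  rewrite -h0 adde0 -mE => /le_trans/(_ T1le); rewrite lee_fin; lra.
- by rewrite setDE setIA setIAC setICr set0I.
Qed.

Lemma lowpart_half1 : lowpart (1 / 2 : R) = 1 / 2 /\ lowpart (1 : R) = 1 / 2.
Proof.
have h : 0 <= (1 / 2 : R) <= 1 by apply/andP; split; lra.
by rewrite /lowpart !clamp01_id ?lexx ?ler01// /Num.min; split; minmax_cases; lra.
Qed.

Lemma highpart_half1 : highpart (1 / 2 : R) = 0 /\ highpart (1 : R) = 1 / 2.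
Proof.
have h : 0 <= (1 / 2 : R) <= 1 by apply/andP; split; lra.
have [lh l1] := lowpart_half1; rewrite /highpart lh l1 !clamp01_id ?lexx ?ler01//.
by split; lra.
Qed.

(** With weight [e = 40 d] the values 1/2 and 1/4 of the split kernel differ by [10 d] after
    scaling. Oscillation and two approximation errors cost [3 d], so [k1] and [l1] are more than
    [7 d] apart, whereas the arguments allow only [3 d + 3 d]. Any factor from 36 on would do. *)
Lemma separation_arith (d k1 k2 k3 l1 l2 l3 x1 x2 x3 y1 y2 y3 : R) : 0 < d ->
  `|x1 + 40 * d * (1 / 2) - k1| < d -> `|x2 + 40 * d * (1 / 2) - k2| < d ->
  `|x3 + 40 * d * (1 / 2) - k3| < d -> `|y1 + 40 * d * (1 / 4) - l1| < d ->
  `|y2 + 40 * d * (1 / 2) - l2| < d -> `|y3 + 40 * d * (1 / 2) - l3| < d ->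
  `|x1 - y1| <= d -> `|x2 - y2| <= d -> `|x3 - y3| <= d ->
  `|k1 - l1| <= `|k2 - l2| + `|k3 - l3| -> False.
Proof.
move=> d0; have tri (x y c k l : R) : `|x + c - k| < d -> `|y + c - l| < d -> `|x - y| <= d -> `|k - l| <= 3 * d.
  rewrite !ltr_norml !ler_norml => /andP[a1 b1] /andP[a2 b2] /andP[a3 b3].
  by apply/andP; split; lra.
move=> h1 h2 h3 g1 g2 g3 w1 w2 w3.
have := tri _ _ _ _ _ h2 g2 w2; have := tri _ _ _ _ _ h3 g3 w3.
move: (`|k2 - l2|) (`|k3 - l3|) => p q {h2 h3 g2 g3 w2 w3 tri} h2 h3.
move: h1 g1 w1; rewrite !ltr_norml !ler_norml.
move=> /andP[a1 b1] /andP[a2 b2] /andP[a3 b3] /andP[a4 b4]; lra.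
Qed.

Lemma separation C (e : R) : is_copula3 C -> 0 < e -> e <= 1 ->
  exists (T : set lineT) (eta : R), [/\ measurable T, 0 < eta &
    forall K K' C', is_cond_kernel (mix e C (split_copula T)) K ->
      simplified C' -> is_cond_kernel C' K' ->
      ~ [/\ gdist K K' (1 / 2) (1 / 2) < eta, gdist K K' (1 / 2) 1 < eta &
           gdist K K' 1 (1 / 2) < eta]].
Proof.
move=> hC e0 e1; have ie : in01 e by rewrite /in01 (ltW e0) e1.
have i1 := in01_1 R; have ih : in01 (1 / 2 : R) by rewrite /in01; apply/andP; split; lra.
have [K0 hK0] := cond_kernel_exists hC.
pose d := e / 40; have d0 : 0 < d by rewrite divr_gt0.
have k0 x y t : 0 <= kbox K0 x y t by case/andP: (kbox01 K0 x y t).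
have mI := measurable_Icc (0:R) 1.
have I0 : (0 < lam (Icc 0%R 1%R))%E by rewrite lam_Icc01.
have [S1 [mS1 S1I S10 f1]] := flat_set mI (@subset_refl _ _) I0
   (measurable_kbox K0 (1/2) (1/2)) (k0 _ _) d0.
have [S2 [mS2 S21 S20 f2]] := flat_set mS1 S1I S10 (measurable_kbox K0 (1/2) 1) (k0 _ _) d0.
have S2I := subset_trans S21 S1I.
have [S3 [mS3 S32 S30 f3]] := flat_set mS2 S2I S20 (measurable_kbox K0 1 (1/2)) (k0 _ _) d0.
have S3I := subset_trans S32 S2I.
have [T1 [T2 [[mT1 mT2] [T1S T2S] [T10 T20] T12]]] := split_set mS3 S3I S30.
have T1I := subset_trans T1S S3I; have T2I := subset_trans T2S S3I.
have finT T : measurable T -> T `<=` Icc 0 1 -> (0 < lam T)%E -> exists2 m : R, 0 < m & lam T = m%:E.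
  move=> mT TI T0; exists (fine (lam T)).
    rewrite -lte_fin fineK// ge0_fin_numE//; apply: (@le_lt_trans _ _ (lam (Icc 0%R 1%R))).
      by apply: le_measure; rewrite ?inE.
    by rewrite lam_Icc01 ltry.
  rewrite fineK// ge0_fin_numE//; apply: (@le_lt_trans _ _ (lam (Icc 0%R 1%R))).
    by apply: le_measure; rewrite ?inE.
  by rewrite lam_Icc01 ltry.
have [m1 m10 m1E] := finT _ mT1 T1I T10; have [m2 m20 m2E] := finT _ mT2 T2I T20.
pose m := Num.min m1 m2; have m0 : 0 < m by rewrite lt_min m10.
(* Three distances below [d * m / 3] add up to less than [d] times the measure of either piece, as
   [pick_point] demands on both. *)
exists T1, (d * m / 3); split => //; first by rewrite divr_gt0// mulr_gt0.
move=> K K' C' hK sC' hK' [g1 g2 g3].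
have [KS [A [hC' hKS hA SA]]] := simplified_kernel_ae sC'.
have [KE hKE] := cond_kernel_exists (split_copula3 mT1).
pose P t := [/\
  [/\ kbox K (1/2) (1/2) t = (1 - e) * kbox K0 (1/2) (1/2) t + e * kbox KE (1/2) (1/2) t,
      kbox K (1/2) 1 t = (1 - e) * kbox K0 (1/2) 1 t + e * kbox KE (1/2) 1 t &
      kbox K 1 (1/2) t = (1 - e) * kbox K0 1 (1/2) t + e * kbox KE 1 (1/2) t],
  [/\ kbox KE (1/2) (1/2) t = (if t \in T1 then 1 / 2 else 1 / 4),
      kbox KE (1/2) 1 t = 1 / 2 & kbox KE 1 (1/2) t = 1 / 2] &
  kbox K' (1/2) (1/2) t = A (kbox K' (1/2) 1 t) (kbox K' 1 (1/2) t)].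
have aeP : {ae lam, forall t, in01 t -> P t}.
  have a1 := mix_kernel_ae ie hK0 hKE hK ih ih.
  have a2 := mix_kernel_ae ie hK0 hKE hK ih i1.
  have a3 := mix_kernel_ae ie hK0 hKE hK i1 ih.
  have b1 := split_copula_kernel mT1 hKE ih ih.
  have b2 := split_copula_kernel mT1 hKE ih i1.
  have b3 := split_copula_kernel mT1 hKE i1 ih.
  (* [A] comes with the particular version [KS]; uniqueness at the three points carries its identity
     over to the given [K']. *)
  have c1 := cond_kernel_version hK' hKS ih ih.
  have c2 := cond_kernel_version hK' hKS ih i1.
  have c3 := cond_kernel_version hK' hKS i1 ih.
  have sa := SA _ _ ih ih.
  have [lh l1] := lowpart_half1; have [hh h1] := highpart_half1.
  have A1 := ae_and a1 (ae_and a2 a3).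
  have B1 := ae_and b1 (ae_and b2 b3).
  have E1 := ae_and (ae_and c1 (ae_and c2 c3)) sa.
  apply: ae_imp (ae_and A1 (ae_and B1 E1)) => t.
  move=> [[p1 [p2 p3]] [[q1 [q2 q3]] [[r1 [r2 r3]] s]]] it.
  split; [split; [exact: p1|exact: p2|exact: p3]|split|].
  - by rewrite q1// lh hh; case: ifP => _; field.
  - by rewrite q2// lh hh l1 h1; case: ifP => _; field.
  - by rewrite q3// lh hh l1 h1; case: ifP => _; field.
  - by rewrite r1// r2// r3// s.
have G T mm : measurable T -> T `<=` Icc 0 1 -> lam T = mm%:E -> m <= mm ->
    exists t, [/\ T t, P t, `|kbox K (1/2) (1/2) t - kbox K' (1/2) (1/2) t| < d,
      `|kbox K (1/2) 1 t - kbox K' (1/2) 1 t| < d &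
      `|kbox K 1 (1/2) t - kbox K' 1 (1/2) t| < d].
  move=> mT TI TE mmm; apply: pick_point => //; rewrite TE -EFinM lte_fin.
  apply: (@lt_le_trans _ _ (d * m)); last by rewrite ler_pM2l.
  have -> : d * m = d * m / 3 + d * m / 3 + d * m / 3 by field.
  by apply: ltrD => //; exact: ltrD.
have [t1 [Tt1 [[p1 p2 p3] [q1 q2 q3] s1] u1 u2 u3]] : exists t, _ :=
  G _ _ mT1 T1I m1E ltac:(by rewrite /m ge_min lexx).
have [t2 [Tt2 [[p1' p2' p3'] [q1' q2' q3'] s2] v1 v2 v3]] : exists t, _ :=
  G _ _ mT2 T2I m2E ltac:(by rewrite /m ge_min lexx orbT).
have n2 : (t2 \in T1) = false.
  by apply/negP => /set_mem h; have : (T1 `&` T2) t2 by []; rewrite T12.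
have t11 : (t1 \in T1) = true by apply/mem_set.
rewrite t11 in q1; rewrite n2 in q1'.
have S3t1 := T1S _ Tt1; have S3t2 := T2S _ Tt2.
have S2t1 := S32 _ S3t1; have S2t2 := S32 _ S3t2.
have w3 := f3 _ _ S3t1 S3t2; have w2 := f2 _ _ S2t1 S2t2.
have w1 := f1 _ _ (S21 _ S2t1) (S21 _ S2t2).
(* Mixing scales the original kernel by [1 - e], so its oscillation remains at most [d]. *)
have sc x y : `|x - y| <= d -> `|(1 - e) * x - (1 - e) * y| <= d.
  move=> xy; rewrite -mulrBr normrM ger0_norm ?subr_ge0//.
  by apply: le_trans xy; rewrite ler_piMl// gerBl ltW.
move: (sc _ _ w1) (sc _ _ w2) (sc _ _ w3) => {}w1 {}w2 {}w3.
have := copula2_lip hA (kbox01 K' (1/2) 1 t1) (kbox01 K' (1/2) 1 t2)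
  (kbox01 K' 1 (1/2) t1) (kbox01 K' 1 (1/2) t2).
rewrite -s1 -s2.
move: u1 u2 u3 v1 v2 v3 w1 w2 w3; rewrite p1 p2 p3 p1' p2' p3' q1 q2 q3 q1' q2' q3'.
have e40 : e = 40 * d by rewrite /d; field.
move: (kbox K' (1/2) (1/2) t1) (kbox K' (1/2) 1 t1) (kbox K' 1 (1/2) t1) => k1 k2 k3.
move: (kbox K' (1/2) (1/2) t2) (kbox K' (1/2) 1 t2) (kbox K' 1 (1/2) t2) => l1 l2 l3.
move: ((1 - e) * kbox K0 (1/2) (1/2) t1) ((1 - e) * kbox K0 (1/2) 1 t1) ((1 - e) * kbox K0 1 (1/2) t1) => x1 x2 x3.
move: ((1 - e) * kbox K0 (1/2) (1/2) t2) ((1 - e) * kbox K0 (1/2) 1 t2) ((1 - e) * kbox K0 1 (1/2) t2) => y1 y2 y3.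
rewrite {}e40; exact: separation_arith d0.
Qed.

End Separation.

(** * Nowhere density for the two metrics *)

Section MetricNowhereDense.
Variable R : realType.
Local Notation pkernel := (R.-pker R ~> (R * R)%type).
Implicit Types (K : pkernel) (C : R -> R -> R -> R).

(** [X] minus [V] is closed, contains [S] and misses [y], so [y] is not in the closure. Of [op] it
    is used only that its sets lie in [X], which covers metric and sequential openness together. *)
Lemma nowhere_dense_of_avoiding (T : Type) (X : set T) (op : set T -> Prop) (S : set T) :
  (forall U, op U -> U `<=` X) -> S `<=` X ->
  (forall U x, op U -> U x -> exists V y, [/\ op V, U y, V y & V `&` S = set0]) ->
  nowhere_dense_in X op S.
Proof.
move=> opX SX h U oU Ucl; apply/seteqP; split => // x Ux.
have [V [y [oV Uy Vy VS]]] := h U x oU Ux.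
have [_ /(_ (X `\` V))] := Ucl y Uy; case.
- by split; [exact: subDsetl|rewrite setDD setIidr//; exact: opX].
- move=> z Sz; split; first exact: SX.
  by move=> Vz; have : (V `&` S) z by []; rewrite VS.
- by move=> _ /(_ Vy).
Qed.

Definition test_close K (eta : R) K' : Prop :=
  [/\ gdist K K' (1 / 2) (1 / 2) < eta, gdist K K' (1 / 2) 1 < eta &
      gdist K K' 1 (1 / 2) < eta].

(** Asking for some kernel of [C] is enough, since all its versions have the same test distances. *)
Definition test_nbhs (X : set (R -> R -> R -> R)) K eta : set (R -> R -> R -> R) :=
  [set C | X C /\ exists2 K', is_cond_kernel C K' & test_close K eta K'].

Lemma gdist_refl K u1 u2 : gdist K K u1 u2 = 0.
Proof.
rewrite /gdist (_ : (\int[_]_(_ in _) _)%E = 0%E)//.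
by rewrite integral0_eq// => t _; rewrite subrr normr0.
Qed.

Lemma test_nbhs_self X C K eta : X C -> is_cond_kernel C K -> 0 < eta -> test_nbhs X K eta C.
Proof. by move=> XC hK e0; split => //; exists K => //; split; rewrite gdist_refl. Qed.

Lemma test_close_slack K K' eta : test_close K eta K' ->
  exists2 s, 0 < s & forall K'', test_close K' s K'' -> test_close K eta K''.
Proof.
move=> [g1 g2 g3].
pose s := Num.min (eta - gdist K K' (1 / 2) (1 / 2))
  (Num.min (eta - gdist K K' (1 / 2) 1) (eta - gdist K K' 1 (1 / 2))).
exists s; first by rewrite /s !lt_min !subr_gt0 g1 g2 g3.
move=> K'' []; rewrite /s !lt_min => /and3P[h1 _ _] /and3P[_ h2 _] /and3P[_ _ h3].
split.
- by apply: le_lt_trans (gdist_triangle K K' K'' _ _) _; rewrite -ltrBrDl.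
- by apply: le_lt_trans (gdist_triangle K K' K'' _ _) _; rewrite -ltrBrDl.
- by apply: le_lt_trans (gdist_triangle K K' K'' _ _) _; rewrite -ltrBrDl.
Qed.

Lemma D1_le C C' K K' (c : R) : is_cond_kernel C K -> is_cond_kernel C' K' -> 0 <= c ->
  (forall u1 u2, in01 u1 -> in01 u2 -> gdist K K' u1 u2 <= c) -> D1 C C' <= c.
Proof. by move=> hK hK' c0 h; rewrite -lee_fin (D1E hK hK'); exact: D1_of_le. Qed.

Lemma Dinf_le C C' K K' (c : R) : is_cond_kernel C K -> is_cond_kernel C' K' -> 0 <= c ->
  (forall u1 u2, in01 u1 -> in01 u2 -> gdist K K' u1 u2 <= c) -> Dinf C C' <= c.
Proof. by move=> hK hK' c0 h; rewrite -lee_fin (DinfE hK hK'); exact: Dinf_of_le. Qed.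

Lemma in01_half : in01 (1 / 2 : R).
Proof. by rewrite /in01; apply/andP; split; lra. Qed.

Lemma Dinf_test_close s : 0 < s -> exists2 r, 0 < r & forall C C' K K',
  is_copula3 C -> is_copula3 C' -> is_cond_kernel C K -> is_cond_kernel C' K' ->
  Dinf C C' < r -> test_close K s K'.
Proof.
move=> s0; exists s => // C C' K K' _ _ hK hK' Ds.
have i1 := in01_1 R; have ih := in01_half.
have h u1 u2 : in01 u1 -> in01 u2 -> gdist K K' u1 u2 < s.
  by move=> j1 j2; apply: le_lt_trans Ds; rewrite -lee_fin (DinfE hK hK'); exact: gdist_le_Dinf_of.
by split; exact: h.
Qed.

Lemma D1_test_close s : 0 < s -> exists2 r, 0 < r & forall C C' K K',
  is_copula3 C -> is_copula3 C' -> is_cond_kernel C K -> is_cond_kernel C' K' ->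
  D1 C C' < r -> test_close K s K'.
Proof.
(* The cap 1/2 keeps the averaging square below each test point inside the unit square. As
   [4 * h <= s / 3], a radius [s / 3] times the area [h * h] forces the test distances below
   [2 * s / 3]. *)
move=> s0; pose h := Num.min (1 / 2) (s / 12).
have h0 : 0 < h by rewrite lt_min !divr_gt0.
have hh : h <= 1 / 2 by rewrite ge_min lexx.
have h1 : h <= 1 by apply: le_trans hh _; lra.
have hs : h <= s / 12 by rewrite ge_min lexx orbT.
exists (s / 3 * (h * h)); first by rewrite !mulr_gt0// divr_gt0.
move=> C C' K K' hC hC' hK hK' Ds.
have i1 := in01_1 R; have ih := in01_half.
have g u1 u2 : in01 u1 -> in01 u2 -> h <= u1 -> h <= u2 -> gdist K K' u1 u2 < s.
  move=> j1 j2 hu1 hu2.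
  have := le_lt_trans (gdist_le_D1 hC hC' hK hK' j1 j2 h0 hu1 hu2) Ds.
  rewrite ltr_pM2r ?mulr_gt0//; lra.
by split; exact: g.
Qed.

(** The distance enters through two properties: it is bounded by any uniform bound on [gdist], and
    its smallness forces the three tests to be small. The space [X] enters through stability under
    proper mixing, so one argument yields all four metric statements. *)
Lemma metric_nowhere_dense (X S : set (R -> R -> R -> R))
    (d : (R -> R -> R -> R) -> (R -> R -> R -> R) -> R) :
  X `<=` @copula3 R -> S `<=` X -> S `<=` @simplified R ->
  (forall C e T, X C -> 0 < e -> e < 1 -> measurable (T : set (measurableTypeR R)) ->
    X (mix e C (split_copula T))) ->
  (forall C C' K K' (c : R), is_cond_kernel C K -> is_cond_kernel C' K' -> 0 <= c ->
    (forall u1 u2, in01 u1 -> in01 u2 -> gdist K K' u1 u2 <= c) -> d C C' <= c) ->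
  (forall s, 0 < s -> exists2 r, 0 < r & forall C C' K K',
    is_copula3 C -> is_copula3 C' -> is_cond_kernel C K -> is_cond_kernel C' K' ->
    d C C' < r -> test_close K s K') ->
  nowhere_dense_in X (metric_open X d) S.
Proof.
move=> XC SX Ss Xmix dle dclose; apply: nowhere_dense_of_avoiding => //.
  by move=> U [].
move=> U C [UX Uo] UC; have [r r0 hr] := Uo _ UC.
have hX := UX _ UC; have hC : is_copula3 C := XC _ hX.
(* [e < r] keeps the mixture in the ball, and [e < 1] keeps a share of [C], on which positivity of
   the density will rest. *)
pose e := Num.min (1 / 2) (r / 2).
have e0 : 0 < e by rewrite lt_min !divr_gt0.
have e1 : e < 1 by rewrite gt_min; apply/orP; left; lra.
have er : e < r by rewrite gt_min; apply/orP; right; lra.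
have ie : in01 e by rewrite /in01 !ltW.
have [T [eta [mT eta0 sep]]] := separation hC e0 (ltW e1).
have hy := Xmix _ _ _ hX e0 e1 mT.
have [K hK] := cond_kernel_exists (XC _ hy).
have [K0 hK0] := cond_kernel_exists hC.
exists (test_nbhs X K eta), (mix e C (split_copula T)); split.
- split; first by move=> ? [].
  move=> C1 [X1 [K1 hK1 cl1]].
  have [s s0 slack] := test_close_slack cl1.
  have [q q0 hq] := dclose _ s0; exists q => // C2 X2 d12.
  have [K2 hK2] := cond_kernel_exists (XC _ X2).
  split => //; exists K2 => //; apply: slack.
  by apply: (hq _ _ _ _ _ _ hK1 hK2 d12); exact: XC.
- apply: hr => //; apply: le_lt_trans er; apply: (dle _ _ _ _ _ hK0 hK) => //; first exact: ltW.
  by move=> u1 u2 j1 j2; apply: (gdist_mix_le ie (split_copula3 mT) hK0 hK).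
- exact: test_nbhs_self.
- apply/seteqP; split => // C' [[_ [K' hK' cl]] SC'].
  exact: (sep _ _ _ hK (Ss _ SC') hK').
Qed.

End MetricNowhereDense.

(** * Mixtures with positive density *)

Section PositiveDensity.
Variable R : realType.
Local Notation lineT := (measurableTypeR R).
Local Notation lam := (@lebesgue_measure R).
Local Notation lam3 := ((lam \x lam) \x lam)%E.

Lemma lam_low (u : R) : in01 u -> lam (Icc 0 u `&` Icc 0 (1 / 2)) = (lowpart u)%:E.
Proof.
move=> iu; have [u0 u1] := andP iu; rewrite /lowpart clamp01_id//.
rewrite -lam_Icc; last by rewrite le_min u0/=; lra.
congr (lam _); apply/seteqP; split => t; rewrite /Icc /= !in_itv/= le_min.
  by move=> [/andP[-> ->] /andP[_ ->]].
by move=> /and3P[-> -> ->].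
Qed.

Lemma lam_high (u : R) : in01 u -> lam (Icc 0 u `\` Icc 0 (1 / 2)) = (highpart u)%:E.
Proof.
move=> iu; have [u0 u1] := andP iu.
have mI := measurable_Icc (0:R) u; have mH := measurable_Icc (0:R) (1/2).
have mD := measurableD mI mH; have mDI := measurableI _ _ mI mH.
have : (lam (Icc 0%R u) = lam (Icc 0%R u `&` Icc 0%R (1 / 2)%R) + lam (Icc 0%R u `\` Icc 0%R (1 / 2)%R))%E.
  rewrite -measureU//; first by rewrite setUIDK.
  by rewrite setDE setIACA setICr setI0.
rewrite lam_low// lam_Icc// /highpart clamp01_id//.
have fin : lam (Icc 0 u `\` Icc 0 (1 / 2)) \is a fin_num.
  apply: (lam_Icc_sub_fin (v := u)) => //; rewrite clamp01_id//; exact: subDsetl.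
rewrite -(fineK fin) -EFinD => -[uE]; congr EFin; lra.
Qed.

(** The complements extend beyond the unit interval, but the density is integrated only over boxes
    inside the cube. *)
Definition split_density (T : set lineT) (z : (R * R) * R) : R :=
  \1_((Icc 0 1 `*` Icc 0 1) `*` ~` T) z
  + 2 * \1_((Icc 0 (1 / 2) `*` Icc 0 (1 / 2)) `*` T) z
  + 2 * \1_((~` Icc 0 (1 / 2) `*` ~` Icc 0 (1 / 2)) `*` T) z.

Lemma split_density_ge0 T z : 0 <= split_density T z.
Proof. by rewrite /split_density !addr_ge0// ?mulr_ge0// indicE. Qed.

Lemma lam3_rect (A B D : set lineT) (a b c : R) : measurable A -> measurable B -> measurable D ->
  lam A = a%:E -> lam B = b%:E -> lam D = c%:E ->
  lam3 ((A `*` B) `*` D) = (a * b * c)%:E.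
Proof.
move=> mA mB mD Aa Bb Dc.
transitivity ((lam \x lam) (A `*` B) * lam D)%E.
  by apply: product_measure1E => //; exact: measurableX.
transitivity (lam A * lam B * lam D)%E; last by rewrite Aa Bb Dc -!EFinM.
by congr (_ * _)%E; exact: product_measure1E.
Qed.

Section Density.
Variable T : set lineT.
Hypothesis mT : measurable T.

Let A0 : set ((lineT * lineT) * lineT) := (Icc 0 1 `*` Icc 0 1) `*` ~` T.
Let A1 : set ((lineT * lineT) * lineT) := (Icc 0 (1 / 2) `*` Icc 0 (1 / 2)) `*` T.
Let A2 : set ((lineT * lineT) * lineT) := (~` Icc 0 (1 / 2) `*` ~` Icc 0 (1 / 2)) `*` T.

Let mA0 : measurable A0.
Proof.
by apply: measurableX; [apply: measurableX; exact: measurable_Icc|exact: measurableC].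
Qed.
Let mA1 : measurable A1.
Proof. by apply: measurableX => //; apply: measurableX; exact: measurable_Icc. Qed.
Let mA2 : measurable A2.
Proof.
by apply: measurableX => //; apply: measurableX; apply: measurableC; exact: measurable_Icc.
Qed.

Lemma measurable_split_density : measurable_fun [set: (lineT * lineT) * lineT] (split_density T).
Proof.
by apply: measurable_funD; [apply: measurable_funD => //|]; try apply: measurable_funM => //;
  apply: measurable_indic.
Qed.

Lemma integral_split_density u1 u2 v : in01 u1 -> in01 u2 -> in01 v ->
  (\int[lam3]_(z in (Icc 0%R u1 `*` Icc 0%R u2) `*` Icc 0%R v) (split_density T z)%:E)%E =
  (split_copula T u1 u2 v)%:E.
Proof.
move=> i1 i2 iv; have [p1 q1] := andP i1; have [p2 q2] := andP i2; have [pv qv] := andP iv.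
pose B : set ((lineT * lineT) * lineT) := (Icc 0 u1 `*` Icc 0 u2) `*` Icc 0 v.
have mB : measurable B by apply: measurableX; [apply: measurableX|]; exact: measurable_Icc.
have mi A : measurable A -> measurable_fun B (fun z => (\1_A z)%:E : \bar R).
  by move=> mA; apply: measurable_funTS; apply/measurable_EFinP; exact: measurable_indic.
have i0 (A : set ((lineT * lineT) * lineT)) (z : (lineT * lineT) * lineT) :
    (0 <= (\1_A z)%:E :> \bar R)%E by rewrite lee_fin indicE.
rewrite (eq_integral (fun z => (\1_A0 z)%:E + (2%:E * (\1_A1 z)%:E + 2%:E * (\1_A2 z)%:E))%E);
  last by move=> z _; rewrite -!EFinM -!EFinD addrA.
have i20 (A : set ((lineT * lineT) * lineT)) z : (0 <= 2%:E * (\1_A z)%:E :> \bar R)%E.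
  by apply: mule_ge0; [rewrite lee_fin|exact: i0].
have m2i A : measurable A -> measurable_fun B (fun z => 2%:E * (\1_A z)%:E : \bar R)%E.
  by move=> mA; apply: measurable_funeM; exact: mi.
rewrite ge0_integralD//; [|exact: mi|by move=> z _; exact: adde_ge0|
  by apply: emeasurable_funD; exact: m2i].
rewrite ge0_integralD//; [|exact: m2i|exact: m2i].
rewrite !ge0_integralZl//; [|exact: mi|exact: mi].
rewrite !integral_indic//.
have e0 : lam3 (A0 `&` B) = (u1 * u2 * timeoff T v)%:E.
  rewrite (_ : A0 `&` B = (Icc 0 u1 `*` Icc 0 u2) `*` (Icc 0 v `\` T)).
    apply: lam3_rect; rewrite ?lam_Icc//; try exact: measurable_Icc.
      by apply: measurableD => //; exact: measurable_Icc.
    by rewrite timeoffE// clamp01_id.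
  apply/seteqP; split => -[[x y] t]; rewrite /A0 /B /Icc /= !in_itv/=; first by move=> [[_ ?] [[? ?] ?]].
  move=> [[/andP[x0 xu] /andP[y0 yu]] [tv nT]].
  by rewrite x0 y0 xu yu (le_trans xu q1) (le_trans yu q2).
have e1 : lam3 (A1 `&` B) = (lowpart u1 * lowpart u2 * timeon T v)%:E.
  rewrite (_ : A1 `&` B = ((Icc 0 u1 `&` Icc 0 (1/2)) `*` (Icc 0 u2 `&` Icc 0 (1/2))) `*` (Icc 0 v `&` T)).
    apply: lam3_rect; try (by apply: lam_low); try (by apply: measurableI => //; exact: measurable_Icc).
    by rewrite timeonE// clamp01_id.
  by apply/seteqP; split => -[[x y] t]; rewrite /A1 /B /=; tauto.
have e2 : lam3 (A2 `&` B) = (highpart u1 * highpart u2 * timeon T v)%:E.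
  rewrite (_ : A2 `&` B = ((Icc 0 u1 `\` Icc 0 (1/2)) `*` (Icc 0 u2 `\` Icc 0 (1/2))) `*` (Icc 0 v `&` T)).
    apply: lam3_rect; try (by apply: lam_high); try (by apply: measurableD => //; exact: measurable_Icc).
      by apply: measurableI => //; exact: measurable_Icc.
    by rewrite timeonE// clamp01_id.
  by apply/seteqP; split => -[[x y] t]; rewrite /A2 /B /=; tauto.
transitivity (lam3 (A0 `&` B) + (2%:E * lam3 (A1 `&` B) + 2%:E * lam3 (A2 `&` B)))%E; first by [].
rewrite e0 e1 e2 -!EFinM -!EFinD /split_copula !clamp01_id//; congr EFin; ring.
Qed.

End Density.

(** The split density vanishes off the diagonal cells at times in [T]; positivity comes from the
    share [1 - e] of the original density. *)
Lemma mix_ac_pos C (e : R) (T : set lineT) : ac_pos C -> 0 < e -> e < 1 -> measurable T ->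
  ac_pos (mix e C (split_copula T)).
Proof.
move=> [hC [c [mc c0 cE cpos]]] e0 e1 mT.
have e1' : 0 < 1 - e by rewrite subr_gt0.
split; first by apply: mix_copula3 => //; [rewrite /in01 !ltW|exact: split_copula3].
have ms : measurable_fun setT (split_density T) := measurable_split_density mT.
exists (fun z => (1 - e) * c z + e * split_density T z); split.
- by apply: measurable_funD; apply: measurable_funM.
- by move=> z; rewrite addr_ge0// mulr_ge0// ?(ltW e0) ?(ltW e1')// split_density_ge0.
- move=> u1 u2 v i1 i2 iv.
  have mB : measurable ((Icc 0 u1 `*` Icc 0 u2) `*` Icc 0 v : set ((lineT * lineT) * lineT)).
    by apply: measurableX; [apply: measurableX|]; exact: measurable_Icc.
  have mm (k : R) (f : (R * R) * R -> R) : measurable_fun setT f ->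
      measurable_fun ((Icc 0 u1 `*` Icc 0 u2) `*` Icc 0 v : set ((lineT * lineT) * lineT)) (fun z => k%:E * (f z)%:E)%E.
    by move=> mf; apply: measurable_funTS; apply: measurable_funeM; apply/measurable_EFinP.
  have mm1 (f : (R * R) * R -> R) : measurable_fun setT f ->
      measurable_fun ((Icc 0 u1 `*` Icc 0 u2) `*` Icc 0 v : set ((lineT * lineT) * lineT)) (fun z => (f z)%:E)%E.
    by move=> mf; apply: measurable_funTS; apply/measurable_EFinP.
  under eq_integral do rewrite EFinD !EFinM.
  rewrite ge0_integralD//; first last.
  + exact: (mm e _ ms).
  + by move=> z _; rewrite -EFinM lee_fin mulr_ge0// ?(ltW e0)// split_density_ge0.
  + exact: (mm (1 - e) _ mc).
  + by move=> z _; rewrite -EFinM lee_fin mulr_ge0// ltW.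
  rewrite !ge0_integralZl ?lee_fin ?(ltW e0) ?(ltW e1')//; first last.
  all: try exact: (mm1 _ ms); try exact: (mm1 _ mc).
  all: try by move=> z _; rewrite lee_fin ?split_density_ge0 ?c0.
  by rewrite -cE// integral_split_density// -!EFinM -EFinD.
- have [N [mN N0 HN]] := cpos; exists N; split => // z /= nz; apply: HN => /= hz.
  apply: nz => zI; have cz := hz zI.
  by rewrite ltr_wpDr ?mulr_gt0// mulr_ge0// ?(ltW e0)// split_density_ge0.
Qed.

End PositiveDensity.

(** * Weak conditional convergence of mixtures *)

Section WeakConditionalMixtures.
Variable R : realType.
Local Notation lineT := (measurableTypeR R).
Local Notation lam := (@lebesgue_measure R).
Local Notation pkernel := (R.-pker R ~> (R * R)%type).
Implicit Types (K : pkernel) (C : R -> R -> R -> R).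

(** The preimage of an open ray is open, hence a countable union of rational rectangles, which lie
    in the product sigma-algebra. *)
Lemma measurable_continuous2 (f : R * R -> R) : continuous f -> measurable_fun setT f.
Proof.
move=> cf; apply: (measurability _ (RGenInftyO.measurableE R)) => _ [_ [c ->] <-].
rewrite setTI; set U := _ @^-1` _.
have oU : open U by move/continuousP : cf; apply; exact: interval_open.
pose rect (p q r s : rat) : set (R * R) := `]ratr p, ratr q[%classic `*` `]ratr r, ratr s[%classic.
have -> : U = \bigcup_(p : rat) \bigcup_(q : rat) \bigcup_(r : rat) \bigcup_(s : rat)
    (if `[< rect p q r s `<=` U >] then rect p q r s else set0).
  apply/seteqP; split => [[x y] Uxy|z]; last first.
    by move=> [p _ [q _ [r _ [s _]]]]; case: asboolP => // h /h.
  have /nbhs_ballP[e /= e0 he] : nbhs (x, y) U by exact: open_nbhs_nbhs.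
  have [p] : exists p : rat, ratr p \in `](x - e), x[ by apply: rat_in_itvoo; rewrite gtrBl.
  rewrite in_itv/= => /andP[p1 p2].
  have [q] : exists q : rat, ratr q \in `]x, (x + e)[ by apply: rat_in_itvoo; rewrite ltrDl.
  rewrite in_itv/= => /andP[q1 q2].
  have [r] : exists r : rat, ratr r \in `](y - e), y[ by apply: rat_in_itvoo; rewrite gtrBl.
  rewrite in_itv/= => /andP[r1 r2].
  have [s] : exists s : rat, ratr s \in `]y, (y + e)[ by apply: rat_in_itvoo; rewrite ltrDl.
  rewrite in_itv/= => /andP[s1 s2].
  exists p => //; exists q => //; exists r => //; exists s => //; rewrite ifT.
    by rewrite /rect /= !in_itv/= p2 q1 r2 s1.
  apply/asboolP => -[a b]; rewrite /rect /= !in_itv/= => -[/andP[a1 a2] /andP[b1 b2]].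
  by apply: he; split => /=; rewrite /ball/= ltr_norml; apply/andP; split; lra.
do 4 (apply: bigcupT_measurable_rat => ?).
by case: ifP => // _; apply: measurableX; exact: measurable_itv.
Qed.

Lemma full_setI (m : {measure set (R * R) -> \bar R}) (D A : set (R * R)) :
  measurable D -> measurable A -> m setT = 1%E -> m D = 1%E -> m A = m (A `&` D).
Proof.
move=> mD mA mT mD1.
have mAD := measurableI _ _ mA mD; have mAC := measurableD mA mD.
have mC : measurable (~` D) by exact: measurableC.
have h0 : m (~` D) = 0%E.
  have : (m D + m (~` D) = 1)%E by rewrite -measureU// ?setUv// setICr.
  rewrite mD1; case: (m (~` D)) => [r||] //=; rewrite -EFinD => -[] h.
  by congr EFin; apply: (addrI 1); rewrite h addr0.
have h1 : m (A `\` D) = 0%E.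
  by apply/eqP; rewrite -measure_le0 -h0; apply: le_measure; rewrite ?inE// => x [].
transitivity (m (A `&` D) + m (A `\` D))%E; last by rewrite h1 adde0.
rewrite -measureU//; first by rewrite setUIDK.
by rewrite setDE setIACA setICr setI0.
Qed.

Lemma kernel_quadrant K t (p q : rat) : kbox K 1 1 t = 1 ->
  K t (@rat_quad R p q) =
  (if (0 <= ratr p :> R) && (0 <= ratr q :> R)
   then kbox K (clamp01 (ratr p)) (clamp01 (ratr q)) t else 0)%:E.
Proof.
move=> k1; have mB := measurable_box (1:R) 1.
have mQ : measurable (@rat_quad R p q) by apply: measurableX.
rewrite (full_setI mB mQ); [| exact: prob_kernel|by rewrite -kboxE k1].
have cl (x : R) : 0 <= x -> clamp01 x = Num.min x 1.
  by move=> x0; rewrite /clamp01 (max_idPr _)// le_min x0 ler01.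
case: ifPn => [/andP[p0 q0]|h].
  rewrite kboxE !cl//; congr (K t _); apply/seteqP; split => -[x y];
    rewrite /rat_quad /box /Icc /= !in_itv/= !le_min.
    by move=> [[-> ->] [/andP[-> ->] /andP[-> ->]]].
  by move=> [/and3P[-> -> ->] /and3P[-> -> ->]].
rewrite (_ : _ `&` _ = set0) ?measure0//; apply/seteqP; split => -[x y] //.
rewrite /rat_quad /box /Icc /= !in_itv/= => -[[xp yq] [/andP[x0 _] /andP[y0 _]]].
by move: h; rewrite (le_trans x0 xp) (le_trans y0 yq).
Qed.

(** The defining formula constrains only integrals over time, so a version may charge points outside
    the unit square, though only at a null set of times. *)
Lemma kernel_full_ae C K : is_copula3 C -> is_cond_kernel C K ->
  {ae lam, forall t, in01 t -> kbox K 1 1 t = 1}.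
Proof.
move=> [_ _ C1 _] hK; apply: (cond_kernel_ae hK (g := cst 1)); try exact: in01_1.
- exact: measurable_cst.
- by move=> t /=; rewrite ler01 lexx.
- move=> v iv; have [v0 v1] := andP iv.
  rewrite (eq_integral (cst 1%E)); last by [].
  rewrite (integral_cst _ (measurable_Icc 0 v)) mul1e.
  case: (C1 _ iv) => _ _ ->; exact: lam_Icc.
Qed.

(** Weak convergence tests the whole measure at a fixed time, so one null set must serve all Borel
    sets; the countably many rational quadrants provide it. *)
Lemma mix_kernel_measure_ae e C C' K K' K'' : in01 e -> is_copula3 C -> is_copula3 C' ->
  is_cond_kernel C K -> is_cond_kernel C' K' -> is_cond_kernel (mix e C C') K'' ->
  {ae lam, forall t, in01 t -> forall A, measurable A ->
    K'' t A = ((1 - e)%:E * K t A + e%:E * K' t A)%E}.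
Proof.
move=> ie hC hC' hK hK' hK''; have [e0 e1] := andP ie.
have hM := mix_copula3 ie hC hC'.
have aq : {ae lam, forall t, forall pq : rat * rat, in01 t ->
   kbox K'' (clamp01 (ratr pq.1)) (clamp01 (ratr pq.2)) t =
   (1 - e) * kbox K (clamp01 (ratr pq.1)) (clamp01 (ratr pq.2)) t +
   e * kbox K' (clamp01 (ratr pq.1)) (clamp01 (ratr pq.2)) t}.
  by apply: ae_forall_countable => pq; apply: (mix_kernel_ae ie hK hK' hK''); exact: clamp01_in01.
have a1 := kernel_full_ae hC hK; have a2 := kernel_full_ae hC' hK'.
have a3 := kernel_full_ae hM hK''.
apply: ae_imp (ae_and aq (ae_and a1 (ae_and a2 a3))) => t [q [k1 [k2 k3]]] it.
move: k1 k2 k3 => /(_ it) k1 /(_ it) k2 /(_ it) k3 A mA.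
have e1' : 0 <= 1 - e by rewrite subr_ge0.
pose m := measure_add (mscale (NngNum e1') (K t)) (mscale (NngNum e0) (K' t)).
have mE B : m B = ((1 - e)%:E * K t B + e%:E * K' t B)%E by exact: measure_addE.
rewrite -mE; apply: (measure_eq_rat_quad (m1 := K'' t) (m2 := m)) => //.
  by rewrite prob_kernel ltry.
move=> p r; rewrite [RHS]mE !kernel_quadrant// -!EFinM -EFinD; congr EFin.
by case: ifP => _; [exact: (q (p, r) it)|rewrite !mulr0 addr0].
Qed.

Lemma bounded_integral (m : {measure set (R * R) -> \bar R}) (h : R * R -> R) M :
  m setT = 1%E -> measurable_fun setT h -> (forall x, 0 <= h x <= M) ->
  exists p : R, [/\ 0 <= p <= M & (\int[m]_x (h x)%:E)%E = p%:E].
Proof.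
move=> mT mh hM.
have i0 : (0 <= \int[m]_x (h x)%:E)%E.
  by apply: integral_ge0 => x _; rewrite lee_fin; case/andP: (hM x).
have iM : (\int[m]_x (h x)%:E <= M%:E)%E.
  apply: (@le_trans _ _ (\int[m]_x (cst M%:E x))%E).
    by apply: ge0_le_integralW => x _ /=; rewrite lee_fin; case/andP: (hM x).
  by rewrite integral_cst// mT mule1.
exists (fine (\int[m]_x (h x)%:E)%E); have fin : (\int[m]_x (h x)%:E)%E \is a fin_num.
  by rewrite ge0_fin_numE// (le_lt_trans iM)// ltry.
by rewrite -!lee_fin fineK// i0 iM.
Qed.

Lemma mix_integral (e : R) (m m' m'' : {measure set (R * R) -> \bar R}) (h : R * R -> R) :
  in01 e -> measurable_fun setT h -> (forall x, 0 <= h x) ->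
  (forall A, measurable A -> m'' A = ((1 - e)%:E * m A + e%:E * m' A)%E) ->
  (\int[m'']_x (h x)%:E = (1 - e)%:E * \int[m]_x (h x)%:E + e%:E * \int[m']_x (h x)%:E)%E.
Proof.
move=> /andP[e0 e1] mh h0 mE; have e1' : 0 <= 1 - e by rewrite subr_ge0.
pose mm := measure_add (mscale (NngNum e1') m) (mscale (NngNum e0) m').
have mhE : measurable_fun setT (EFin \o h) by exact/measurable_EFinP.
rewrite (eq_measure_integral mm); last first.
  by move=> A mA _; rewrite mE//; apply/esym; exact: measure_addE.
have hE x : setT x -> (0 <= (EFin \o h) x)%E by move=> _; rewrite lee_fin.
rewrite ge0_integral_measure_add//.
by congr (_ + _)%E; rewrite ge0_integral_mscale.
Qed.

(** The integrals against [m] and [m''] differ by [e] times a difference of two integrals, each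
    between [-M] and [M]. Positive and negative parts reduce linearity in the measure to nonnegative
    integrands. *)
Lemma mix_weak_close (e M : R) (m m' m'' : {measure set (R * R) -> \bar R}) (f : R * R -> R) :
  in01 e -> measurable_fun setT f -> (forall x, `|f x| <= M) ->
  m setT = 1%E -> m' setT = 1%E ->
  (forall A, measurable A -> m'' A = ((1 - e)%:E * m A + e%:E * m' A)%E) ->
  exists p q : R, [/\ (\int[m'']_x (f x)%:E)%E = p%:E, (\int[m]_x (f x)%:E)%E = q%:E &
    `|q - p| <= e * (2 * M)].
Proof.
move=> ie mf fM mT mT' mE; have [e0 e1] := andP ie.
have pn (n : {measure set (R * R) -> \bar R}) : (\int[n]_x (f x)%:E = \int[n]_x (Num.max (f x) 0)%:E
     - \int[n]_x (Num.max (- f x) 0)%:E)%E.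
  rewrite integralE; congr (_ - _)%E; apply: eq_integral => x _.
    by rewrite funeposE EFin_max.
  by rewrite funenegE EFin_max EFinN.
have mp : measurable_fun setT (fun x => Num.max (f x) 0) by exact: measurable_maxr.
have mn : measurable_fun setT (fun x => Num.max (- f x) 0).
  by apply: measurable_maxr => //; exact: measurableT_comp.
have M0 : 0 <= M by apply: le_trans (fM (0, 0)).
have hp x : 0 <= Num.max (f x) 0 <= M.
  by rewrite le_max lexx orbT ge_max M0 andbT (le_trans (ler_norm _)).
have hn x : 0 <= Num.max (- f x) 0 <= M.
  by rewrite le_max lexx orbT ge_max M0 andbT (le_trans (ler_norm _))// normrN.
have [p [/andP[p0 pM] pE]] := bounded_integral mT mp hp.
have [p' [/andP[p0' pM'] pE']] := bounded_integral mT' mp hp.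
have [n [/andP[n0 nM] nE]] := bounded_integral mT mn hn.
have [n' [/andP[n0' nM'] nE']] := bounded_integral mT' mn hn.
have hp0 x : 0 <= Num.max (f x) 0 by case/andP: (hp x).
have hn0 x : 0 <= Num.max (- f x) 0 by case/andP: (hn x).
exists (((1 - e) * p + e * p') - ((1 - e) * n + e * n')), (p - n); split.
- rewrite pn (mix_integral ie mp hp0 mE) (mix_integral ie mn hn0 mE) pE pE' nE nE'.
  by rewrite -!EFinM -!EFinD.
- by rewrite pn pE nE -EFinB.
- rewrite (_ : _ - _ = e * ((p - n) - (p' - n'))); last by ring.
  rewrite normrM ger0_norm// ler_wpM2l// ler_norml; apply/andP; split; lra.
Qed.

(** The error [e n * (2 * M)] does not involve [C' n], so the admixed copulas may vary with [n]
    without converging themselves. *)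
Lemma wcc_mix (e : nat -> R) C (C' : nat -> R -> R -> R -> R) : is_copula3 C ->
  (forall n, is_copula3 (C' n)) -> (forall n, in01 (e n)) -> e @ \oo --> (0 : R) ->
  wcc (fun n => mix (e n) C (C' n)) C.
Proof.
move=> hC hC' ie ecv Kn K hKn hK.
have /choice[K' hK'] : forall n, exists K, is_cond_kernel (C' n) K.
  by move=> n; exact: cond_kernel_exists.
have ae : {ae lam, forall t, forall n : nat, in01 t -> forall A, measurable A ->
    Kn n t A = ((1 - e n)%:E * K t A + (e n)%:E * K' n t A)%E}.
  apply: ae_forall_countable => n.
  exact: (mix_kernel_measure_ae (ie n) hC (hC' n) hK (hK' n) (hKn n)).
apply: ae_imp ae => t h it f cf [M fM].
have mf := measurable_continuous2 cf.
have /choice[p hp] : forall n, exists p : R, exists q : R, [/\ (\int[Kn n t]_x (f x)%:E)%E = p%:E,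
    (\int[K t]_x (f x)%:E)%E = q%:E & `|q - p| <= e n * (2 * M)].
  move=> n; apply: (mix_weak_close (m' := K' n t) (ie n) mf fM).
  - exact: prob_kernel.
  - exact: prob_kernel.
  - by move=> A mA; exact: (h n it A mA).
have [q [_ qE _]] := hp 0%N; rewrite qE.
rewrite (_ : (fun n => _) = EFin \o p); last first.
  by apply/funext => n; have [? [-> _ _]] := hp n.
apply/cvg_EFin; first by apply: nearW => n.
have M0 : 0 <= M by apply: le_trans (fM (0, 0)).
apply/cvgrPdist_le => d d0.
(* The summand 1 keeps the divisor positive when [M = 0]. *)
have d1 : 0 < d / (2 * M + 1) by rewrite divr_gt0// ltr_wpDl// mulr_ge0.
have /cvgrPdist_le/(_ _ d1) := ecv; apply: filterS => n /=.
rewrite sub0r normrN ger0_norm; last by case/andP: (ie n).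
rewrite ler_pdivlMr; last by rewrite ltr_wpDl// mulr_ge0.
move=> ed; have [q' [_ q'E le]] := hp n.
have -> : q = q' by apply: EFin_inj; rewrite -qE -q'E.
apply: le_trans le _; apply: le_trans ed.
by rewrite mulrDr mulr1 lerDl; case/andP: (ie n).
Qed.

End WeakConditionalMixtures.

(** * Openness of the test neighbourhoods under weak conditional convergence *)

Section WeakConditionalTopology.
Variable R : realType.
Local Notation lineT := (measurableTypeR R).
Local Notation lam := (@lebesgue_measure R).
Local Notation pkernel := (R.-pker R ~> (R * R)%type).
Implicit Types (K : pkernel) (C : R -> R -> R -> R).

Lemma continuous_clamp01 : continuous (@clamp01 R).
Proof.
move=> x; apply/cvgrPdist_le => e e0; near=> y.
have xye : `|x - y| <= e by near: y; apply: cvgr_dist_le.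
apply: le_trans xye; case: (leP x y) => [|/ltW] xy.
  by rewrite distrC [leRHS]distrC !ger0_norm ?subr_ge0 ?clamp01_nd ?clamp01_lip.
by rewrite !ger0_norm ?subr_ge0 ?clamp01_nd ?clamp01_lip.
Unshelve. all: by end_near. Qed.

Section Tent.
Variables (u1 u2 d : R).
Hypothesis d0 : 0 < d.

(** Equal to 1 up to [u], to 0 from [u + d] on, and linear between: a continuous substitute for the
    indicator of a ray, admissible as a test function. *)
Definition cutoff (u x : R) : R := clamp01 ((u + d - x) / d).
Definition cutoff2 (z : R * R) : R := cutoff u1 z.1 * cutoff u2 z.2.

Lemma continuous_cutoff u : continuous (cutoff u).
Proof.
move=> x; apply: (@continuous_comp _ _ _ (fun x => (u + d - x) / d) (@clamp01 R)).
  apply: cvgM; last exact: cvg_cst.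
  by apply: cvgB; [exact: cvg_cst|exact: cvg_id].
exact: continuous_clamp01.
Qed.

Lemma continuous_cutoff2 : continuous cutoff2.
Proof.
move=> z; apply: cvgM.
  by apply: continuous_comp; [exact: cvg_fst|exact: continuous_cutoff].
by apply: continuous_comp; [exact: cvg_snd|exact: continuous_cutoff].
Qed.

Lemma cutoff01 u x : 0 <= cutoff u x <= 1.
Proof. by rewrite clamp01_ge0 clamp01_le1. Qed.

Lemma cutoff_eq1 u x : x <= u -> cutoff u x = 1.
Proof. by move=> xu; rewrite /cutoff clamp01_ge1// ler_pdivlMr//; lra. Qed.

Lemma cutoff_eq0 u x : u + d <= x -> cutoff u x = 0.
Proof. by move=> xu; rewrite /cutoff clamp01_le0// ler_pdivrMr//; lra. Qed.

Lemma cutoff201 z : 0 <= cutoff2 z <= 1.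
Proof.
have /andP[a b] := cutoff01 u1 z.1; have /andP[a' b'] := cutoff01 u2 z.2.
by rewrite /cutoff2 mulr_ge0//= mulr_ile1.
Qed.

Lemma measurable_cutoff2 : measurable_fun setT cutoff2.
Proof. exact (measurable_continuous2 continuous_cutoff2). Qed.

Definition kcut K (t : R) : R := fine (\int[K t]_z (cutoff2 z)%:E)%E.

Lemma kcutE K t : (kcut K t)%:E = (\int[K t]_z (cutoff2 z)%:E)%E /\ 0 <= kcut K t <= 1.
Proof.
have [p [p01 pE]] := bounded_integral (prob_kernel (s := K) t) measurable_cutoff2 cutoff201.
by rewrite /kcut pE /=.
Qed.

Lemma measurable_kcut K : measurable_fun [set: lineT] (kcut K).
Proof.
apply/measurable_EFinP; rewrite (_ : _ \o _ = fun t => \int[K t]_z (cutoff2 z)%:E)%E; last first.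
  by apply/funext => t /=; rewrite (kcutE K t).1.
apply: (@measurable_fun_integral_kernel _ _ R (R * R)%type R K (measurable_kernel K)
  (EFin \o cutoff2)).
- by move=> z; rewrite lee_fin; case/andP: (cutoff201 z).
- by apply/measurable_EFinP; exact: measurable_cutoff2.
Qed.

Hypotheses (i1 : in01 u1) (i2 : in01 u2).
Let v1 := Num.min (u1 + d) 1.
Let v2 := Num.min (u2 + d) 1.

(** The cutoff lies above the indicator of the small box, and below that of the enlarged box plus
    that of the complement of the unit square, which has no mass by assumption. *)
Lemma kcut_bounds K t : kbox K 1 1 t = 1 ->
  kbox K u1 u2 t <= kcut K t <= kbox K v1 v2 t.
Proof.
move=> k1; rewrite -!lee_fin (kcutE K t).1 !kboxE; apply/andP; split.
  have -> : K t (box u1 u2) = (\int[K t]_z (\1_(box u1 u2) z)%:E)%E.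
    by rewrite integral_indic ?setIT//; exact: measurable_box.
  apply: ge0_le_integralW => z _ /=; first by rewrite lee_fin indicE.
  rewrite lee_fin indicE; case: (boolP (z \in _)) => [|_]; last by case/andP: (cutoff201 z).
  rewrite inE /box /Icc /= !in_itv/= => -[/andP[_ h1] /andP[_ h2]].
  by rewrite /cutoff2 !cutoff_eq1// mulr1.
have mB := measurable_box (1 : R) 1; have mv := measurable_box v1 v2.
have mC : measurable (~` box 1 1 : set (R * R)) by exact: measurableC.
have kC : K t (~` box 1 1) = 0%E.
  by rewrite (full_setI mB mC) ?setICl ?measure0//; [exact: prob_kernel|rewrite -kboxE k1].
apply: (@le_trans _ _ (\int[K t]_z ((\1_(box v1 v2) z)%:E + (\1_(~` box 1 1) z)%:E))%E).
  apply: ge0_le_integralW => z _; first by rewrite lee_fin; case/andP: (cutoff201 z).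
  rewrite -EFinD lee_fin !indicE in_setC.
  case: (boolP (z \in box 1 1)) => [|_]; last first.
    by have /andP[_ h] := cutoff201 z; rewrite (le_trans h)//= lerDr.
  rewrite inE /box /Icc /= !in_itv/= addr0 => -[/andP[x0 x1] /andP[y0 y1]].
  have [hx|hx] := ltP (u1 + d) z.1; first by rewrite /cutoff2 cutoff_eq0 ?mul0r// ltW.
  have [hy|hy] := ltP (u2 + d) z.2; first by rewrite /cutoff2 (@cutoff_eq0 u2) ?mulr0// ltW.
  rewrite mem_set; first by case/andP: (cutoff201 z).
  by rewrite /= !in_itv/= x0 y0 /v1 /v2 !le_min hx hy x1 y1.
have m1 (A : set (R * R)) : measurable A -> measurable_fun setT (fun z => (\1_A z)%:E : \bar R).
  by move=> mA; apply/measurable_EFinP; exact: measurable_indic.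
rewrite (ge0_integralD (K t) measurableT _ (m1 _ mv) _ (m1 _ mC)).
- by rewrite !integral_indic// !setIT kC adde0.
- by move=> z _; rewrite lee_fin indicE.
- by move=> z _; rewrite lee_fin indicE.
Qed.

Lemma in01_cut u : in01 u -> in01 (Num.min (u + d) 1).
Proof.
move=> /andP[u0 _]; rewrite /in01 le_min ler01 ge_min lexx orbT !andbT.
by rewrite addr_ge0// ltW.
Qed.

(** Both box values are sandwiched around their cutoffs; each sandwich has mean width at most
    [2 * d] because the margins are uniform, and there are two of them. *)
Lemma gdist_le_kcut C C' K K' : is_copula3 C -> is_copula3 C' ->
  is_cond_kernel C K -> is_cond_kernel C' K' ->
  ((gdist K K' u1 u2)%:E <= \int[lam]_(t in Icc 0%R 1%R) `|kcut K' t - kcut K t|%:E + (4 * d)%:E)%E.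
Proof.
move=> hC hC' hK hK'.
have mI := measurable_Icc (0:R) 1.
have j1 := in01_cut i1; have j2 := in01_cut i2.
have uv1 : u1 <= v1 by rewrite le_min lerDl ltW//=; case/andP: i1.
have uv2 : u2 <= v2 by rewrite le_min lerDl ltW//=; case/andP: i2.
have vd1 : v1 <= u1 + d by rewrite ge_min lexx.
have vd2 : v2 <= u2 + d by rewrite ge_min lexx.
have mw k : measurable_fun (Icc 0 1 : set lineT) (fun t => (kbox k v1 v2 t - kbox k u1 u2 t)%:E).
  by apply: measurable_funTS; apply/measurable_EFinP; apply: measurable_funB; exact: measurable_kbox.
have w0 k t : (0 <= (kbox k v1 v2 t - kbox k u1 u2 t)%:E)%E by rewrite lee_fin subr_ge0 kbox_le.
have mc : measurable_fun (Icc 0 1 : set lineT) (fun t => `|kcut K' t - kcut K t|%:E).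
  apply: measurable_funTS; apply/measurable_EFinP; apply: measurableT_comp => //.
  by apply: measurable_funB; exact: measurable_kcut.
have wle c k : is_copula3 c -> is_cond_kernel c k ->
    (\int[lam]_(t in Icc 0%R 1%R) (kbox k v1 v2 t - kbox k u1 u2 t)%:E <= (2 * d)%:E)%E.
  move=> hc hk; apply: le_trans (integral_kdiff_box hc hk j1 j2 i1 i2 uv1 uv2) _.
  rewrite lee_fin -/v1 -/v2; lra.
rewrite gdistE (_ : 4 * d = 2 * d + 2 * d); last by ring.
rewrite EFinD; apply: le_trans; last first.
  by apply: leeD2l; apply: leeD; [exact: (wle _ _ hC hK)|exact: (wle _ _ hC' hK')].
rewrite -ge0_integralD// -ge0_integralD//; first last.
- exact: emeasurable_funD.
- by move=> t _; rewrite adde_ge0.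
apply: ae_ge0_le_integral => //.
- exact: measurable_kdiffE.
- by move=> t _; rewrite !adde_ge0.
- by do 2 apply: emeasurable_funD => //.
have a1 := kernel_full_ae hC hK; have a2 := kernel_full_ae hC' hK'.
apply: ae_imp (ae_and a1 a2) => t [k1 k2]; rewrite /Icc /= in_itv/= => it.
have /andP[b1 c1] := kcut_bounds (k1 it); have /andP[b2 c2] := kcut_bounds (k2 it).
rewrite -!EFinD lee_fin.
set x := kcut K' t in b2 c2 *; set y := kcut K t in b1 c1 *.
have : `|y - x| = `|x - y| by rewrite distrC.
have := ler_norm (x - y); have := ler_norm (y - x) => h1 h2 h3.
by rewrite ler_norml; apply/andP; split; lra.
Qed.

End Tent.

(** The boundary of a box may carry mass, so weak convergence does not give convergence of box
    values at each time. The cutoffs do converge, dominated convergence integrates this over time,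
    and the smoothing error is uniform in [n]. *)
Lemma wcc_gdist (Cn : nat -> R -> R -> R -> R) C (Kn : nat -> pkernel) K u1 u2 (s : R) :
  (forall n, is_copula3 (Cn n)) -> is_copula3 C ->
  (forall n, is_cond_kernel (Cn n) (Kn n)) -> is_cond_kernel C K -> wcc Cn C ->
  in01 u1 -> in01 u2 -> 0 < s -> \forall n \near \oo, gdist K (Kn n) u1 u2 < s.
Proof.
(* With this width the smoothing error [4 * d] is [s / 2], leaving the other half to the convergence
   of the cutoffs. *)
move=> hCn hC hKn hK cv i1 i2 s0; pose d := s / 8.
have d0 : 0 < d by rewrite divr_gt0.
have mI := measurable_Icc (0:R) 1.
have mk k : measurable_fun (Icc 0 1 : set lineT) (EFin \o kcut u1 u2 d k).
  by apply: measurable_funTS; apply/measurable_EFinP; exact: measurable_kcut.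
have [| | |_ + _] := @dominated_convergence _ lineT R lam (Icc 0 1) mI
  (fun n t => (kcut u1 u2 d (Kn n) t)%:E) (fun t => (kcut u1 u2 d K t)%:E) (cst 1%E)
  (fun n => mk (Kn n)) (mk K).
- apply: ae_imp (cv Kn K hKn hK) => t h; rewrite /Icc /= in_itv/= => it.
  have bd : exists M, forall z, `|cutoff2 u1 u2 d z| <= M.
    by exists 1 => z; have /andP[a b] := cutoff201 u1 u2 d z; rewrite ger0_norm.
  have := h it _ (@continuous_cutoff2 u1 u2 d) bd.
  rewrite -(kcutE u1 u2 d K t).1 => hc; apply: cvg_trans hc.
  by rewrite (_ : (fun n => _) = (fun n => \int[Kn n t]_x (cutoff2 u1 u2 d x)%:E)%E)//;
    apply/funext => n; rewrite (kcutE u1 u2 d (Kn n) t).1.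
- apply/integrableP; split; first exact: measurable_cst.
  rewrite (eq_integral (cst 1%E)); last by move=> t _; rewrite /= normr1.
  by rewrite integral_cst// mul1e; apply: (@le_lt_trans _ _ (lam (Icc 0%R 1%R))) => //; rewrite lam_Icc01 ltry.
- apply: aeW => t n _; rewrite /= lee_fin ger0_norm; by case/andP: (kcutE u1 u2 d (Kn n) t).2.
move/fine_cvgP => [rfin /cvgrPdist_lt/(_ _ (divr_gt0 s0 (ltr0n R 2)))].
move: rfin; apply: filterS2 => n /= rfin.
rewrite sub0r normrN => rs.
rewrite -lte_fin; apply: le_lt_trans (gdist_le_kcut d0 i1 i2 hC (hCn n) hK (hKn n)) _.
have -> : s = s / 2 + 4 * d by rewrite /d; field.
rewrite EFinD lteD2rE//; set I := (X in (X < _)%E).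
have rfin' : I \is a fin_num by exact: rfin.
rewrite -(fineK rfin') lte_fin; exact: le_lt_trans (ler_norm _) rs.
Qed.

Lemma wcc_nowhere_dense :
  nowhere_dense_in (@copula3 R) (seq_open (@copula3 R) (@wcc R)) (@simplified R).
Proof.
apply: nowhere_dense_of_avoiding; first by move=> U [].
  by move=> C [].
move=> U C [UX Uo] UC; have hC : is_copula3 C := UX _ UC.
pose e (n : nat) : R := (n.+1%:R)^-1.
have e0 n : 0 < e n by rewrite invr_gt0 ltr0n.
have e1 n : e n <= 1 by rewrite invf_le1 ?ltr0n// ler1n.
have ie n : in01 (e n) by rewrite /in01 ltW ?e0//= e1.
have ecv : e @ \oo --> (0 : R) by exact: cvg_harmonic.
have /choice[T hT] : forall n, exists T : set lineT, exists eta : R,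
    [/\ measurable T, 0 < eta &
    forall K K' C', is_cond_kernel (mix (e n) C (split_copula T)) K ->
      simplified C' -> is_cond_kernel C' K' -> ~ test_close K eta K'].
  by move=> n; exact: separation.
have mT n : measurable (T n) by have [? []] := hT n.
have hE n : is_copula3 (split_copula (T n)) by exact: split_copula3.
have cv := wcc_mix hC hE ie ecv.
(* If every mixture lay outside [U], sequential openness would exclude their limit [C] from [U]. *)
have [n Un] : exists n, U (mix (e n) C (split_copula (T n))).
  apply: contrapT => /forallNP hn; apply: (Uo _ C _ hC cv UC) => n; split; last exact: hn.
  exact: mix_copula3.
have [eta [_ eta0 sep]] := hT n.
have [K hK] := cond_kernel_exists (UX _ Un).
exists (test_nbhs (@copula3 R) K eta), (mix (e n) C (split_copula (T n))); split => //.
(* A sequence outside the test neighbourhood cannot converge to a point inside: its three distances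
   to the limit eventually fall below the slack there. *)
- split; first by move=> ? [].
  move=> xn x hxn hx cvx [_ [K1 hK1 cl1]].
  have hxn1 m : is_copula3 (xn m) by case: (hxn m).
  have [s s0 slack] := test_close_slack cl1.
  have /choice[Kn hKn] : forall m, exists K, is_cond_kernel (xn m) K.
    by move=> m; exact: cond_kernel_exists.
  have i1 := in01_1 R; have ih := in01_half R.
  have g u1 u2 (j1 : in01 u1) (j2 : in01 u2) := wcc_gdist hxn1 hx hKn hK1 cvx j1 j2 s0.
  have [N _ /(_ N (leqnn N)) [h1 [h2 h3]]] := filterI (g _ _ ih ih) (filterI (g _ _ ih i1) (g _ _ i1 ih)).
  have [_] := hxn N; apply; split; first exact: hxn1.
  by exists (Kn N) => //; apply: slack; split.
- apply: test_nbhs_self => //; exact: UX.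
- apply/seteqP; split => // C' [[_ [K' hK' cl]] SC'].
  exact: (sep _ _ _ hK SC' hK').
Qed.

End WeakConditionalTopology.

Theorem theorem3p9 (R : realType) :
  [/\ nowhere_dense_in (@copula3 R) (metric_open (@copula3 R) (@D1 R)) (@simplified R),
      nowhere_dense_in (@copula3 R) (metric_open (@copula3 R) (@Dinf R)) (@simplified R),
      nowhere_dense_in (@copula3 R) (seq_open (@copula3 R) (@wcc R)) (@simplified R),
      nowhere_dense_in (@ac_pos R) (metric_open (@ac_pos R) (@D1 R))
        (@simplified R `&` @ac_pos R) &
      nowhere_dense_in (@ac_pos R) (metric_open (@ac_pos R) (@Dinf R))
        (@simplified R `&` @ac_pos R)].
Proof.
have acC : @ac_pos R `<=` @copula3 R by move=> C [].
have mixC C e (T : set (measurableTypeR R)) : copula3 C -> 0 < e -> e < 1 -> measurable T ->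
    copula3 (mix e C (split_copula T)).
  by move=> hC e0 e1 mT; apply: mix_copula3 => //; [rewrite /in01 !ltW|exact: split_copula3].
split.
- by apply: metric_nowhere_dense => //; [move=> C []|exact: D1_le|exact: D1_test_close].
- by apply: metric_nowhere_dense => //; [move=> C []|exact: Dinf_le|exact: Dinf_test_close].
- exact: wcc_nowhere_dense.
- apply: metric_nowhere_dense; [exact: acC|exact: subIsetr|exact: subIsetl|..].
  + exact: mix_ac_pos.
  + exact: D1_le.
  + exact: D1_test_close.
- apply: metric_nowhere_dense; [exact: acC|exact: subIsetr|exact: subIsetl|..].
  + exact: mix_ac_pos.
  + exact: Dinf_le.
  + exact: Dinf_test_close.
Qed.
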